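(* Let $G$ be a compact connected Lie group and let $V$ be a finite-dimensional real orthogonal representation space of $G$. Let $V_{\mathrm{princ}}\subset V$ be the union of all principal orbits. Then the function $V_{\mathrm{princ}}\to\mathbf{R}$, $v\mapsto \mathrm{vol}(Gv)^2$, extends uniquely to a $G$-invariant homogeneous polynomial function on $V$. Moreover, this polynomial can be expressed as a (finite) sum of squares of real polynomials on $V$.
   Context: An element $v\in V$ and its orbit $Gv$ are called regular if $\dim Gv$ is maximal among the $G$-orbits in $V$. For $v$ regular, $Gv$ is called a principal orbit if in addition the number of connected components of the isotropy group $G_v$ is as small as possible. By the principal orbit type theorem, the union of all principal orbits is open and dense in $V$. Here $\mathrm{vol}(Gv)$ denotes the $m$-dimensional Riemannian volume of the orbit $Gv$ with the metric induced from the Euclidean space $V$, where $m$ is the dimension of the principal orbits. *)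

(* Defs.v *)
From HB Require Import structures.
From mathcomp Require Import all_boot all_order all_algebra.
From mathcomp Require Import all_classical all_reals all_analysis.
From mathcomp Require mpoly.

Set Implicit Arguments.
Unset Strict Implicit.
Unset Printing Implicit Defensive.

Import Order.TTheory GRing.Theory Num.Theory.
Import numFieldNormedType.Exports.

Local Open Scope classical_set_scope.
Local Open Scope ring_scope.

(* Meaningful for U open: full (not one-sided) limits are taken at the points
   of U, and f is unconstrained outside U. *)
Fixpoint Ck (R : realType) (V W : normedModType R) (k : nat) (U : set V)
    (f : V -> W) : Prop :=
  if k is k'.+1 then
    (forall x, U x -> differentiable f x) /\
    (forall v, Ck k' U (fun x => 'D_v f x))
  else forall x, U x -> {for x, continuous f}.

Definition smooth (R : realType) (V W : normedModType R) (U : set V)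
    (f : V -> W) : Prop := forall k, Ck k U f.

HB.structure Definition PreTopologicalGroup := {G of Topological G & Group G}.

HB.mixin Record isTopologicalGroup G & PreTopologicalGroup G := {
  mulg_continuous : continuous (fun p : G * G => (p.1 * p.2)%g) ;
  invg_continuous : continuous (fun x : G => (x^-1)%g) }.

#[short(type="topologicalGroupType")]
HB.structure Definition TopologicalGroup :=
  {G of PreTopologicalGroup G & isTopologicalGroup G}.

(* [cmap] and [cinv] are total functions; only their values on [cdom] and on
   [cimg], respectively, are meaningful. *)
Record chart (R : realType) (T : topologicalType) (d : nat) := Chart {
  cdom : set T ;
  cmap : T -> 'rV[R]_d ;
  cinv : 'rV[R]_d -> T ;
  cimg := cmap @` cdom ;
  cdom_open : open cdom ;
  cimg_open : open cimg ;
  cmapK : forall x, cdom x -> cinv (cmap x) = x ;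
  cmap_continuous : forall x, cdom x -> {for x, continuous cmap} ;
  cinv_continuous : forall y, cimg y -> {for y, continuous cinv} }.

HB.mixin Record isLieGroup (R : realType) G & TopologicalGroup G := {
  lie_hausdorff : hausdorff_space G ;
  lie_second_countable : @second_countable G ;
  lie_dim : nat ;
  atlas : set (chart R G lie_dim) ;
  atlas_cover : \bigcup_(a in atlas) cdom a = [set: G] ;
  atlas_compat : forall a b, atlas a -> atlas b ->
    smooth (cmap a @` (cdom a `&` cdom b)) (cmap b \o cinv a) ;
  mulg_smooth : forall a b c, atlas a -> atlas b -> atlas c ->
    smooth [set p : 'rV[R]_lie_dim * 'rV[R]_lie_dim |
             [/\ cimg a p.1, cimg b p.2 & cdom c (cinv a p.1 * cinv b p.2)%g]]
           (fun p => cmap c (cinv a p.1 * cinv b p.2)%g) ;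
  invg_smooth : forall a b, atlas a -> atlas b ->
    smooth [set x | cimg a x /\ cdom b ((cinv a x)^-1)%g]
           (fun x => cmap b ((cinv a x)^-1)%g) }.

#[short(type="lieGroupType")]
HB.structure Definition LieGroup (R : realType) :=
  {G of TopologicalGroup G & isLieGroup R G}.

(* The representation space is R^n with its standard inner product u^T v. *)
Record orthogonal_representation (R : realType) (G : lieGroupType R) (n : nat)
    (rho : G -> 'M[R]_n) : Prop := OrthogonalRepresentation {
  rep_mul : forall g h, rho (g * h)%g = rho g *m rho h ;
  rep_orthogonal : forall g, (rho g)^T *m rho g = 1%:M ;
  rep_smooth : forall a, atlas (s := G) a -> smooth (cimg a) (rho \o cinv a) }.

Section Submanifold.
Variables (R : realType) (m n : nat).
Implicit Types (M : set 'cV[R]_n) (U : set 'rV[R]_m) (phi : 'rV[R]_m -> 'cV[R]_n).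

(* The last two conditions say that phi is a homeomorphism of U onto a
   relatively open subset of M. *)
Record local_parametrization M U phi : Prop := LocalParametrization {
  lp_open : open U ;
  lp_smooth : smooth U phi ;
  lp_immersion : forall x, U x -> injective ('d phi x) ;
  lp_injective : forall x y, U x -> U y -> phi x = phi y -> x = y ;
  lp_relopen : forall O, open O -> O `<=` U ->
    exists2 W : set 'cV[R]_n, open W & phi @` O = M `&` W }.

Definition submanifold M : Prop := forall p, M p ->
  exists U phi, local_parametrization M U phi /\ (phi @` U) p.

(* The metric induced from R^n, in the coordinates phi. *)
Definition first_fundamental_form phi (x : 'rV[R]_m) : 'M[R]_m :=
  \matrix_(i, j)
    (('D_(delta_mx 0 i) phi x)^T *m ('D_(delta_mx 0 j) phi x)) 0 0.

End Submanifold.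

(* A nonempty submanifold has exactly one dimension. *)
Definition dimension (R : realType) (n : nat) (M : set 'cV[R]_n) : nat :=
  xget 0%N [set d | @submanifold R d n M].

Section LebesgueMeasure.
Variable R : realType.
Local Notation mR := (measurableTypeR R).
(* [pushforward] together with its canonical measure structure. *)
Local Notation pushforward_measure :=
  measure_function_pushforward__canonical__measure_function_Measure.

Definition tcons m (p : m.-tuple mR * mR) : m.+1.-tuple mR :=
  [tuple of p.2 :: p.1].

Lemma measurable_tcons m : measurable_fun setT (@tcons m).
Proof. by apply: (@measurable_cons _ _ _ _ snd m fst). Qed.

(* m-dimensional Lebesgue measure; for m = 0 it is the unit mass at the unique
   point. *)
Fixpoint lebesgue_tuple m : {measure set (m.-tuple mR) -> \bar R} :=
  if m is m'.+1 then
    pushforward_measure (lebesgue_tuple m' \x lebesgue_measure)%E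
      (@measurable_tcons m')
  else dirac [tuple].

End LebesgueMeasure.

Definition row_of_tuple (R : realType) m (t : m.-tuple (measurableTypeR R)) :
  'rV[R]_m := \row_i tnth t i.

(* Riemannian volume of a compact m-dimensional submanifold M: the sum of the
   coordinate integrals over a finite partition of M into Borel pieces, each
   lying in one coordinate patch. By the change of variables formula all
   partitions give the same value, so the infimum only serves to name it. *)
Definition riemannian_volume (R : realType) (m n : nat) (M : set 'cV[R]_n) :
    \bar R :=
  ereal_inf [set s | exists (k : nat) (U : 'I_k -> set 'rV[R]_m)
      (phi : 'I_k -> 'rV[R]_m -> 'cV[R]_n)
      (A : 'I_k -> set (m.-tuple (measurableTypeR R))),
    let piece i := (phi i \o @row_of_tuple R m) @` A i in
    [/\ forall i, local_parametrization M (U i) (phi i),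
        forall i, measurable (A i) /\ (@row_of_tuple R m) @` A i `<=` U i,
        trivIset setT piece,
        \bigcup_i piece i = M &
        s = (\sum_(i < k) \int[lebesgue_tuple R m]_(t in A i)
               (Num.sqrt (\det (first_fundamental_form (phi i)
                                  (row_of_tuple t))))%:E)%E]].

Section Orbits.
Variables (R : realType) (G : lieGroupType R) (n : nat) (rho : G -> 'M[R]_n).
Implicit Types v w : 'cV[R]_n.

Definition orbit v : set 'cV[R]_n := range (fun g => rho g *m v).

Definition isotropy v : set G := [set g | rho g *m v = v].

Definition regular v : Prop :=
  forall w, (dimension (orbit w) <= dimension (orbit v))%N.

Definition components v : set (set G) :=
  connected_component (isotropy v) @` isotropy v.

Definition principal v : Prop :=
  regular v /\ forall w, regular w -> (components v #<= components w)%card.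

Definition Vprinc : set 'cV[R]_n := \bigcup_(v in principal) orbit v.

Definition orbit_volume v : \bar R :=
  riemannian_volume (dimension (orbit v)) (orbit v).

End Orbits.

Notation "{ 'mpoly' R [ n ] }" := (mpoly.mpoly n R)
  (at level 0, R at level 2, n at level 9, format "{ 'mpoly'  R [ n ] }")
  : type_scope.

Section Polynomials.
Import (canonicals, coercions) mpoly.
Variables (R : realType) (n : nat).
Implicit Types P : {mpoly R[n]}.

Definition poly_eval P (v : 'cV[R]_n) : R := mpoly.meval (fun i => v i 0) P.

Definition homogeneous P : Prop :=
  exists d : nat, P \is mpoly.ishomog1 d mpoly.mdeg.

Definition sum_of_squares P : Prop :=
  exists s : seq {mpoly R[n]}, P = \sum_(q <- s) q ^+ 2.

End Polynomials.

(* Main.v *)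
(* For v in V let k v be the tangent space of Gv at v, where k is the Lie
   algebra of rho(G), and let Z_1, ..., Z_N be an orthonormal basis of k for the
   trace form. With m the dimension of the principal orbits, let Phi(v) be the
   sum of the squares of the m x m minors of the matrix with rows Z_i v; it is
   homogeneous of degree 2m, and it is G-invariant because the adjoint action of
   G on k is orthogonal.

   If v and w have the same isotropy group, the equivariant map g v |-> g w is a
   diffeomorphism from Gv to Gw. Its differential maps X p to X q for X in k, so
   by the Cauchy-Binet formula it multiplies the determinant of the first
   fundamental form by the constant Phi(w) / Phi(v): hence
   vol(Gw)^2 / Phi(w) = vol(Gv)^2 / Phi(v). If v is the point of a principal
   orbit Gv closest to a principal w, then G_x is contained in both G_v and G_w
   for x in the open segment ]v, w[, so minimality of G_v and G_w gives
   G_v = G_w; so vol^2 = c Phi on V_princ with c >= 0. For an arbitrary u, the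
   same argument shows that a segment from a point of Gu to w has a principal
   interior, which gives uniqueness.

   No exponential map, inverse function theorem or Haar measure is used: one-
   parameter subgroups are replaced by powers e(x / N)^N in a chart e at 1, and
   charts of orbits come from compactness of G. *)
Require Import Defs.
From HB Require Import structures.
From mathcomp Require Import all_boot all_order all_algebra perm finmap ring lra.
From mathcomp Require Import all_classical all_reals all_analysis.
From mathcomp Require mpoly.

Set Implicit Arguments.
Unset Strict Implicit.
Unset Printing Implicit Defensive.

Import Order.TTheory GRing.Theory Num.Theory.
Import numFieldNormedType.Exports.

Local Open Scope classical_set_scope.
Local Open Scope ring_scope.

(** * Matrices: norms, orthonormal rows, minors *)

Section MatrixNorm.
Variable R : realType.

(** The crux is a quantitative lift, [local_lift]: if g v is close to v, then g v = e(x) v with |x|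
    at most C |g v - v|. Coordinates x may contain a part along the isotropy algebra that moves v
    hardly at all; it is removed by multiplying with a genuine isotropy element found near each
    kernel vector of the infinitesimal action, a step that contracts x down to the size of the
    displacement. The lift gives charts and tangent spaces of orbits, differentiability of the
    equivariant maps, and openness of G_x in G_v when G_x lies in G_v and their orbits have the same
    dimension.

    Comparing numbers of components yields equality of isotropy groups only once each G_v is known
    to have finitely many components, each open in G_v; the same contraction provides this.

    Since [riemannian_volume] is an infimum, volumes are compared by transporting decompositions: an
    equivariant map carries every admissible decomposition to an admissible one and multiplies its
    sum by one fixed constant, so the infimum scales too. One explicit decomposition with finite sum
    then allows squares to be computed in the reals. *)

Lemma mx_entry_norm m n (A : 'M[R]_(m, n)) i j : `|A i j| <= `|A|.
Proof.
rewrite [leRHS]/Num.Def.normr /= mx_normrE.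
exact: (le_bigmax _ (fun ij => `|A ij.1 ij.2|) (i, j)).
Qed.

Lemma mx_norm_le m n (A : 'M[R]_(m, n)) (c : R) :
  0 <= c -> (forall i j, `|A i j| <= c) -> `|A| <= c.
Proof.
move=> c0 h; rewrite [leLHS]/Num.Def.normr /= mx_normrE.
by apply/bigmax_leP; split=> // -[i j] _; exact: h.
Qed.

Lemma mulmx_norm m n p (A : 'M[R]_(m, n)) (B : 'M[R]_(n, p)) :
  `|A *m B| <= n%:R * `|A| * `|B|.
Proof.
apply: mx_norm_le => [|i j]; first by rewrite !mulr_ge0.
rewrite mxE (le_trans (ler_norm_sum _ _ _))//.
rewrite -[X in X%:R](card_ord n) -mulrA mulr_natl -sumr_const.
by apply: ler_sum => k _; rewrite normrM ler_pM//; exact: mx_entry_norm.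
Qed.

Lemma mxvec_norm m n (A : 'M[R]_(m, n)) : `|mxvec A| = `|A|.
Proof.
apply/eqP; rewrite eq_le; apply/andP; split; apply: mx_norm_le => // i j.
  rewrite ord1; case/mxvec_indexP: j => k l; rewrite mxvecE.
  exact: mx_entry_norm.
by rewrite -mxvecE; exact: mx_entry_norm.
Qed.

Lemma vec_mx_norm m n (A : 'rV[R]_(m * n)) : `|vec_mx A| = `|A|.
Proof. by rewrite -mxvec_norm vec_mxK. Qed.

Lemma trmx_norm m n (A : 'M[R]_(m, n)) : `|A^T| = `|A|.
Proof.
apply/eqP; rewrite eq_le; apply/andP; split; apply: mx_norm_le => // i j;
  first by rewrite mxE; exact: mx_entry_norm.
by have := mx_entry_norm A^T j i; rewrite mxE.
Qed.

Lemma sqr_sum_eq0 n (u : 'rV[R]_n) : u *m u^T = 0 -> u = 0.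
Proof.
move=> /matrixP/(_ 0 0); rewrite !mxE => /eqP.
rewrite psumr_eq0; last by move=> i _; rewrite mxE -expr2 sqr_ge0.
move=> /allP h; apply/rowP => i; rewrite mxE.
have := h i (mem_index_enum _); rewrite mxE -expr2 /= sqrf_eq0.
by move/eqP.
Qed.

Lemma mulmx_tr_eq0 m n (A : 'M[R]_(m, n)) : A *m A^T = 0 -> A = 0.
Proof.
move=> h; apply/row_matrixP => i; rewrite row0; apply: sqr_sum_eq0.
by rewrite tr_row -row_mul colE rowE !mulmxA -(mulmxA _ A) h mulmx0 mul0mx.
Qed.

(** Positivity: [y *m A *m A^T = 0] makes the Gram matrix of [y *m A] vanish, hence [y *m A]
    itself. *)
Lemma gram_unitmx m n (A : 'M[R]_(m, n)) :
  (A *m A^T \in unitmx) = row_free A.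
Proof.
apply/idP/idP => [h|fA].
  apply/row_freeP.
  by exists (A^T *m invmx (A *m A^T)); rewrite mulmxA mulmxV.
rewrite -row_free_unit -kermx_eq0; apply/eqP.
have h : kermx (A *m A^T) *m A = 0.
  apply: mulmx_tr_eq0; rewrite trmx_mul -mulmxA (mulmxA A).
  by rewrite mulmxA mulmx_ker mul0mx.
by apply: (row_free_inj fA); rewrite h mul0mx.
Qed.

(** The norm is the largest absolute entry, which orthogonal matrices do not preserve; their entries
    are at most 1, whence the factor [n] that recurs in the estimates on [rho]. *)
Lemma orthogonal_norm n k (O : 'M[R]_n) (v : 'M[R]_(n, k)) :
  O^T *m O = 1%:M -> `|O *m v| <= n%:R * `|v|.
Proof.
move=> h; rewrite (le_trans (mulmx_norm _ _))// ler_wpM2r//.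
rewrite ler_piMr// mx_norm_le// => i j.
have : \sum_l O l j ^+ 2 = 1.
  have /matrixP/(_ j j) := h; rewrite !mxE eqxx => E.
  by rewrite -[RHS]E; apply: eq_bigr => l _; rewrite mxE expr2.
rewrite (bigD1 i)//= => h1.
rewrite -(@ler_pXn2r _ 2) ?nnegrE// expr1n real_normK ?num_real// -h1 lerDl.
by apply: sumr_ge0 => ? _; rewrite sqr_ge0.
Qed.

(** The row space is the kernel of the bounded map [cokermx A]. In this form, limits of difference
    quotients can be placed in tangent spaces. *)
Lemma row_space_closed m n (A : 'M[R]_(m, n)) (y : 'rV[R]_n) :
  (forall e, 0 < e -> exists2 z, (z <= A)%MS & `|y - z| <= e) -> (y <= A)%MS.
Proof.
move=> h; rewrite submxE -normr_le0; apply/ler_addgt0Pr => e e0; rewrite add0r.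
set c := n%:R * `|cokermx A|.
have c0 : 0 <= c by rewrite mulr_ge0.
have [|z zA yz] := h (e / (c + 1)); first by rewrite divr_gt0// ltr_wpDl.
have -> : y *m cokermx A = (y - z) *m cokermx A.
  by move: zA; rewrite submxE => /eqP zA; rewrite mulmxBl zA subr0.
rewrite (le_trans (mulmx_norm _ _))// mulrAC -/c.
rewrite (le_trans (ler_wpM2l c0 yz))// mulrCA.
have c1 : 0 < c + 1 by rewrite ltr_wpDl.
by rewrite ler_piMr ?(ltW e0)// ler_pdivrMr// mul1r lerDl.
Qed.

End MatrixNorm.

Section OrthonormalRows.
Variable R : realType.

(** Gram-Schmidt by induction on the rank: a nonzero vector of the row space is normalized, and the
    rest is the intersection with its orthogonal complement. *)
Lemma orthonormal_row_base m n (A : 'M[R]_(m, n)) :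
  exists Z : 'M[R]_(\rank A, n), Z *m Z^T = 1%:M /\ (Z :=: A)%MS.
Proof.
suff: forall r m (A : 'M[R]_(m, n)), \rank A = r ->
    exists Z : 'M[R]_(r, n), Z *m Z^T = 1%:M /\ (Z :=: A)%MS.
  by move/(_ _ _ A erefl).
elim=> [|r IH] {}m {}A rA.
  exists 0; split; first by apply/matrixP => -[].
  by move/eqP: rA; rewrite mxrank_eq0 => /eqP ->; apply/eqmxP; rewrite !sub0mx.
pose u : 'rV[R]_n := nz_row A.
have u0 : u != 0 by rewrite nz_row_eq0 -mxrank_eq0 rA.
pose c := (u *m u^T) 0 0.
have c0 : 0 < c.
  rewrite lt_def; apply/andP; split; last first.
    by rewrite /c mxE sumr_ge0// => i _; rewrite mxE -expr2 sqr_ge0.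
  apply: contraNneq u0 => c0; apply/eqP/sqr_sum_eq0.
  by apply/matrixP => i j; rewrite !ord1 [LHS]c0 mxE.
pose e := (Num.sqrt c)^-1 *: u.
have ee : e *m e^T = 1%:M.
  apply/matrixP => i j; rewrite !ord1 [RHS]mxE eqxx mulr1n.
  rewrite linearZ -scalemxAl -scalemxAr scalerA mxE -/c.
  by rewrite -invfM -expr2 sqr_sqrtr ?ltW// mulVf ?gt_eqF.
have eA : (e <= A)%MS by rewrite scalemx_sub ?nz_row_sub.
pose B := (A :&: kermx e^T)%MS.
have Bker : B *m e^T = 0 by apply/sub_kermxP; exact: capmxSr.
have AE : (A :=: e + B)%MS.
  apply/eqmxP; rewrite addsmx_sub eA capmxSl !andbT.
  apply/row_subP => i.
  have -> : row i A = (row i A *m e^T) *m e + (row i A - (row i A *m e^T) *m e).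
    by rewrite addrC subrK.
  rewrite addmx_sub_adds ?submxMl// sub_capmx; apply/andP; split.
    by rewrite addmx_sub ?row_sub// eqmx_opp mulmx_sub.
  by apply/sub_kermxP; rewrite mulmxBl -(mulmxA _ e) ee mulmx1 subrr.
have dx : (e :&: B = 0)%MS.
  apply/eqP/rowV0P => w; rewrite sub_capmx => /andP[/sub_rVP[k ->]].
  move=> /submxP[D kD]; have : k *: e *m e^T = 0.
    by rewrite kD -mulmxA Bker mulmx0.
  rewrite -scalemxAl ee => /matrixP/(_ 0 0); rewrite !mxE mulr1 => ->.
  by rewrite scale0r.
have rB : \rank B = r.
  have := mxrank_disjoint_sum dx; rewrite -AE rA.
  have e0 : e != 0.
    apply/eqP => e0; move: ee; rewrite e0 mul0mx => /matrixP/(_ 0 0)/eqP.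
    by rewrite !mxE eq_sym oner_eq0.
  by rewrite rank_rV e0 add1n => -[].
have [Z [ZZ ZB]] := IH _ B rB.
exists (col_mx e Z); split.
  rewrite (tr_col_mx e Z) (mul_col_row e Z e^T Z^T) ee ZZ.
  have -> : Z *m e^T = 0.
    by have /submxP[D ->] : (Z <= B)%MS by [rewrite ZB]; rewrite -mulmxA Bker mulmx0.
  have -> : e *m Z^T = 0.
    apply: trmx_inj; rewrite trmx_mul trmxK trmx0.
    by have /submxP[D ->] : (Z <= B)%MS by [rewrite ZB]; rewrite -mulmxA Bker mulmx0.
  by rewrite -scalar_mx_block.
exact: eqmx_trans (eqmx_trans (eqmx_sym (addsmxE e Z))
  (adds_eqmx (eqmx_refl e) ZB)) (eqmx_sym AE).
Qed.

End OrthonormalRows.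

(** * Cauchy-Binet and sums of squared minors *)

Section Minors.
Variable R : realType.

(** Summing over all maps instead of r-subsets produces the factor r!: non-injective maps contribute
    0 and the orderings of a subset contribute equally. After expansion over maps, averaging over
    the reindexings of f by permutations turns the product of entries of A into a determinant. *)
Lemma cauchy_binet r N (A : 'M[R]_(r, N)) (B : 'M[R]_(N, r)) :
  r`!%:R * \det (A *m B) =
  \sum_(f : {ffun 'I_r -> 'I_N}) \det (colsub f A) * \det (rowsub f B).
Proof.
have E : \det (A *m B) =
    \sum_(f : {ffun 'I_r -> 'I_N}) (\prod_i A i (f i)) * \det (rowsub f B).
  rewrite /determinant.
  transitivity (\sum_(s : 'S_r) \sum_(f : {ffun 'I_r -> 'I_N})
     (-1) ^+ s * \prod_i (A i (f i) * B (f i) (s i))).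
    apply: eq_bigr => s _; rewrite -big_distrr /=; congr (_ * _).
    rewrite -(bigA_distr_bigA (fun i k => A i k * B k (s i))) /=.
    by apply: eq_bigr => i _; rewrite mxE.
  rewrite exchange_big /=; apply: eq_bigr => f _.
  rewrite big_distrr /=; apply: eq_bigr => s _.
  rewrite big_split /= mulrCA; congr (_ * _).
  by congr (_ * _); apply: eq_bigr => i _; rewrite mxE.
have -> : r`!%:R * \det (A *m B) = \sum_(s : 'S_r) \det (A *m B).
  by rewrite sumr_const card_Sn mulr_natl.
transitivity (\sum_(s : 'S_r) \sum_(f : {ffun 'I_r -> 'I_N})
    (-1) ^+ s * (\prod_i A i (f (s i))) * \det (rowsub f B)).
  apply: eq_bigr => s _; rewrite {}E.
  rewrite (reindex_inj (h := fun f : {ffun 'I_r -> 'I_N} =>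
    [ffun i => f (s i)])) /=; last first.
    move=> f g /ffunP h; apply/ffunP => i.
    by have := h (s^-1 i)%g; rewrite !ffunE permKV.
  apply: eq_bigr => f _.
  have -> : rowsub [ffun i => f (s i)] B = row_perm s (rowsub f B).
    by apply/matrixP => i j; rewrite !mxE ffunE.
  rewrite row_permE det_mulmx det_perm mulrA; congr (_ * _).
  rewrite mulrC; congr (_ * _); apply: eq_bigr => i _; by rewrite ffunE.
rewrite exchange_big /=; apply: eq_bigr => f _.
rewrite -big_distrl /=; congr (_ * _).
by apply: eq_bigr => s _; congr (_ * _); apply: eq_bigr => i _; rewrite mxE.
Qed.

(** Rows and columns are selected by arbitrary maps, so every squared minor is counted (r!)^2 times;
    the factor cancels in the ratios that matter. *)
Definition sqminors r N n (B : 'M[R]_(N, n)) : R :=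
  \sum_(f : {ffun 'I_r -> 'I_N}) \sum_(h : {ffun 'I_r -> 'I_n})
    \det (mxsub f h B) ^+ 2.

Lemma sqminors_gram r N n (B : 'M[R]_(N, n)) :
  sqminors r B = r`!%:R *
    \sum_(f : {ffun 'I_r -> 'I_N}) \det (rowsub f B *m (rowsub f B)^T).
Proof.
rewrite /sqminors mulr_sumr; apply: eq_bigr => f _.
rewrite cauchy_binet; apply: eq_bigr => h _.
rewrite expr2; congr (_ * _).
  by congr (\det _); apply/matrixP => i j; rewrite !mxE.
by rewrite -[RHS]det_tr; congr (\det _); apply/matrixP => i j; rewrite !mxE.
Qed.

Lemma sqminors_tr r N n (B : 'M[R]_(N, n)) : sqminors r B^T = sqminors r B.
Proof.
rewrite /sqminors exchange_big; apply: eq_bigr => f _; apply: eq_bigr => h _.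
by rewrite -det_tr; congr (\det _ ^+ 2); apply/matrixP => i j; rewrite !mxE.
Qed.

(** Only Gram matrices of selected rows enter, by [sqminors_gram], and [U] cancels in them. *)
Lemma sqminors_isometryr r N n k (B : 'M[R]_(N, n)) (U : 'M[R]_(n, k)) :
  U *m U^T = 1%:M -> sqminors r (B *m U) = sqminors r B.
Proof.
move=> h; rewrite !sqminors_gram; congr (_ * _); apply: eq_bigr => f _.
rewrite (_ : rowsub f (B *m U) = rowsub f B *m U); last first.
  by apply/matrixP => i j; rewrite !mxE; apply: eq_bigr => l _; rewrite mxE.
by rewrite trmx_mul -mulmxA (mulmxA U) h mul1mx.
Qed.

Lemma sqminors_isometryl r N n k (B : 'M[R]_(N, n)) (U : 'M[R]_(k, N)) :
  U^T *m U = 1%:M -> sqminors r (U *m B) = sqminors r B.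
Proof.
move=> h; rewrite -sqminors_tr trmx_mul sqminors_isometryr ?sqminors_tr//.
by rewrite trmxK.
Qed.

Lemma det_gram_mul r n (A : 'M[R]_r) (P : 'M[R]_(r, n)) :
  \det ((A *m P) *m (A *m P)^T) = \det A ^+ 2 * \det (P *m P^T).
Proof.
by rewrite trmx_mul -mulmxA (mulmxA P) !det_mulmx det_tr mulrCA -expr2 mulrC.
Qed.

Lemma sqminors_factor r N n (C : 'M[R]_(N, r)) (P : 'M[R]_(r, n)) :
  sqminors r (C *m P) = \det (P *m P^T) *
    (r`!%:R * \sum_(f : {ffun 'I_r -> 'I_N}) \det (rowsub f C) ^+ 2).
Proof.
rewrite sqminors_gram mulrCA; congr (_ * _); rewrite mulr_sumr.
apply: eq_bigr => f _.
rewrite (_ : rowsub f (C *m P) = rowsub f C *m P); last first.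
  by apply/matrixP => i j; rewrite !mxE; apply: eq_bigr => l _; rewrite mxE.
by rewrite det_gram_mul mulrC.
Qed.

Lemma sqminors_ge0 r N n (B : 'M[R]_(N, n)) : 0 <= sqminors r B.
Proof. by do 2![apply: sumr_ge0 => ? _]; rewrite sqr_ge0. Qed.

Lemma sqminors_gt0 N n (B : 'M[R]_(N, n)) : 0 < sqminors (\rank B) B.
Proof.
rewrite lt_def sqminors_ge0 andbT -{2}(mulmx_base B) sqminors_factor.
rewrite mulf_neq0//.
  by have := row_base_free B; rewrite -gram_unitmx unitmxE unitfE.
have [D /(congr1 determinant)] := row_fullP (col_base_full B).
rewrite det1 => h.
apply: mulf_neq0; first by rewrite pnatr_eq0 -lt0n fact_gt0.
apply/eqP => /eqP.
rewrite psumr_eq0 => [/allP h0|*]; last exact: sqr_ge0.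
(* If all maximal minors of [col_base B] vanished, Cauchy-Binet for its left inverse [D] would give
   r! = 0. *)
have := @cauchy_binet _ _ D (col_base B); rewrite h mulr1 big1 => [/eqP|f _].
  by rewrite pnatr_eq0 => /eqP f0; have := fact_gt0 (\rank B); rewrite f0.
have := h0 f (mem_index_enum _); rewrite /= sqrf_eq0 => /eqP ->.
by rewrite mulr0.
Qed.

(* Two matrices with the same left kernel factor through a common full-rank
   matrix, which multiplies all Gram determinants by the same factor. *)
Lemma gram_ratio r N n n' (B : 'M[R]_(N, n)) (B' : 'M[R]_(N, n'))
    (b : 'M[R]_(r, N)) :
  \rank B = r -> (forall c : 'rV[R]_N, c *m B = 0 -> c *m B' = 0) ->
  \det ((b *m B') *m (b *m B')^T) * sqminors r B =
  \det ((b *m B) *m (b *m B)^T) * sqminors r B'.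
Proof.
move=> rB kerB.
have [C [D [DC BE]]] : exists (C : 'M[R]_(N, r)) D, D *m C = 1%:M /\
    B = C *m (D *m B).
  case: _ / rB.
  have [D DC] := row_fullP (col_base_full B).
  exists (col_base B), D; split => //.
  suff -> : D *m B = row_base B by rewrite mulmx_base.
  by move/(congr1 (mulmx^~ (row_base B))): DC; rewrite /= -mulmxA mulmx_base mul1mx.
have B'E : B' = C *m (D *m B').
  apply/eqP; rewrite -subr_eq0; apply/eqP/row_matrixP => i; rewrite row0.
  rewrite mulmxA -[X in X - _]mul1mx -mulmxBl row_mul kerB//.
  by rewrite -row_mul mulmxBl mul1mx -mulmxA -BE subrr row0.
move: (D *m B) (D *m B') BE B'E => P P' -> ->.
rewrite !sqminors_factor !(mulmxA b) !det_gram_mul.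
by ring.
Qed.

End Minors.

(** * Calculus for functions of class C^k *)

Section NormedModContinuity.
Variables (R : realType) (V : normedModType R).

Lemma addl_continuous (a : V) : continuous (+%R a).
Proof.
move=> x; apply/cvgrPdist_le => e e0.
have /cvgrPdist_le/(_ e e0) := @cvg_id _ (nbhs x).
by apply: filterS => y; rewrite opprD addrACA subrr add0r.
Qed.

Lemma dist_continuous (a : V) : continuous (fun y => `|y - a|).
Proof.
move=> x; apply/cvgrPdist_le => e e0.
have /cvgrPdist_le/(_ e e0) := @cvg_id _ (nbhs x).
apply: filterS => y; apply: le_trans; rewrite (le_trans (ler_dist_dist _ _))//.
by rewrite opprB addrA subrK.
Qed.

End NormedModContinuity.

Section DifferentialEps.
Variables (R : realType) (V W : normedModType R).

Lemma diff_eps (f : V -> W) x (e : R) : differentiable f x -> 0 < e ->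
  \forall h \near 0, `|f (h + x) - f x - 'd f x h| <= e * `|h|.
Proof.
move=> /diff_locallyP[_ /eqaddoP h] e0; apply: filterS (h _ e0) => y.
by rewrite -[X in _ -> `|X| <= _]addrA -opprD.
Qed.

Lemma eps_diff (f : V -> W) x (df : {linear V -> W}) : continuous df ->
  (forall e, 0 < e ->
    \forall h \near 0, `|f (h + x) - f x - df h| <= e * `|h|) ->
  differentiable f x /\ 'd f x = df :> (V -> W).
Proof.
move=> cdf h.
have H : f \o shift x = cst (f x) + df +o_ 0 id.
  apply: eqaddoE; apply/eqaddoP => e e0.
  apply: filterS (h _ e0) => y.
  by rewrite -[X in `|X| <= _ -> _]addrA -opprD.
have E := diff_unique cdf H.
by split => //; apply/diff_locallyP; rewrite E.
Qed.

Lemma near_eq_differentiable (f g : V -> W) x :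
  (\forall y \near x, f y = g y) -> differentiable f x -> differentiable g x.
Proof.
move=> fg df.
have [] // := @eps_diff g x ('d f x) (diff_continuous df).
move=> e e0; have gx := nbhs_singleton fg.
have fg' : \forall h \near 0, f (h + x) = g (h + x).
  by rewrite (near_shift x)/=; near=> y; rewrite /= sub0r subrK; near: y.
near=> h; rewrite -gx.
have <- : f (h + x) = g (h + x) by near: h.
by near: h; exact: diff_eps.
Unshelve. all: by end_near. Qed.

End DifferentialEps.

Section CkGeneral.
Variables (R : realType) (V W : normedModType R).
Implicit Types (U : set V) (f g : V -> W).

Lemma Ck_sub k U U' f : U' `<=` U -> Ck k U f -> Ck k U' f.
Proof.
move=> UU'; elim: k f => [|k IH] f /=; first by move=> h x /UU'; exact: h.
by case=> h1 h2; split=> [x /UU'|v]; [exact: h1|apply/IH/h2].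
Qed.

(** [Ck] takes full limits at each point of the set, so it can be checked point by point, with a
    local formula chosen anew at each of them. *)
Lemma Ck_pointwise k U f : (forall x, U x -> Ck k [set x] f) -> Ck k U f.
Proof.
elim: k f => [|k IH] f /= h; first by move=> x Ux; exact: (h x Ux x).
split=> [x Ux|v]; first by have [+ _] := h x Ux; exact.
by apply: IH => x Ux; have [_] := h x Ux; exact.
Qed.

Lemma Ck_ext k U f g : open U -> (forall x, U x -> f x = g x) ->
  Ck k U f -> Ck k U g.
Proof.
move=> oU; elim: k f g => [|k IH] f g fg /=.
  move=> h x Ux; have := h x Ux.
  rewrite /prop_for /continuous_at -fg// => fx.
  apply: cvg_trans fx; apply: near_eq_cvg.
  by near=> y; apply: fg; near: y; exact: open_nbhs_nbhs.
have nfg x : U x -> \forall y \near x, f y = g y.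
  by move=> Ux; near=> y; apply: fg; near: y; exact: open_nbhs_nbhs.
case=> h1 h2; split=> [x Ux|v].
  by apply: near_eq_differentiable (h1 _ Ux); exact: nfg.
apply: IH (h2 v) => x Ux; apply: near_eq_derive; exact: nfg.
Unshelve. all: by end_near. Qed.

Lemma Ck_continuous k U f x : Ck k U f -> U x -> {for x, continuous f}.
Proof.
case: k => [|k] /=; first exact.
by case=> h _ Ux; apply: differentiable_continuous; exact: h.
Qed.

Lemma CkW k U f : Ck k.+1 U f -> Ck k U f.
Proof.
elim: k f => [|k IH] f; first by move=> h x; exact: (Ck_continuous h).
by move=> [h1 h2]; split=> // v; apply: IH; exact: h2.
Qed.

Lemma Ck_cst k U (c : W) : Ck k U (cst c).
Proof.
elim: k c => [|k IH] c /=; first by move=> x _; exact: cst_continuous.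
split=> [x _|v]; first exact: differentiable_cst.
rewrite (_ : (fun x => 'D_v (cst c) x) = cst 0)//.
by apply/funext => x; exact: derive_cst.
Qed.

End CkGeneral.

Section CkReal.
Variables (R : realType) (V : normedModType R) (U : set V).
Hypothesis oU : open U.
Implicit Types (f g : V -> R).

Lemma CkD k f g : Ck k U f -> Ck k U g -> Ck k U (fun x => f x + g x).
Proof.
elim: k f g => [|k IH] f g /=.
  by move=> h1 h2 x Ux; apply: cvgD; [exact: h1|exact: h2].
move=> [df f'] [dg g']; split=> [x Ux|v].
  by apply: differentiableD; [exact: df|exact: dg].
apply: (@Ck_ext _ _ _ _ _ (fun x => 'D_v f x + 'D_v g x)) => //; last exact: IH.
by move=> x Ux; rewrite deriveD//; exact/diff_derivable/df || exact/diff_derivable/dg.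
Qed.

Lemma CkM k f g : Ck k U f -> Ck k U g -> Ck k U (fun x => f x * g x).
Proof.
elim: k f g => [|k IH] f g.
  by move=> h1 h2 x Ux; apply: cvgM; [exact: h1|exact: h2].
move=> hf hg; have [df f'] := hf; have [dg g'] := hg; split=> [x Ux|v].
  by apply: differentiableM; [exact: df|exact: dg].
apply: (@Ck_ext _ _ _ _ _ (fun x => f x * 'D_v g x + g x * 'D_v f x)) => //.
  move=> x Ux; rewrite deriveM//; exact/diff_derivable/df || exact/diff_derivable/dg.
by apply: CkD; [exact: IH (CkW hf) (g' v)|exact: IH (CkW hg) (f' v)].
Qed.

Lemma CkN k f : Ck k U f -> Ck k U (fun x => - f x).
Proof.
move=> h; apply: (@Ck_ext _ _ _ _ _ (fun x => -1 * f x)) => //.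
  by move=> x _; rewrite mulN1r.
by apply: CkM => //; exact: Ck_cst.
Qed.

Lemma CkV k f : (forall x, U x -> f x != 0) ->
  Ck k U f -> Ck k U (fun x => (f x)^-1).
Proof.
move=> f0; elim: k => [|k IH].
  by move=> h x Ux; apply: cvgV; [exact: f0|exact: h].
move=> hf; have [df f'] := hf; split=> [x Ux|v].
  by apply: differentiableV; [exact: df|exact: f0].
have h := IH (CkW hf).
apply: (@Ck_ext _ _ _ _ _ (fun x => - (((f x)^-1 * (f x)^-1) * 'D_v f x))) => //.
  move=> x Ux; rewrite deriveV; [|exact: f0|exact/diff_derivable/df].
  by rewrite scaleNr /GRing.scale/= expr2 invfM.
exact: (CkN (CkM (CkM h h) (f' v))).
Qed.

Lemma Ck_sum k (I : Type) (r : seq I) (P : pred I) (F : I -> V -> R) :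
  (forall i, P i -> Ck k U (F i)) -> Ck k U (fun x => \sum_(i <- r | P i) F i x).
Proof.
move=> h; rewrite (_ : (fun _ => _) = \big[(fun f g x => f x + g x)/cst 0]_(i <- r | P i) F i).
  by apply: big_ind; [exact: Ck_cst|move=> *; exact: CkD|exact: h].
apply/funext => x.
by apply: (big_ind2 (fun a (f : V -> R) => a = f x)) => // ? ? ? ? -> ->.
Qed.

Lemma Ck_prod k (I : Type) (r : seq I) (P : pred I) (F : I -> V -> R) :
  (forall i, P i -> Ck k U (F i)) -> Ck k U (fun x => \prod_(i <- r | P i) F i x).
Proof.
move=> h; rewrite (_ : (fun _ => _) = \big[(fun f g x => f x * g x)/cst 1]_(i <- r | P i) F i).
  by apply: big_ind; [exact: Ck_cst|move=> *; exact: CkM|exact: h].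
apply/funext => x.
by apply: (big_ind2 (fun a (f : V -> R) => a = f x)) => // ? ? ? ? -> ->.
Qed.

End CkReal.

Section MatrixFunctions.
Variables (R : realType) (V : normedModType R).

Lemma mx_continuousP m n (f : V -> 'M[R]_(m, n)) x :
  {for x, continuous f} <-> forall i j, {for x, continuous (fun y => f y i j)}.
Proof.
split=> [cf i j|cf].
  exact: (continuous_comp cf (@coord_continuous _ _ _ i j _)).
apply/cvgrPdist_le => e e0.
have : \forall y \near x, forall ij : 'I_m * 'I_n,
    `|f x ij.1 ij.2 - f y ij.1 ij.2| <= e.
  by apply: filter_forall => -[i j] /=; have /cvgrPdist_le := cf i j; exact.
apply: filterS => y h; apply: mx_norm_le => [|i j]; first exact: ltW.
by rewrite !mxE; exact: (h (i, j)).
Qed.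

Lemma mx_differentiableP m n (f : V -> 'M[R]_(m, n)) x :
  differentiable f x <-> forall i j, differentiable (fun y => f y i j) x.
Proof.
split=> [df i j|df].
  exact: (differentiable_comp df (differentiable_coord (f x) i j)).
rewrite (_ : f = \sum_(i < m) \sum_(j < n)
    (fun y => f y i j *: (delta_mx i j : 'M[R]_(m, n)))).
  by do 2![apply: differentiable_sum => ?]; exact: differentiableZl.
apply/funext => y; rewrite [LHS]matrix_sum_delta fct_sumE.
by apply: eq_bigr => i _; rewrite fct_sumE.
Qed.

Lemma Ck_mxP k m n (U : set V) (f : V -> 'M[R]_(m, n)) : open U ->
  Ck k U f <-> forall i j, Ck k U (fun y => f y i j).
Proof.
move=> oU; split=> [+ i j|].
  elim: k f => [|k IH] f /=; first by move=> h x /h /mx_continuousP.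
  case=> df f'; split=> [x Ux|v]; first by have /mx_differentiableP := df _ Ux.
  apply: (@Ck_ext _ _ _ _ _ (fun x => 'D_v f x i j)) => //; last exact: IH.
  by move=> x Ux; rewrite derive_mx ?mxE//; exact/diff_derivable/df.
elim: k f => [|k IH] f /= h.
  by move=> x Ux; apply/mx_continuousP => i j; exact: h.
have df x : U x -> differentiable f x.
  by move=> Ux; apply/mx_differentiableP => i j; have [+ _] := h i j; exact.
split=> // v; apply: IH => i j.
apply: (@Ck_ext _ _ _ _ _ ('D_v (fun y => f y i j))) => //.
  by move=> x Ux; rewrite derive_mx ?mxE//; exact/diff_derivable/df.
by have [_] := h i j; exact.
Qed.

Variable U : set V.
Hypothesis oU : open U.

Lemma Ck_mulmx k m n p (f : V -> 'M[R]_(m, n)) (g : V -> 'M[R]_(n, p)) :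
  Ck k U f -> Ck k U g -> Ck k U (fun x => f x *m g x).
Proof.
move=> /(Ck_mxP _ _ oU) hf /(Ck_mxP _ _ oU) hg; apply/Ck_mxP => // i j.
under eq_fun do rewrite mxE.
by apply: Ck_sum => // l _; exact: CkM.
Qed.

Lemma Ck_scalemx k m n (f : V -> R) (g : V -> 'M[R]_(m, n)) :
  Ck k U f -> Ck k U g -> Ck k U (fun x => f x *: g x).
Proof.
move=> hf /(Ck_mxP _ _ oU) hg; apply/Ck_mxP => // i j.
by under eq_fun do rewrite mxE; exact: CkM.
Qed.

Lemma Ck_trmx k m n (f : V -> 'M[R]_(m, n)) :
  Ck k U f -> Ck k U (fun x => (f x)^T).
Proof.
move=> /(Ck_mxP _ _ oU) hf; apply/Ck_mxP => // i j.
by under eq_fun do rewrite mxE.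
Qed.

Lemma Ck_det k n (f : V -> 'M[R]_n) : Ck k U f -> Ck k U (fun x => \det (f x)).
Proof.
move=> /(Ck_mxP _ _ oU) hf; apply: Ck_sum => // s _.
by apply: CkM => //; [exact: Ck_cst|exact: Ck_prod].
Qed.

Lemma Ck_adjmx k n (f : V -> 'M[R]_n) : Ck k U f -> Ck k U (fun x => \adj (f x)).
Proof.
move=> /(Ck_mxP _ _ oU) hf; apply/Ck_mxP => // i j.
under eq_fun do rewrite mxE /cofactor.
apply: CkM => //; first exact: Ck_cst.
apply: Ck_det; apply/Ck_mxP => // i' j'.
by under eq_fun do rewrite !mxE.
Qed.

End MatrixFunctions.

Section Affine.
Variables (R : realType) (V V' W : normedModType R).

Lemma Ck_comp_affine k (U : set V) (U' : set V') (L : {linear V -> V'}) a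
    (f : V' -> W) :
  continuous L -> (forall x, U x -> U' (a + L x)) ->
  Ck k U' f -> Ck k U (fun x => f (a + L x)).
Proof.
move=> cL UU'; elim: k f => [|k IH] f /=.
  move=> h x Ux; apply: (@continuous_comp _ _ _ (fun x => a + L x) f).
    by apply: cvgD; [exact: cvg_cst|exact: cL].
  by apply: h; exact: UU'.
case=> df f'.
have E v x : 'D_v (fun x => f (a + L x)) x = 'D_(L v) f (a + L x).
  have E : (fun h : R => h^-1 *: (f (a + L (h *: v + x)) - f (a + L x))) =
      (fun h : R => h^-1 *: (f (h *: L v + (a + L x)) - f (a + L x))).
    by apply/funext => h; rewrite linearP addrCA.
  by rewrite /derive /= E.
split=> [x Ux|v].
  apply: (@differentiable_comp _ _ _ _ (fun x => a + L x) f).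
    apply: differentiableD; first exact: differentiable_cst.
    by apply: linear_differentiable.
  exact/df/UU'.
rewrite (_ : (fun x => 'D_v _ x) = (fun x => 'D_(L v) f (a + L x))); last first.
  by apply/funext => x; exact: E.
exact: (IH _ (f' (L v))).
Qed.

Lemma derive_line (f : V -> W) (b v : V) (t : R) :
  ('D_1 (fun s : R => f (b + s *: v)) t = 'D_v f (b + t *: v)) *
  (derivable (fun s : R => f (b + s *: v)) t 1 = derivable f (b + t *: v) v).
Proof.
have E : (fun h : R => h^-1 *: (f (b + (h *: (1 : R) + t) *: v) - f (b + t *: v))) =
         (fun h : R => h^-1 *: (f (h *: v + (b + t *: v)) - f (b + t *: v))).
  apply/funext => h; congr (_ *: (f _ - _)).
  by rewrite scalerDl /GRing.scale/= mulr1 addrCA.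
by split; rewrite /derive /derivable /= E.
Qed.

End Affine.

Lemma mean_value01 (R : realType) (g dg : R -> R) :
  (forall t : R, t \in `[0, 1] -> is_derive t 1 g (dg t)) ->
  exists2 c : R, c \in `[0, 1] & g 1 - g 0 = dg c * (1 - 0).
Proof.
move=> gd.
have cg : {within `[0, 1], continuous g}.
  apply: derivable_within_continuous => t t01.
  by have [] := gd t t01.
have gd' (t : R) : t \in `]0, 1[ -> is_derive t 1 g (dg t).
  by move=> t01; apply: gd; move: t01; apply: subset_itv_oo_cc.
have [c c01 E] := MVT ltr01 gd' cg.
by exists c => //; move: c01; apply: subset_itv_oo_cc.
Qed.

(** * Strict differentiability of C^1 maps *)

Section StrictDifferentiability.
Variables (R : realType) (V : normedModType R).

(* A coordinate system: it makes [V] finite-dimensional. *)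
Variables (N : nat) (e : 'I_N -> V) (co : 'I_N -> V -> R).
Hypothesis coE : forall v, v = \sum_i co i v *: e i.
Hypothesis co_norm : forall i v, `|co i v| <= `|v|.

(** The mean value theorem is applied to each entry along the segment from b to a. [Ck 1] gives
    continuity of derivatives one direction at a time; a finite coordinate system makes the estimate
    uniform in the direction. *)
Lemma strict_diff p q (U : set V) (f : V -> 'M[R]_(p, q)) x (eps : R) :
  open U -> Ck 1 U f -> U x -> 0 < eps -> exists2 d : R, 0 < d &
    forall a b, `|a - x| < d -> `|b - x| < d ->
    `|f a - f b - 'd f x (a - b)| <= eps * `|a - b|.
Proof.
move=> oU [df cf] Ux eps0.
(* There are N directional errors to add up; the [+ 1] covers N = 0. *)
pose eta := eps / (N%:R + 1).
have eta0 : 0 < eta by rewrite divr_gt0// ltr_wpDl.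
have : \forall y \near x, U y /\ forall l, `|'D_(e l) f x - 'D_(e l) f y| <= eta.
  apply: filterI; first exact: open_nbhs_nbhs.
  apply: filter_forall => l; have /cvgrPdist_le := cf (e l) x Ux; exact.
move=> /nbhs_ballP[d /= d0 h].
exists d => // a b ax bx.
set v := a - b.
have inU (t : R) : t \in `[0, 1] -> U (b + t *: v) /\
    forall l, `|'D_(e l) f x - 'D_(e l) f (b + t *: v)| <= eta.
  rewrite in_itv/= => /andP[t0 t1]; apply: h; rewrite -ball_normE /= distrC.
  have -> : b + t *: v - x = t *: (a - x) + (1 - t) *: (b - x).
    rewrite addrAC scalerBl scale1r addrCA -scalerBr; congr (_ + _ *: _).
    by rewrite opprB addrA subrK.
  rewrite (le_lt_trans (ler_normD _ _))// !normrZ !ger0_norm ?subr_ge0//.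
  rewrite (@lt_le_trans _ _ (t * d + (1 - t) * d))//; last first.
    by rewrite -mulrDl subrKC mul1r.
  have [->|t0'] := eqVneq t 0.
    by rewrite !mul0r !add0r subr0 !mul1r.
  apply: ltr_leD; first by rewrite ltr_pM2l// lt_def t0'.
  by rewrite ler_wpM2l ?subr_ge0// ltW.
apply: mx_norm_le => [|i j]; first by rewrite mulr_ge0// ltW.
pose g : R -> R := fun t => f (b + t *: v) i j.
pose dg : R -> R := fun t => ('D_v f (b + t *: v)) i j.
have gd (t : R) : t \in `[0, 1] -> is_derive t 1 g (dg t).
  move=> /inU[Ut _].
  have dt : derivable (fun s : R => f (b + s *: v)) t 1.
    by rewrite derive_line; exact/diff_derivable/df.
  split; first by have /derivable_mxP := dt; exact.
  by rewrite /dg -derive_line derive_mx// mxE.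
have [c c01 gE] := mean_value01 gd.
have -> : (f a - f b - 'd f x v) i j = dg c - 'd f x v i j.
  move: gE; rewrite subr0 mulr1 => <-; rewrite !mxE /g scale1r scale0r addr0.
  by rewrite /v subrKC.
have [Uc hc] := inU c c01.
rewrite /dg deriveE; last exact: df.
have D y : 'd f y v i j = \sum_l co l v * 'd f y (e l) i j.
  rewrite {1}(coE v) linear_sum summxE; apply: eq_bigr => l _.
  by rewrite linearZ mxE.
rewrite !D -sumrB (le_trans (ler_norm_sum _ _ _))//.
apply: (@le_trans _ _ (\sum_(l < N) `|v| * eta)).
  apply: ler_sum => l _; rewrite -mulrBr normrM ler_pM//.
  rewrite -!deriveE; [|exact: df..].
  rewrite (le_trans _ (hc l))// distrC.
  have := mx_entry_norm ('D_(e l) f x - 'D_(e l) f (b + c *: v)) i j.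
  by rewrite !mxE.
rewrite sumr_const card_ord -mulrnAr mulrC ler_wpM2r// /eta -mulr_natr -mulrA.
have N0 : 0 < N%:R + 1 :> R by rewrite ltr_wpDl.
by rewrite ler_piMr ?(ltW eps0)// mulrC ler_pdivrMr// mul1r lerDl.
Qed.

End StrictDifferentiability.

Section StrictDifferentiabilityRow.
Variable R : realType.

Lemma strict_diff_row d p q (U : set 'rV[R]_d) (f : 'rV[R]_d -> 'M[R]_(p, q)) x
    (eps : R) :
  open U -> Ck 1 U f -> U x -> 0 < eps -> exists2 r : R, 0 < r &
    forall a b, `|a - x| < r -> `|b - x| < r ->
    `|f a - f b - 'd f x (a - b)| <= eps * `|a - b|.
Proof.
apply: (@strict_diff _ _ d (fun i => delta_mx 0 i) (fun i v => v 0 i)).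
  exact: row_sum_delta.
by move=> i v; exact: mx_entry_norm.
Qed.

Lemma strict_diff_pair d p q (U : set ('rV[R]_d * 'rV[R]_d))
    (f : 'rV[R]_d * 'rV[R]_d -> 'M[R]_(p, q)) x (eps : R) :
  open U -> Ck 1 U f -> U x -> 0 < eps -> exists2 r : R, 0 < r &
    forall a b, `|a - x| < r -> `|b - x| < r ->
    `|f a - f b - 'd f x (a - b)| <= eps * `|a - b|.
Proof.
pose e (i : 'I_(d + d)) : 'rV[R]_d * 'rV[R]_d := match fintype.split i with
    | inl j => (delta_mx 0 j, 0) | inr j => (0, delta_mx 0 j) end.
pose co (i : 'I_(d + d)) (v : 'rV[R]_d * 'rV[R]_d) : R :=
  match fintype.split i with inl j => v.1 0 j | inr j => v.2 0 j end.
have coE v : v = \sum_i co i v *: e i.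
  have fstE (I : Type) (r : seq I) (F : I -> 'rV[R]_d * 'rV[R]_d) :
      (\sum_(i <- r) F i).1 = \sum_(i <- r) (F i).1.
    by apply: (big_ind2 (fun a b => a.1 = b)) => // ? ? ? ? <- <-.
  have sndE (I : Type) (r : seq I) (F : I -> 'rV[R]_d * 'rV[R]_d) :
      (\sum_(i <- r) F i).2 = \sum_(i <- r) (F i).2.
    by apply: (big_ind2 (fun a b => a.2 = b)) => // ? ? ? ? <- <-.
  have lE j : fintype.split (lshift d j : 'I_(d + d)) = inl j by exact: (unsplitK (inl _)).
  have rE j : fintype.split (rshift d j : 'I_(d + d)) = inr j by exact: (unsplitK (inr _)).
  case: v => v w; rewrite [RHS]surjective_pairing fstE sndE !big_split_ord /=.
  congr (_, _).
    rewrite [X in _ = _ + X]big1 ?addr0 => [|j _]; last first.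
      by rewrite /co /e rE /= scaler0.
    rewrite [LHS]row_sum_delta; apply: eq_bigr => j _.
    by rewrite /co /e lE.
  rewrite [X in _ = X + _]big1 ?add0r => [|j _]; last first.
    by rewrite /co /e lE /= scaler0.
  rewrite [LHS]row_sum_delta; apply: eq_bigr => j _.
  by rewrite /co /e rE.
apply: (strict_diff coE) => i [v w] /=; rewrite prod_normE/= le_max /co.
case: fintype.split => j; first by rewrite mx_entry_norm.
by rewrite mx_entry_norm orbT.
Qed.

End StrictDifferentiabilityRow.

(** * The group near its unit *)

(* Coordinates [e] of G near 1, with [e 0 = 1]; [L] is the matrix of the
   differential of [rho \o e] at 0, so that [vec_mx (x *m L)] runs through the
   Lie algebra of the image of [rho]. *)
Record unit_coordinates (R : realType) (G : lieGroupType R) (n : nat)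
    (rho : G -> 'M[R]_n) (d : nat) (e : 'rV[R]_d -> G) (L : 'M[R]_(d, n * n))
    (r0 : R) : Prop := UnitCoordinates {
  uc_gt0 : 0 < r0 ;
  uc_0 : e 0 = 1%g ;
  uc_nbhs : forall r, 0 < r ->
    \forall g \near (1%g : G), exists2 x, `|x| < r & g = e x ;
  uc_mul : forall eps, 0 < eps -> exists2 r, 0 < r &
    forall x y, `|x| < r -> `|y| < r ->
    exists2 z, (e x * e y)%g = e z & `|z - (x + y)| <= eps * `|y| ;
  uc_continuous : forall x, `|x| < r0 -> {for x, continuous e} ;
  uc_smooth : smooth [set x | `|x| < r0] (rho \o e) ;
  uc_diff : forall eps, 0 < eps -> exists2 r, 0 < r &
    forall x y, `|x| < r -> `|y| < r ->
    `|rho (e x) - rho (e y) - vec_mx ((x - y) *m L)| <= eps * `|x - y| }.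

Section UnitCoordinates.
Variables (R : realType) (G : lieGroupType R) (n : nat) (rho : G -> 'M[R]_n).
Hypothesis rho_rep : orthogonal_representation rho.

Lemma open_ball0 d (r : R) : open [set x : 'rV[R]_d | `|x| < r].
Proof.
rewrite (_ : [set _ | _] = ball (0 : 'rV[R]_d) r); first exact: ball_open.
by apply/seteqP; split => x; rewrite -ball_normE /= sub0r normrN.
Qed.

Lemma unit_coordinates_exist :
  exists d (e : 'rV[R]_d -> G) L r0, unit_coordinates rho e L r0.
Proof.
have [a Aa a1] : exists2 a, atlas (s := G) a & cdom a 1%g.
  have : (\bigcup_(a in atlas (s := G)) cdom a) 1%g by rewrite atlas_cover.
  by case=> a; exists a.
exists (lie_dim (s := G)); set d := lie_dim.
pose x0 := cmap a 1%g.
pose e x := cinv a (x0 + x).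
have x0i : cimg a x0 by exists 1%g.
have cinvK y : cimg a y -> cmap a (cinv a y) = y.
  by case=> g ga <-; rewrite cmapK.
have cinvD y : cimg a y -> cdom a (cinv a y).
  by case=> g ga <-; rewrite cmapK.
have e0 : e 0 = 1%g by rewrite /e addr0 cmapK.
have [r0 r00 hr0] : exists2 r, 0 < r & forall x, `|x| < r -> cimg a (x0 + x).
  have /nbhs_ballP[r /= r0 h] : nbhs x0 (cimg a).
    by apply: open_nbhs_nbhs; split; [exact: cimg_open|].
  exists r => // x xr; apply: h.
  by rewrite -ball_normE /= opprD addNKr normrN.
have smooth_e : smooth [set x | `|x| < r0] (rho \o e).
  move=> k; apply: (@Ck_comp_affine _ _ _ _ _ _ _ idfun x0 (rho \o cinv a)).
  - by move=> x; exact: cvg_id.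
  - exact: hr0.
  - exact: (rep_smooth rho_rep Aa k).
pose f := rho \o e.
have f00 : `|0 : 'rV[R]_d| < r0 by rewrite normr0.
exists e, (lin1_mx (mxvec \o 'd f 0)), r0; split => //.
- move=> r rpos; near=> g.
  exists (cmap a g - x0); last first.
    rewrite /e subrKC cmapK//; near: g.
    by apply: open_nbhs_nbhs; split=> //; exact: cdom_open.
  near: g; have /cvgrPdist_lt/(_ _ rpos) := cmap_continuous a1.
  by apply: filterS => g; rewrite distrC.
- move=> eps eps0.
  pose mu (p : 'rV[R]_d * 'rV[R]_d) := cmap a (cinv a p.1 * cinv a p.2)%g.
  pose U := [set p : 'rV[R]_d * 'rV[R]_d |
     [/\ cimg a p.1, cimg a p.2 & cdom a (cinv a p.1 * cinv a p.2)%g]].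
  have oU : open U.
    rewrite openE => -[p1 p2] [/= h1 h2 h3]; rewrite /interior.
    apply: filterS3; first by move=> p; exact: And3.
    - by apply: (@cvg_fst _ _ (nbhs p1) (nbhs p2)); apply: open_nbhs_nbhs; split => //; exact: cimg_open.
    - by apply: (@cvg_snd _ _ (nbhs p1) (nbhs p2)); apply: open_nbhs_nbhs; split => //; exact: cimg_open.
    - have c : {for (p1, p2), continuous (fun p => (cinv a p.1 * cinv a p.2)%g)}.
        apply: (@continuous_comp _ _ _ (fun p => (cinv a p.1, cinv a p.2))
          (fun p : G * G => (p.1 * p.2)%g)); last exact: mulg_continuous.
        apply: cvg_pair.
          by apply: (@continuous_comp _ _ _ fst (cinv a)); [exact: cvg_fst|exact: cinv_continuous].
        by apply: (@continuous_comp _ _ _ snd (cinv a)); [exact: cvg_snd|exact: cinv_continuous].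
      by apply: c; apply: open_nbhs_nbhs; split => //; exact: cdom_open.
  have U0 : U (x0, x0) by split=> //=; rewrite cmapK// mulg1.
  have eps2 : 0 < eps / 2 by rewrite divr_gt0.
  have cmu : Ck 1 U mu by exact: (mulg_smooth a a a Aa Aa Aa 1%N).
  have [r1 r10 h1] := strict_diff_pair oU cmu U0 eps2.
  have [r2 r20 h2] : exists2 r, 0 < r & forall x y : 'rV[R]_d, `|x| < r -> `|y| < r -> U (x0 + x, x0 + y).
    have /nbhs_ballP[r /= rpos h] : nbhs (x0, x0) U by apply: open_nbhs_nbhs.
    exists r => // x y xr yr; apply: h; split => /=;
      by rewrite -ball_normE /= opprD addNKr normrN.
  exists (Num.min r0 (Num.min r1 r2)); first by rewrite !lt_min r00 r10.
  move=> x y; rewrite !lt_min => /and3P[xr0 xr1 xr2] /and3P[yr0 yr1 yr2].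
  exists (mu (x0 + x, x0 + y) - x0).
    by rewrite /e subrKC /mu cmapK//; have [] := h2 _ _ xr2 yr2.
  have mu1 z : `|z| < r0 -> mu (x0 + z, x0) = x0 + z.
    by move=> zr; rewrite /mu/= cmapK// mulg1 cinvK//; exact: hr0.
  have mu2 z : `|z| < r0 -> mu (x0, x0 + z) = x0 + z.
    by move=> zr; rewrite /mu/= cmapK// mul1g cinvK//; exact: hr0.
  have nE z w : `|(x0 + z, x0 + w) - (x0, x0)| = Num.max `|z| `|w|.
    by rewrite prod_normE /= ![x0 + _]addrC !addrK.
  have nE' z w w' : (x0 + z, x0 + w) - (x0 + z, x0 + w') = (0, w - w').
    by congr (_, _); rewrite /= ?subrr// opprD addrACA subrr add0r.
  have nE0 (w : 'rV[R]_d) : `|(0 : 'rV[R]_d, w)| = `|w|.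
    by rewrite prod_normE /= normr0 max_r.
  (* [A] compares (x, y) with (x, 0) and [B] compares (0, y) with (0, 0). Both have the same linear
     term D(0, y), so their difference bounds x y - (x + y) by a multiple of |y| alone. Errors then
     add up linearly when many small factors are multiplied. *)
  have A := h1 (x0 + x, x0 + y) (x0 + x, x0 + 0).
  have B := h1 (x0 + 0, x0 + y) (x0 + 0, x0 + 0).
  rewrite !nE !nE' !nE0 !normr0 !gt_max !subr0 in A B.
  have {}A := A _ _; have {}B := B _ _.
  move: (A); rewrite xr1 yr1 r10 => /(_ isT isT) {}A.
  move: (B); rewrite yr1 r10 => /(_ isT isT) {}B.
  rewrite !addr0 mu1// in A. rewrite !addr0 mu2// in B.
  have m00 : mu (x0, x0) = x0 by have := mu1 0 f00; rewrite addr0.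
  rewrite m00 in B.
  rewrite [x0 + y]addrC addrK in B.
  move: A B; set M := mu _; set D := 'd mu _ _; move: M D => M D A B.
  have -> : M - x0 - (x + y) = (M - (x0 + x) - D) - (y - D).
    by rewrite opprB [RHS]addrA subrK !opprD !addrA.
  rewrite (le_trans (ler_normB _ _))//.
  by rewrite [eps]splitr mulrDl lerD.
- move=> x xr; apply: (@continuous_comp _ _ _ (fun x => x0 + x) (cinv a)).
    exact: addl_continuous.
  exact/cinv_continuous/hr0.
- move=> eps eps0.
  have [r rpos h] := strict_diff_row (@open_ball0 _ r0) (smooth_e 1%N) f00 eps0.
  exists r => // x y xr yr.
  rewrite mul_rV_lin1 /= mxvecK.
  by apply: h; rewrite subr0.
Unshelve. all: by end_near. Qed.

Lemma rho1 : rho 1%g = 1%:M.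
Proof.
have h := rep_orthogonal rho_rep 1%g.
rewrite -[LHS]mul1mx -{1}h -mulmxA -(rep_mul rho_rep) mulg1.
exact: h.
Qed.

Lemma rho_tr g : rho g *m (rho g)^T = 1%:M.
Proof. exact/mulmx1C/rep_orthogonal. Qed.

Lemma rhoV g : rho g^-1%g = (rho g)^T.
Proof.
rewrite -[LHS]mul1mx -(rep_orthogonal rho_rep g) -mulmxA -(rep_mul rho_rep).
by rewrite mulgV rho1 mulmx1.
Qed.

Lemma rhoK g k (v : 'M[R]_(n, k)) : rho g^-1%g *m (rho g *m v) = v.
Proof. by rewrite mulmxA -(rep_mul rho_rep) mulVg rho1 mul1mx. Qed.

Lemma rhoVK g k (v : 'M[R]_(n, k)) : rho g *m (rho g^-1%g *m v) = v.
Proof. by rewrite mulmxA -(rep_mul rho_rep) mulgV rho1 mul1mx. Qed.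

Lemma rho_norm g k (v : 'M[R]_(n, k)) : `|rho g *m v| <= n%:R * `|v|.
Proof. exact/orthogonal_norm/rep_orthogonal. Qed.

End UnitCoordinates.

Lemma closed_ball_compact (R : realType) d (x : 'rV[R]_d) (r : R) :
  compact [set y | `|y - x| <= r].
Proof.
apply: bounded_closed_compact.
  exists (`|x| + r); split; first exact: num_real.
  move=> M hM y /= yx; apply/ltW/(le_lt_trans _ hM).
  by rewrite -[y](subrKC x) (le_trans (ler_normD _ _))// lerD2l.
rewrite (_ : [set _ | _] = (fun y => `|y - x|) @^-1` [set t | t <= r])//.
apply: closed_comp; last exact: closed_le.
by move=> y _; exact: dist_continuous.
Qed.

Lemma mulgl_continuous (G : topologicalGroupType) (g : G) :
  continuous (fun h => (g * h)%g).
Proof.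
move=> h; apply: (@continuous_comp _ _ _ (fun h => (g, h))
  (fun p : G * G => (p.1 * p.2)%g)); last exact: mulg_continuous.
by apply: cvg_pair; [exact: cvg_cst|exact: cvg_id].
Qed.

Lemma mulgr_continuous (G : topologicalGroupType) (g : G) :
  continuous (fun h => (h * g)%g).
Proof.
move=> h; apply: (@continuous_comp _ _ _ (fun h => (h, g))
  (fun p : G * G => (p.1 * p.2)%g)); last exact: mulg_continuous.
by apply: cvg_pair; [exact: cvg_id|exact: cvg_cst].
Qed.

(** * Lifting displacements on an orbit to small group elements *)

Section LocalStructure.
Variables (R : realType) (G : lieGroupType R) (n : nat) (rho : G -> 'M[R]_n).
Hypothesis rho_rep : orthogonal_representation rho.
Hypothesis G_compact : compact [set: G].
Variables (d : nat) (e : 'rV[R]_d -> G) (L : 'M[R]_(d, n * n)) (r0 : R).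
Hypothesis uc : unit_coordinates rho e L r0.

(** The differential at 0 of the map x |-> e(x) v, with values flattened to rows. Allowing [k]
    columns covers both vectors and the identity matrix, for which it is [L] itself. *)
Definition inf_act k (v : 'M[R]_(n, k)) : 'M[R]_(d, n * k) := L *m lin_mulmxr v.

Lemma inf_actE k (v : 'M[R]_(n, k)) x :
  vec_mx (x *m inf_act v) = vec_mx (x *m L) *m v.
Proof. by rewrite mulmxA mx_rV_lin. Qed.

Lemma act_diff k (v : 'M[R]_(n, k)) (eps : R) : 0 < eps ->
  exists2 r, 0 < r & forall x y, `|x| < r -> `|y| < r ->
  `|rho (e x) *m v - rho (e y) *m v - vec_mx ((x - y) *m inf_act v)| <=
    eps * `|x - y|.
Proof.
move=> eps0; pose c := n%:R * `|v| + 1.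
have c0 : 0 < c by rewrite ltr_wpDl// mulr_ge0.
have [r rpos h] := uc_diff uc (divr_gt0 eps0 c0).
exists r => // x y xr yr; rewrite inf_actE -!mulmxBl.
rewrite (le_trans (mulmx_norm _ _))// mulrAC.
rewrite (le_trans (ler_wpM2l _ (h x y xr yr)))//.
rewrite mulrA ler_wpM2r// mulrCA ler_piMr ?(ltW eps0)//.
by rewrite ler_pdivrMr// mul1r lerDl.
Qed.

Lemma act_diff0 k (v : 'M[R]_(n, k)) (eps : R) : 0 < eps ->
  exists2 r, 0 < r & forall x, `|x| < r ->
  `|rho (e x) *m v - v - vec_mx (x *m inf_act v)| <= eps * `|x|.
Proof.
move=> eps0; have [r rpos h] := act_diff v eps0.
exists r => // x xr; have := h x 0 xr.
by rewrite normr0 (uc_0 uc) (rho1 rho_rep) mul1mx subr0; apply.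
Qed.

Lemma act_e_continuous k (v : 'M[R]_(n, k)) x : `|x| < r0 ->
  {for x, continuous (fun y => rho (e y) *m v)}.
Proof.
move=> xr; have h : Ck 0 [set x | `|x| < r0] (fun y => rho (e y) *m v).
  apply: Ck_mulmx; [exact: open_ball0|exact: (uc_smooth uc 0%N)|exact: Ck_cst].
exact: h.
Qed.

Lemma rho_continuous : continuous rho.
Proof.
move=> g; apply/cvgrPdist_le => eps eps0.
pose c := n%:R + 1 : R.
have c0 : 0 < c by rewrite ltr_wpDl.
have eps1 : 0 < eps / c by rewrite divr_gt0.
have [r rpos hr] : exists2 r, 0 < r & forall x, `|x| < r -> `|rho (e x) - 1%:M| <= eps / c.
  have := @act_e_continuous n 1%:M 0.
  rewrite normr0 => /(_ (uc_gt0 uc)) /cvgrPdist_le /(_ _ eps1).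
  move=> /nbhs_ballP[r /= rpos h]; exists r => // x xr.
  have := h x; rewrite -ball_normE /= sub0r normrN => /(_ xr).
  by rewrite !mulmx1 distrC (uc_0 uc) (rho1 rho_rep).
have : \forall h \near g, exists2 x, `|x| < r & (g^-1 * h)%g = e x.
  have cg := @mulgl_continuous G g^-1%g g.
  have H : nbhs (g^-1 * g)%g [set h | exists2 x, `|x| < r & h = e x].
    by rewrite mulVg; exact: (uc_nbhs uc).
  exact: (cg _ H).
apply: filterS => h [x xr ghE].
have -> : rho h = rho g *m rho (e x) by rewrite -ghE (rep_mul rho_rep) (rhoVK rho_rep).
rewrite -[X in X - _]mulmx1 -mulmxBr (le_trans (rho_norm rho_rep _ _))//.
rewrite distrC (le_trans (ler_wpM2l _ (hr x xr)))// mulrCA ler_piMr ?(ltW eps0)//.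
by rewrite ler_pdivrMr// mul1r lerDl.
Qed.

Lemma act_continuous k (v : 'M[R]_(n, k)) : continuous (fun g => rho g *m v).
Proof.
move=> g; apply/cvgrPdist_le => eps eps0.
pose c := n%:R * `|v| + 1.
have c0 : 0 < c by rewrite ltr_wpDl// mulr_ge0.
have /cvgrPdist_le/(_ _ (divr_gt0 eps0 c0)) := @rho_continuous g.
apply: filterS => h gh; rewrite -mulmxBl (le_trans (mulmx_norm _ _))// mulrAC.
rewrite (le_trans (ler_wpM2l _ gh))// mulrCA ler_piMr ?(ltW eps0)//.
by rewrite ler_pdivrMr// mul1r lerDl.
Qed.

(** The source of isotropy elements: the kernel of the infinitesimal action consists of directions
    tangent to the isotropy group, up to an arbitrarily small relative error. *)
Lemma kernel_fixed k (v : 'M[R]_(n, k)) (eps : R) : 0 < eps ->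
  exists2 r, 0 < r & forall x, `|x| < r -> x *m inf_act v = 0 ->
  exists2 z, rho (e z) *m v = v & `|z - x| <= eps * `|x|.
Proof.
wlog eps1 : eps / eps <= 1 => [hw|] eps0.
  have [||r rpos h] := hw (Num.min eps 1).
    by rewrite ge_min lexx orbT.
    by rewrite lt_min eps0 ltr01.
  exists r => // x xr xv; have [z zv zx] := h x xr xv.
  by exists z => //; rewrite (le_trans zx)// ler_wpM2r// ge_min lexx.
have [r1 r10 hmul] := uc_mul uc eps0.
have r00 := uc_gt0 uc.
exists (Num.min r0 r1 / 2) => [|x xr xv]; first by rewrite divr_gt0// lt_min r00.
have x2r : 2 * `|x| < Num.min r0 r1 by rewrite mulrC -ltr_pdivlMr.
move: x2r; rewrite lt_min => /andP[xr0 xr1].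
have epsx : eps * `|x| <= `|x| by rewrite ler_piMl.
(* [e (x / N) ^+ N] moves [v] by [o(1)] and stays [eps]-close to [x]; by
   compactness some point [eps]-close to [x] then fixes [v]. *)
have step (N : nat) (y := (N.+1)%:R^-1 *: x) : forall j, (j <= N.+1)%N ->
    exists z, [/\ `|z - j%:R *: y| <= eps * (j%:R * `|y|),
      `|rho (e z) *m v - v| <= j%:R * (n%:R * `|rho (e y) *m v - v|)
      & `|z| < r1 ].
  have yE : N.+1%:R * `|y| = `|x|.
    by rewrite normrZ ger0_norm ?invr_ge0// mulVKf.
  have yx : `|y| <= `|x| by rewrite -yE ler_peMl// ler1n.
  elim=> [_|j IH jN].
    by exists 0; split; rewrite ?scale0r ?subr0 ?normr0 ?mul0r ?mulr0//
      (uc_0 uc) (rho1 rho_rep) mul1mx subrr normr0.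
  have [z [z1 z2 z3]] := IH (ltnW jN).
  have yr1 : `|y| < r1.
    by rewrite (le_lt_trans yx)// (le_lt_trans _ xr1)// ler_peMl// ler1n.
  have [w ew wz] := hmul z y z3 yr1.
  have wE : `|w - j.+1%:R *: y| <= eps * (j.+1%:R * `|y|).
    rewrite (_ : w - _ = (w - (z + y)) + (z - j%:R *: y)); last first.
      by apply/rowP => i; rewrite !mxE -natr1; ring.
    rewrite (le_trans (ler_normD _ _))// -natr1 [in leRHS]mulrDl mul1r mulrDr addrC.
    exact: lerD.
  exists w; split => //.
    rewrite -ew (rep_mul rho_rep) -mulmxA.
    (* The displacement telescopes over the factors; each new factor is moved by a group element,
       which costs [n]. *)
    rewrite (_ : _ - v = rho (e z) *m (rho (e y) *m v - v) + (rho (e z) *m v - v)); last first.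
      by rewrite mulmxBr addrA subrK.
    rewrite (le_trans (ler_normD _ _))// -natr1 mulrDl mul1r addrC lerD//.
    exact: rho_norm.
  rewrite (le_lt_trans _ xr1)// -[w](subrK (j.+1%:R *: y)).
  rewrite (le_trans (ler_normD _ _))// normrZ ger0_norm//.
  have jx : j.+1%:R * `|y| <= `|x| by rewrite -yE ler_wpM2r// ler_nat.
  rewrite mulr_natl mulr2n lerD// (le_trans wE)//.
  by rewrite (le_trans _ epsx)// ler_wpM2l// ltW.
have near_fixed (eta : R) : 0 < eta ->
    exists2 z, `|z - x| <= eps * `|x| & `|rho (e z) *m v - v| <= eta.
  move=> eta0; pose c := n%:R * `|x| + 1.
  have c0 : 0 < c by rewrite ltr_wpDl// mulr_ge0.
  have [r2 r20 h2] := act_diff0 v (divr_gt0 eta0 c0).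
  have [N hN] : exists N : nat, `|x| / r2 < N.+1%:R.
    exists (Num.bound (`|x| / r2)); rewrite (lt_le_trans (archi_boundP _))// ?ler_nat//.
    by rewrite divr_ge0// ltW.
  have [z [z1 z2 _]] := step N _ (leqnn _).
  have yE : N.+1%:R *: (N.+1%:R^-1 *: x) = x by rewrite scalerA divff// scale1r.
  have ynE : N.+1%:R * `|N.+1%:R^-1 *: x| = `|x|.
    by rewrite normrZ ger0_norm ?invr_ge0// mulVKf.
  rewrite yE ynE in z1; exists z => //; rewrite (le_trans z2)//.
  have y2 : `|N.+1%:R^-1 *: x| < r2.
    by rewrite normrZ ger0_norm ?invr_ge0// mulrC ltr_pdivrMr// mulrC -ltr_pdivrMr.
  have := h2 _ y2; rewrite -scalemxAl xv scaler0 linear0 subr0 => h3.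
  rewrite mulrCA (le_trans (ler_wpM2l _ (ler_wpM2l _ h3)))//.
  rewrite [N.+1%:R * _]mulrCA ynE mulrCA -mulrA ler_piMr ?(ltW eta0)//.
  by rewrite mulrC ler_pdivrMr// mul1r lerDl.
pose A := [set z | `|z - x| <= eps * `|x|].
have Ar0 z : A z -> `|z| < r0.
  move=> Az; rewrite (le_lt_trans _ xr0)// -[z](subrK x).
  by rewrite (le_trans (ler_normD _ _))// mulr_natl mulr2n lerD2r (le_trans Az).
have [|||c /set_mem Ac cmin] := @EVT_min_rV _ _ (fun z => `|rho (e z) *m v - v|) A.
- by exists x; rewrite /A/= subrr normr0 mulr_ge0// ltW.
- exact: closed_ball_compact.
- apply: continuous_in_subspaceT => z /set_mem Az.
  apply: (@continuous_comp _ _ _ (fun z => rho (e z) *m v) (fun w => `|w - v|)).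
    exact/act_e_continuous/Ar0.
  exact: dist_continuous.
exists c => //; apply/eqP; rewrite -subr_eq0 -normr_le0.
apply/ler_addgt0Pr => eta eta0; rewrite add0r.
have [z Az zv] := near_fixed _ eta0.
by rewrite (le_trans _ zv)// cmin// mem_set.
Qed.

(* Subtracting from [x] the fraction [s] of its component along the kernel of
   [inf_act v]; the correction [y] lies in the isotropy group of [v]. *)
Lemma fibre_step k (v : 'M[R]_(n, k)) : exists2 r, 0 < r <= r0 & exists2 C, 0 <= C &
  forall x s, `|x| < r -> 0 <= s <= 1 -> exists y z,
    [/\ (e x * e y)%g = e z, rho (e y) *m v = v, `|y| <= C * (s * `|x|) &
     `|z| <= (1 - s) * `|x| + s * (C * `|rho (e x) *m v - v| + `|x| / 4)].
Proof.
pose A := inf_act v.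
pose C2 := (n * k)%:R * `|pinvmx A|.
pose C0 := 1 + C2 * (`|A| * d%:R).
have C20 : 0 <= C2 by rewrite mulr_ge0.
have C01 : 1 <= C0 by rewrite lerDl !mulr_ge0.
have C0p : 0 < C0 by rewrite (lt_le_trans ltr01).
(* The errors are s |x| / 12 from the product, s |x| / 24 from [kernel_fixed] and s |x| / 8 from the
   linearization; together they make up the s |x| / 4 of the statement. *)
pose a := (8 * (C2 + 1))^-1.
pose b := (24 * C0)^-1.
have a0 : 0 < a by rewrite invr_gt0 mulr_gt0// ltr_wpDl.
have b0 : 0 < b by rewrite invr_gt0 mulr_gt0.
have b1 : b <= 1.
  by rewrite invf_le1 ?mulr_gt0// (le_trans C01)// ler_peMl// ?(ltW C0p)// ler1n.
have [r1 r10 hdiff] := act_diff0 v a0.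
have [r2 r20 hker] := kernel_fixed v b0.
have [r3 r30 hmul] := uc_mul uc b0.
have r00 := uc_gt0 uc.
pose r4 := Num.min (Num.min r0 r1) (Num.min r2 r3).
have r40 : 0 < r4 by rewrite !lt_min r00 r10 r20 r30.
have D0 : 0 < 2 * C0 by rewrite mulr_gt0.
have D1 : 1 <= 2 * C0 by rewrite (le_trans C01)// ler_peMl// ?(ltW C0p)// ler1n.
exists (r4 / (2 * C0)).
  rewrite divr_gt0//=; apply: (@le_trans _ _ r4); last by rewrite !ge_min lexx.
  by rewrite ler_pdivrMr// ler_peMr// ltW.
exists (C2 + 2 * C0); first by rewrite addr_ge0// ltW.
move=> x s xr /andP[s0 s1].
(* [eta] has the same image under [A] as [x], but its norm is controlled by that image, hence by the
   displacement of [v]; [xi] is the remaining kernel component. *)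
pose eta := x *m (A *m pinvmx A).
pose xi := x - eta.
have etaE : eta *m A = x *m A.
  by rewrite /eta -mulmxA mulmxKpV.
have xiA : xi *m A = 0 by rewrite mulmxBl etaE subrr.
have eta_le : `|eta| <= C2 * `|x *m A|.
  by rewrite /eta mulmxA (le_trans (mulmx_norm _ _))// mulrAC.
have xi_le : `|xi| <= C0 * `|x|.
  rewrite (le_trans (ler_normB _ _))// mulrDl mul1r lerD2l (le_trans eta_le)//.
  rewrite -[in leRHS]mulrA ler_wpM2l// (le_trans (mulmx_norm _ _))//.
  by rewrite mulrC mulrA.
have x2r : 2 * (C0 * `|x|) < r4 by rewrite mulrA mulrC -ltr_pdivlMr.
have cx : `|x| <= 2 * (C0 * `|x|).
  by rewrite mulrA ler_peMl.
have sxi : `|- s *: xi| <= C0 * `|x|.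
  by rewrite normrZ normrN ger0_norm// (le_trans _ xi_le)// ler_piMl.
have sxi2 : `|- s *: xi| < r2.
  rewrite (le_lt_trans sxi)// (@lt_le_trans _ _ r4)//; last by rewrite !ge_min lexx !orbT.
  by rewrite (le_lt_trans _ x2r)// ler_peMl ?ler1n// mulr_ge0// ltW.
have [|y yv yE] := hker (- s *: xi) sxi2.
  by rewrite -scalemxAl xiA scaler0.
have y_le : `|y| <= 2 * (s * `|xi|).
  rewrite -[y](subrK (- s *: xi)) (le_trans (ler_normD _ _))// mulr_natl mulr2n.
  rewrite lerD//; last by rewrite normrZ normrN ger0_norm.
  by rewrite (le_trans yE)// normrZ normrN ger0_norm// ler_piMl// mulr_ge0.
have y_le' : `|y| <= 2 * (C0 * (s * `|x|)).
  by rewrite (le_trans y_le)// ler_wpM2l// [leRHS]mulrCA ler_wpM2l.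
have yr3 : `|y| < r3.
  rewrite (le_lt_trans y_le')// (@lt_le_trans _ _ r4)//; last by rewrite !ge_min lexx !orbT.
  rewrite (le_lt_trans _ x2r)// ler_wpM2l// ler_wpM2l ?(ltW C0p)//.
  by rewrite ler_piMl.
have xr4 : `|x| < r4 by rewrite (le_lt_trans cx).
have xr3 : `|x| < r3 by rewrite (lt_le_trans xr4)// !ge_min lexx !orbT.
have xr1 : `|x| < r1 by rewrite (lt_le_trans xr4)// !ge_min lexx !orbT.
have [z ez zE] := hmul x y xr3 yr3.
exists y, z; split => //.
  rewrite (le_trans y_le')// mulrA ler_wpM2r ?mulr_ge0//.
  by rewrite lerDr.
set w := rho (e x) *m v - v.
have xA_le : `|x *m A| <= `|w| + a * `|x|.
  rewrite -[x *m A]vec_mxK mxvec_norm -[X in `|X| <= _](subrK w) addrC.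
  rewrite (le_trans (ler_normD _ _))// lerD2l distrC.
  exact: hdiff.
have -> : z = (z - (x + y)) + (y - (- s *: xi)) + (1 - s) *: x + s *: eta.
  by rewrite /xi; apply/rowP => i; rewrite !mxE; ring.
have s1' : 0 <= 1 - s by rewrite subr_ge0.
have A1 : `|z - (x + y)| <= s * (`|x| / 12).
  rewrite (le_trans zE)// (le_trans (ler_wpM2l (ltW b0) y_le'))//.
  rewrite /b le_eqVlt; apply/orP; left; apply/eqP; field.
  by rewrite gt_eqF.
have A2 : `|y - (- s *: xi)| <= s * (`|x| / 24).
  rewrite (le_trans yE)// normrZ normrN ger0_norm//.
  rewrite (le_trans (ler_wpM2l (ltW b0) (ler_wpM2l s0 xi_le)))//.
  rewrite /b le_eqVlt; apply/orP; left; apply/eqP; field.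
  by rewrite gt_eqF.
have A3 : `|(1 - s) *: x| = (1 - s) * `|x| by rewrite normrZ ger0_norm.
have A4 : `|s *: eta| <= s * (C2 * `|w| + `|x| / 8).
  rewrite normrZ ger0_norm// ler_wpM2l// (le_trans eta_le)//.
  rewrite (le_trans (ler_wpM2l C20 xA_le))// mulrDr lerD2l mulrA [leRHS]mulrC.
  rewrite ler_wpM2r// /a invfM mulrCA ler_piMr//.
  by rewrite ler_pdivrMr ?ltr_wpDl// mul1r lerDl.
rewrite (le_trans (ler_normD _ _))// (le_trans (lerD (ler_normD _ _) A4))//.
rewrite A3 (le_trans (lerD (lerD (le_trans (ler_normD _ _) (lerD A1 A2)) (lexx _)) (lexx _)))//.
rewrite [leLHS]addrAC addrC lerD2l -!mulrDr ler_wpM2l//.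
have w0 : 0 <= 2 * C0 * `|w| by rewrite mulr_ge0// ltW.
rewrite [(C2 + 2 * C0) * `|w|]mulrDl.
move: (C2 * `|w|) (2 * C0 * `|w|) w0 (`|x|) (normr_ge0 x) => p q q0 t t0.
lra.
Qed.

(** Compactness excludes elements far from the isotropy group that barely move v. Near a g that
    fixes v, every h is e(x) g, so h v = e(x) v; near any other g the displacement stays above half
    its value at g. *)
Lemma local_lift_small k (v : 'M[R]_(n, k)) r : 0 < r ->
  exists2 del, 0 < del & forall g, `|rho g *m v - v| < del ->
  exists2 x, `|x| < r & rho g *m v = rho (e x) *m v.
Proof.
move=> rpos.
pose P (del : R) g := `|rho g *m v - v| < del ->
  exists2 x, `|x| < r & rho g *m v = rho (e x) *m v.
have : \forall del \near 0^'+, forall g, [set: G] g -> P del g.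
  have /compact_near_coveringP := G_compact.
  apply => g _.
  have [gv|gv] := eqVneq (rho g *m v) v.
    have : \forall h \near g, exists2 x, `|x| < r & (h * g^-1)%g = e x.
      have cg := @mulgr_continuous G g^-1%g g.
      have H : nbhs (g * g^-1)%g [set h | exists2 x, `|x| < r & h = e x].
        by rewrite mulgV; exact: (uc_nbhs uc).
      exact: (cg _ H).
    move=> H; exists ([set h | exists2 x, `|x| < r & (h * g^-1)%g = e x], setT).
      by split => //; exact: filterT.
    move=> [h del] [/= [x xr hx] _] _; exists x => //.
    by rewrite -hx (rep_mul rho_rep) -mulmxA -{2}gv (rhoK rho_rep).
  pose c := `|rho g *m v - v| / 2.
  have c0 : 0 < c by rewrite divr_gt0// normr_gt0 subr_eq0.
  exists ([set h | `|rho g *m v - rho h *m v| <= c], [set del | del < c]).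
    split => /=; last exact: nbhs_right_lt.
    by have /cvgrPdist_le/(_ _ c0) := @act_continuous _ v g.
  move=> [h del] [/= H1 H2] H3; exfalso.
  have : `|rho g *m v - v| <= c + `|rho h *m v - v|.
    rewrite -[X in `|X| <= _](subrKA (rho h *m v)) (le_trans (ler_normD _ _))//.
    by rewrite lerD2r.
  rewrite [X in X <= _](_ : _ = c + c); last by rewrite -splitr.
  by rewrite lerD2l leNgt (lt_trans H3 H2).
move=> H; have [del [del0 hdel]] : exists del : R, 0 < del /\ forall g, P del g.
  near (0 : R)^'+ => del; exists del; split; first by near: del; exact: nbhs_right_gt.
  by move=> g; move: g (I : [set: G] g); near: del.
by exists del.
Unshelve. all: by end_near. Qed.

(** Let t be the displacement and choose x representing g v with norm within t of the infimum. A
    fibre step with s = 1 gives another representative of norm at most C t + |x| / 4;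
    near-minimality of x then bounds |x| by a multiple of t. *)
Lemma local_lift k (v : 'M[R]_(n, k)) : exists2 C, 0 <= C &
  forall r, 0 < r -> exists2 del, 0 < del &
  forall g, `|rho g *m v - v| < del ->
  exists x, [/\ `|x| < r, `|x| <= C * `|rho g *m v - v| &
    rho g *m v = rho (e x) *m v].
Proof.
have [r1 /andP[r10 r1r0] [C C0 step]] := fibre_step v.
exists (2 * C + 2) => [|r2 r20]; first by rewrite addr_ge0// mulr_ge0.
pose r := Num.min r1 r2.
have rpos : 0 < r by rewrite lt_min r10.
have [del1 del10 hlift] := local_lift_small v rpos.
pose del2 := r / (2 * (C + 1)).
have C1 : 0 < C + 1 by rewrite ltr_wpDl.
have del20 : 0 < del2 by rewrite divr_gt0// mulr_gt0.
exists (Num.min del1 del2) => [|g]; first by rewrite lt_min del10.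
rewrite lt_min => /andP[g1 g2].
have [x1 x1r gx1] := hlift g g1.
set u := rho g *m v in g1 g2 gx1 *.
set t := `|u - v| in g1 g2 *.
have t0 : 0 <= t by exact: normr_ge0.
have [uv|uv] := eqVneq u v.
  exists 0; rewrite normr0 (uc_0 uc) (rho1 rho_rep) mul1mx; split => //.
  by rewrite !mulr_ge0// addr_ge0// mulr_ge0.
have tp : 0 < t by rewrite normr_gt0 subr_eq0.
pose S := [set `|x| | x in [set x | `|x| < r /\ u = rho (e x) *m v]].
have S0 : S !=set0 by exists `|x1|; exists x1.
have Slb : lbound S 0 by move=> _ [x _ <-].
have hS : has_inf S by split => //; exists 0.
have [_ [x [xr xu] <-] xm] := inf_adherent tp hS.
have mS z : `|z| < r -> u = rho (e z) *m v -> inf S <= `|z|.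
  by move=> zr zu; apply: (ge_inf hS.2); exists z.
have xr1 : `|x| < r1 by rewrite (lt_le_trans xr)// ge_min lexx.
have [|y [z [ez yv _ zle]]] := step x 1 xr1; first by rewrite ler01 lexx.
rewrite subrr mul0r add0r mul1r -xu -/t in zle.
have Ct : C * t < r / 2.
  rewrite (@le_lt_trans _ _ ((C + 1) * t))//; first by rewrite ler_wpM2r// lerDl.
  rewrite mulrC -ltr_pdivlMr// (lt_le_trans g2)// /del2 invfM mulrA.
  by rewrite le_eqVlt eqxx.
have zr : `|z| < r by move: zle xr Ct (normr_ge0 x); lra.
have zu : u = rho (e z) *m v by rewrite -ez (rep_mul rho_rep) -mulmxA yv.
have := mS z zr zu => mz.
exists x; split => //; first by rewrite (lt_le_trans xr)// ge_min lexx orbT.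
have Ct0 : 0 <= C * t by rewrite mulr_ge0.
rewrite mulrDl -[2 * C * t]mulrA.
by move: zle mz xm (normr_ge0 x) t0 Ct0; lra.
Qed.

End LocalStructure.

(** * Charts and tangent spaces of orbits *)

Section MoreLinear.
Variable R : realType.

Lemma lipschitz_continuous (V W : normedModType R) (f : V -> W) (C : R) :
  (forall x y, `|f x - f y| <= C * `|x - y|) -> continuous f.
Proof.
move=> fC x; apply/cvgrPdist_le => e e0.
pose c := `|C| + 1.
have c0 : 0 < c by rewrite ltr_wpDl.
have /cvgrPdist_le/(_ _ (divr_gt0 e0 c0)) := @cvg_id _ (nbhs x).
apply: filterS => y xy; rewrite (le_trans (fC _ _))//.
rewrite (@le_trans _ _ (c * `|x - y|))//.
  by rewrite ler_wpM2r// /c ler_wpDr// ler_norm.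
by rewrite mulrC -ler_pdivlMr.
Qed.

Lemma open_dist (V : normedModType R) (a : V) (r : R) :
  open [set w | `|w - a| < r].
Proof.
rewrite (_ : [set w | _] = (fun w => `|w - a|) @^-1` [set t | t < r])//.
by apply: open_comp => [w _|]; [exact: dist_continuous|exact: open_lt].
Qed.

Lemma mulmx_continuous m n p (A : 'M[R]_(m, n)) :
  continuous (mulmx A : 'M[R]_(n, p) -> 'M[R]_(m, p)).
Proof.
apply: (@lipschitz_continuous _ _ _ (n%:R * `|A|)) => x y.
by rewrite -mulmxBr mulmx_norm.
Qed.

Lemma mulmxr_continuous m n p (A : 'M[R]_(n, p)) :
  continuous (mulmxr A : 'M[R]_(m, n) -> 'M[R]_(m, p)).
Proof.
apply: (@lipschitz_continuous _ _ _ (n%:R * `|A|)) => x y.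
by rewrite /= -mulmxBl (le_trans (mulmx_norm _ _))// mulrAC.
Qed.

Lemma mulmxl_diff (V : normedModType R) m n p (A : 'M[R]_(m, n))
    (f : V -> 'M[R]_(n, p)) x : differentiable f x ->
  differentiable (fun y => A *m f y) x /\
  'd (fun y => A *m f y) x = (fun h => A *m 'd f x h) :> (V -> _).
Proof.
move=> df; have cA := @mulmx_continuous _ _ p A.
have dA : differentiable (mulmx A : 'M[R]_(n, p) -> _) (f x) by exact: linear_differentiable.
split; first exact: (differentiable_comp df dA).
by have := diff_comp df dA; rewrite (diff_lin (f x) cA).
Qed.

Lemma row_free_norm m n (A : 'M[R]_(m, n)) : row_free A ->
  exists2 C, 0 <= C & forall x : 'rV[R]_m, `|x| <= C * `|x *m A|.
Proof.
move=> fA; exists (n%:R * `|pinvmx A|); first by rewrite mulr_ge0.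
move=> x; rewrite -{1}[x]mulmx1 -(mulmxVp fA) mulmxA.
by rewrite (le_trans (mulmx_norm _ _))// mulrAC.
Qed.

Lemma row_norm_le m n (A : 'M[R]_(m, n)) (x : 'rV[R]_m) :
  `|x *m A| <= m%:R * `|A| * `|x|.
Proof. by rewrite (le_trans (mulmx_norm _ _))// mulrAC. Qed.

(** Reserves a quarter for an error term: three of them still sum to less than the whole, by
    [lt_three_quarters]. *)
Lemma small_factor (c : R) : 0 <= c -> exists2 e : R, 0 < e & c * e <= 4^-1.
Proof.
move=> c0; exists (4 * (c + 1))^-1; first by rewrite invr_gt0 mulr_gt0// ltr_wpDl.
rewrite invfM mulrCA ler_piMr// ler_pdivrMr ?ltr_wpDl// mul1r lerDl.
exact: ler01.
Qed.

Lemma lt_three_quarters (t : R) : 0 < t -> 4^-1 * t + 4^-1 * t + 4^-1 * t < t.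
Proof. by move=> ?; lra. Qed.

Lemma relatively_open (T : Type) (V : normedModType R) (M : set V) (phi : T -> V)
    (O : set T) :
  (forall y, O y -> M (phi y)) ->
  (forall y, O y -> exists2 dl, 0 < dl &
    forall u, M u -> `|u - phi y| < dl -> (phi @` O) u) ->
  exists2 W : set V, open W & phi @` O = M `&` W.
Proof.
move=> OM core.
pose I := [set p : T * R | O p.1 /\ 0 < p.2 /\
  forall u, M u -> `|u - phi p.1| < p.2 -> (phi @` O) u].
exists (\bigcup_(p in I) [set w | `|w - phi p.1| < p.2]).
  by apply: bigcup_open => p _; exact: open_dist.
apply/seteqP; split=> [_ [y Oy <-]|u [ou [p [_ [_ h]] up]]]; last exact: h.
split; first exact: OM.
have [dl dl0 h] := core y Oy.
by exists (y, dl) => //=; rewrite subrr normr0.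
Qed.

Lemma diff_strict_bound (V W : normedModType R) (f : V -> W) x (M : V -> W) (e : R)
    (U : set V) : open U -> U x -> differentiable f x ->
  (forall t h, M (t *: h) = t *: M h) ->
  (forall y, U y -> `|f y - f x - M (y - x)| <= e * `|y - x|) ->
  forall h, `|'d f x h - M h| <= e * `|h|.
Proof.
move=> oU Ux df MZ hf h; apply/ler_addgt0Pr => eps eps0.
have [->|h0] := eqVneq h 0.
  have M0 : M 0 = 0 by rewrite -(scale0r (0 : V)) MZ scale0r.
  by rewrite linear0 M0 subrr !normr0 mulr0 add0r ltW.
have hp : 0 < `|h| by rewrite normr_gt0.
have H1 := diff_eps df (divr_gt0 eps0 hp).
have H2 : \forall k \near 0, U (k + x).
  rewrite (near_shift x)/=; near=> y; rewrite /= sub0r subrK.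
  by near: y; exact: open_nbhs_nbhs.
have [r /= rpos hr] := (@nbhs_ballP _ _ _ _).1 (filterI H1 H2).
pose t := r / 2 / `|h|.
have t0 : 0 < t by rewrite !divr_gt0.
have [|h1 h2] := hr (t *: h).
  rewrite -ball_normE /= sub0r normrN normrZ ger0_norm ?(ltW t0)//.
  by rewrite /t divfK ?gt_eqF// ltr_pdivrMr// ltr_pMr// ltr1n.
have h3 := hf _ h2; rewrite addrK MZ in h3; rewrite linearZ in h1.
rewrite -(ler_pM2l t0) -[X in X * `|_|](ger0_norm (ltW t0)) -normrZ scalerBr.
have -> : t *: 'd f x h - t *: M h =
  (f (t *: h + x) - f x - t *: M h) - (f (t *: h + x) - f x - t *: 'd f x h).
  by rewrite opprB [RHS]addrC subrKA.
rewrite (le_trans (ler_normB _ _))// (le_trans (lerD h3 h1))//.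
rewrite normrZ ger0_norm ?(ltW t0)// mulrDr mulrCA lerD2l mulrCA divfK ?gt_eqF//.
Unshelve. all: by end_near. Qed.

End MoreLinear.

Section OrbitGeometry.
Variables (R : realType) (G : lieGroupType R) (n : nat) (rho : G -> 'M[R]_n).
Hypothesis rho_rep : orthogonal_representation rho.
Hypothesis G_compact : compact [set: G].
Variables (d : nat) (e : 'rV[R]_d -> G) (L : 'M[R]_(d, n * n)) (r0 : R).
Hypothesis uc : unit_coordinates rho e L r0.
Local Notation inf_act := (inf_act L).
Local Notation orbit := (Defs.orbit rho).

(** Velocities at v of arbitrary motions in the orbit are infinitesimal actions. Each g lifts to an
    x of size O(t), x / t acts on v nearly as w, and the row space is closed. No regularity of g in
    t is assumed. *)
Lemma inf_act_limit k (v w : 'M[R]_(n, k)) :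
  (forall eps, 0 < eps -> exists t g, 0 < t < eps /\
     `|rho g *m v - v - t *: w| <= eps * t) ->
  (mxvec w <= inf_act v)%MS.
Proof.
move=> h; apply: row_space_closed => eps0 eps00.
have [C C0 lift] := local_lift rho_rep G_compact uc v.
pose c := C * (`|w| + 1).
have w1 : 0 < `|w| + 1 by rewrite ltr_wpDl.
have c0 : 0 <= c by rewrite mulr_ge0// ltW.
have c1 : 0 < c + 1 by rewrite ltr_wpDl.
pose eps2 := eps0 / 2 / (c + 1).
have eps20 : 0 < eps2 by rewrite !divr_gt0.
have [r2 r20 hdiff] := act_diff0 rho_rep uc v eps20.
have [del del0 {}lift] := lift r2 r20.
pose eps := Num.min (Num.min (eps0 / 2) 1) (del / (`|w| + 1)).
have epspos : 0 < eps by rewrite !lt_min !divr_gt0// ltr01.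
have [t [g [/andP[t0 teps] gt]]] := h eps epspos.
have eps1 : eps <= 1 by rewrite !ge_min lexx !orbT.
have eps_half : eps <= eps0 / 2 by rewrite !ge_min lexx.
have gv : `|rho g *m v - v| <= t * (`|w| + 1).
  rewrite -[X in `|X| <= _](subrK (t *: w)) (le_trans (ler_normD _ _))//.
  rewrite normrZ ger0_norm ?(ltW t0)// mulrDr mulr1 addrC lerD2l (le_trans gt)//.
  by rewrite ler_piMl// ltW.
have [|x [xr xC gx]] := lift g.
  rewrite (le_lt_trans gv)// -ltr_pdivlMr// (lt_le_trans teps)//.
  by rewrite !ge_min lexx !orbT.
exists (t^-1 *: (x *m inf_act v)); first by rewrite scalemx_sub// submxMl.
have hx := hdiff x xr; rewrite -gx in hx.
have xc : `|x| <= c * t.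
  by rewrite (le_trans xC)// (le_trans (ler_wpM2l C0 gv))// /c mulrCA mulrC.
rewrite -[_ *: _]vec_mxK -linearB mxvec_norm linearZ.
have -> : w - t^-1 *: vec_mx (x *m inf_act v) =
    t^-1 *: ((rho g *m v - v - vec_mx (x *m inf_act v)) - (rho g *m v - v - t *: w)).
  rewrite opprB [rho g *m v - v - _ + _]addrC subrKA scalerBr scalerA.
  by rewrite mulVf ?gt_eqF// scale1r.
rewrite normrZ ger0_norm ?invr_ge0 ?(ltW t0)// mulrC ler_pdivrMr//.
rewrite (le_trans (ler_normB _ _))// [eps0]splitr mulrDl lerD//; last first.
  by rewrite (le_trans gt)// ler_wpM2r// ltW.
rewrite (le_trans hx)// (le_trans (ler_wpM2l (ltW eps20) xc))// mulrA.
apply: ler_wpM2r; first exact: ltW.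
rewrite /eps2 mulrAC ler_pdivrMr// ler_wpM2l ?lerDl//.
by rewrite divr_ge0// ltW.
Qed.

Lemma inf_act_curve k (v : 'M[R]_(n, k)) z (eps : R) : 0 < eps ->
  exists2 r, 0 < r & forall t, 0 < t < r ->
  `|rho (e (t *: z)) *m v - v - t *: vec_mx (z *m inf_act v)| <= eps * t.
Proof.
move=> eps0; pose c := `|z| + 1.
have c0 : 0 < c by rewrite ltr_wpDl.
have [r rpos h] := act_diff0 rho_rep uc v (divr_gt0 eps0 c0).
exists (r / c) => [|t /andP[t0 tr]]; first by rewrite divr_gt0.
have tz : `|t *: z| <= c * t.
  by rewrite normrZ ger0_norm ?(ltW t0)// mulrC ler_wpM2r ?(ltW t0)// lerDl.
have := h (t *: z); rewrite -scalemxAl linearZ.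
have -> : `|t *: z| < r.
  by rewrite (le_lt_trans tz)// mulrC -ltr_pdivlMr.
move=> /(_ isT) /le_trans; apply.
have ec : 0 <= eps / c by rewrite divr_ge0 ?ltW.
by rewrite (le_trans (ler_wpM2l ec tz))// mulrA divfK ?gt_eqF.
Qed.

(** [S] selects coordinates on which the infinitesimal action at v is injective, so phi is injective
    with Lipschitz inverse. For relative openness, the point phi y1 nearest to u over a small closed
    ball must equal u: otherwise the remaining displacement, lifted to G and projected to the
    coordinates [S], gives a correction that comes strictly closer. *)
Lemma orbit_parametrization (v : 'cV[R]_n) :
  exists U (phi : 'rV[R]_(\rank (inf_act v)) -> 'cV[R]_n),
  [/\ local_parametrization (orbit v) U phi, U 0 & phi 0 = v].
Proof.
pose A := inf_act v; pose m := \rank A.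
have [S BE] : exists S, row_base A = S *m A.
  by apply/submxP; rewrite eq_row_base.
pose B := row_base A.
have fB : row_free B by exact: row_base_free.
have [CB CB0 CBP] := row_free_norm fB.
have [C C0 lift] := local_lift rho_rep G_compact uc v.
have N0 : 0 <= n%:R :> R by [].
pose C5 := CB * (d%:R * `|A| * (C * n%:R)).
have C50 : 0 <= C5 by rewrite !mulr_ge0.
(* [eps1] serves injectivity and immersion; [eps2], [eps4] and [eps3] bound the three errors [T1],
   [T2] and [T3] of the correction by a quarter of the distance each. *)
have [eps1 eps10 eps1P] := small_factor CB0.
have [eps2 eps20 eps2P] := small_factor C50.
pose c6 := n%:R * (C * n%:R).
have c60 : 0 <= c6 by rewrite !mulr_ge0.
have [eps3 eps30 eps3P] := small_factor c60.
pose c7 := n%:R * (d%:R * `|A| * (C * n%:R)).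
have c70 : 0 <= c7 by rewrite !mulr_ge0.
have [eps4 eps40 eps4P] := small_factor c70.
pose cS := m%:R * `|S| + 1.
have cS0 : 0 < cS by rewrite ltr_wpDl// mulr_ge0.
have yS (y : 'rV[R]_m) : `|y *m S| <= cS * `|y|.
  by rewrite (le_trans (row_norm_le _ _))// ler_wpM2r// lerDl.
pose eps := Num.min eps1 eps2 / cS.
have epspos : 0 < eps by rewrite divr_gt0// lt_min eps10.
have [r1 r10 hdiff] := act_diff uc v epspos.
have [r2 r20 hrho] : exists2 r, 0 < r & forall x, `|x| < r -> `|rho (e x) - 1%:M| <= eps4.
  have := @act_e_continuous _ _ _ _ _ _ _ _ uc _ 1%:M 0.
  rewrite normr0 => /(_ (uc_gt0 uc)) /cvgrPdist_le /(_ _ eps40).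
  move=> /nbhs_ballP[r /= rpos h]; exists r => // x xr.
  have := h x; rewrite -ball_normE /= sub0r normrN => /(_ xr).
  by rewrite !mulmx1 distrC (uc_0 uc) (rho1 rho_rep).
have [r3 r30 hdiff0] := act_diff0 rho_rep uc v eps30.
have [del del0 {}lift] := lift r3 r30.
have r00 := uc_gt0 uc.
pose r := Num.min r0 (Num.min r1 r2) / cS.
have rpos : 0 < r by rewrite divr_gt0// !lt_min r00 r10.
pose U := [set y : 'rV[R]_m | `|y| < r].
have oU : open U by exact: open_ball0.
have ySr y : U y -> [/\ `|y *m S| < r0, `|y *m S| < r1 & `|y *m S| < r2].
  move=> Uy; have : `|y *m S| < Num.min r0 (Num.min r1 r2).
    by rewrite (le_lt_trans (yS y))// mulrC -ltr_pdivlMr.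
  by rewrite !lt_min => /and3P[].
pose phi (y : 'rV[R]_m) := rho (e (y *m S)) *m v.
have phiP x y : U x -> U y ->
    `|phi x - phi y - vec_mx ((x - y) *m B)| <= Num.min eps1 eps2 * `|x - y|.
  move=> /ySr[_ x1 _] /ySr[_ y1 _]; have := hdiff _ _ x1 y1.
  rewrite -![x *m S - y *m S]mulmxBl -mulmxA -BE => /le_trans; apply.
  rewrite (le_trans (ler_wpM2l (ltW epspos) (yS _)))// mulrA.
  by rewrite /eps divfK ?gt_eqF.
have phi_lip x y : U x -> U y -> `|x - y| <= 2 * CB * `|phi x - phi y|.
  move=> Ux Uy; have h1 := CBP (x - y).
  have h2 : `|(x - y) *m B| <= `|phi x - phi y| + eps1 * `|x - y|.
    rewrite -vec_mx_norm -[X in `|X| <= _](subrK (phi x - phi y)) addrC.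
    rewrite (le_trans (ler_normD _ _))// lerD2l distrC (le_trans (phiP _ _ Ux Uy))//.
    by rewrite ler_wpM2r// ge_min lexx.
  have h3 := le_trans h1 (ler_wpM2l CB0 h2).
  have h4 : CB * eps1 * `|x - y| <= 4^-1 * `|x - y| by rewrite ler_wpM2r.
  rewrite mulrDr (mulrA CB eps1) in h3; rewrite -(mulrA 2 CB).
  have h5 : 0 <= `|x - y| by [].
  by move: h3 h4 h5; lra.
have sphi : smooth U phi.
  move=> k; apply: Ck_mulmx => //; last exact: Ck_cst.
  apply: (@Ck_ext _ _ _ _ _ (fun y => (rho \o e) (0 + y *m S))) => //.
    by move=> y _; rewrite add0r.
  apply: (@Ck_comp_affine _ _ _ _ _ U _ (mulmxr S) 0 (rho \o e)); last exact: (uc_smooth uc k).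
    exact: mulmxr_continuous.
  by move=> y /ySr[y0 _ _]; rewrite /= add0r.
have dphi y : U y -> differentiable phi y by have [+ _] := sphi 1%N; exact.
exists U, phi; split; last 2 first.
  by rewrite /U/= normr0.
  by rewrite /phi mul0mx (uc_0 uc) (rho1 rho_rep) mul1mx.
split => //.
- move=> x Ux.
  suff h0 h : 'd phi x h = 0 -> h = 0.
    move=> h1 h2 /eqP; rewrite -subr_eq0 -linearB => /eqP/h0/eqP.
    by rewrite subr_eq0 => /eqP.
  move=> dh0; apply/eqP; rewrite -normr_le0.
  have hb : `|'d phi x h - vec_mx (h *m B)| <= Num.min eps1 eps2 * `|h|.
    apply: (@diff_strict_bound _ _ _ _ _ (fun h => vec_mx (h *m B)) _ U) => //.
    - exact: dphi.
    - by move=> t k; rewrite -scalemxAl linearZ.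
    - by move=> y Uy; exact: phiP.
  rewrite dh0 sub0r normrN vec_mx_norm in hb.
  have h1 : `|h *m B| <= eps1 * `|h| by rewrite (le_trans hb)// ler_wpM2r// ge_min lexx.
  have h2 := le_trans (CBP h) (ler_wpM2l CB0 h1).
  have h4 : CB * eps1 * `|h| <= 4^-1 * `|h| by rewrite ler_wpM2r.
  rewrite mulrA in h2; have h5 : 0 <= `|h| by []. 
  by move: h2 h4 h5; lra.
- move=> x y Ux Uy E; apply/eqP; rewrite -subr_eq0 -normr_le0.
  by rewrite (le_trans (phi_lip _ _ Ux Uy))// E subrr normr0 mulr0.
move=> O oO OU.
apply: relatively_open => y Oy; first by exists (e (y *m S)).
have [r' r'0 hr'] : exists2 r', 0 < r' & forall z, `|z - y| <= r' -> O z.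
  have /nbhs_ballP[r' /= r'0 h] : nbhs y O by exact: open_nbhs_nbhs.
  exists (r' / 2) => [|z zy]; first by rewrite divr_gt0.
  apply: h; rewrite -ball_normE /= distrC (le_lt_trans zy)// ltr_pdivrMr//.
  by rewrite ltr_pMr// ltr1n.
pose c8 := 4 * CB + C5 + 1.
have c80 : 0 < c8 by rewrite ltr_wpDl// addr_ge0// mulr_ge0.
pose n1 : R := n%:R + 1.
have n10 : 0 < n1 by rewrite ltr_wpDl.
(* The first bound keeps the corrected point [y2] in the ball [K], the second brings a^-1 g within
   reach of [lift]. *)
pose dl := Num.min (r' / 2 / c8) (del / n1).
have dl0 : 0 < dl by rewrite lt_min !divr_gt0.
exists dl => // _ [g _ <-] gy; set u := rho g *m v in gy *.
pose K := [set z | `|z - y| <= r'].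
have UK z : K z -> U z by move=> Kz; exact/OU/hr'.
have [|||y1 /set_mem Ky1 y1min] := @EVT_min_rV _ _ (fun z => `|phi z - u|) K.
- by exists y; rewrite /K/= subrr normr0 ltW.
- exact: closed_ball_compact.
- apply: continuous_in_subspaceT => z /set_mem Kz.
  apply: (@continuous_comp _ _ _ phi (fun w => `|w - u|)); last exact: dist_continuous.
  by apply: differentiable_continuous; exact/dphi/UK.
exists y1; first exact: hr'.
have Uy : U y by exact: OU.
have Uy1 := UK _ Ky1.
set eta := `|phi y1 - u|.
have eta_dl : eta < dl.
  rewrite (le_lt_trans _ gy)// distrC y1min// mem_set// /K/= subrr normr0.
  exact: ltW.
have [eta0|eta0] := ltP 0 eta; last first.
  by apply/eqP; rewrite -subr_eq0 -normr_le0.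
exfalso.
have dlr : dl * c8 <= r' / 2 by rewrite -ler_pdivlMr// ge_min lexx.
have y1y : `|y1 - y| <= 4 * CB * dl.
  rewrite (le_trans (phi_lip _ _ Uy1 Uy))//.
  have : `|phi y1 - phi y| <= 2 * dl.
    rewrite -[X in `|X| <= _](subrKA u) (le_trans (ler_normD _ _))//.
    by rewrite mulr_natl mulr2n lerD// ltW.
  move=> /(ler_wpM2l (mulr_ge0 (ler0n _ 2) CB0))/le_trans; apply.
  by rewrite le_eqVlt; apply/orP; left; apply/eqP; ring.
pose a := e (y1 *m S).
have [ya0 ya1 ya2] := ySr _ Uy1.
have hv : `|rho (a^-1 * g)%g *m v - v| <= n%:R * eta.
  have -> : rho (a^-1 * g)%g *m v - v = rho a^-1%g *m (u - phi y1).
    by rewrite mulmxBr /phi (rhoK rho_rep) (rep_mul rho_rep) mulmxA.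
  by rewrite (le_trans (rho_norm rho_rep _ _))// distrC.
have [|x [xr xC hx]] := lift (a^-1 * g)%g.
  rewrite (le_lt_trans hv)// (@le_lt_trans _ _ (n1 * eta))//.
    by rewrite ler_wpM2r ?(ltW eta0)// /n1 lerDl.
  by rewrite mulrC -ltr_pdivlMr// (lt_le_trans eta_dl)// ge_min lexx orbT.
have {}xC : `|x| <= C * n%:R * eta.
  by rewrite (le_trans xC)// -mulrA ler_wpM2l.
have uE : u = rho a *m (rho (e x) *m v) by rewrite -hx (rep_mul rho_rep) -mulmxA (rhoVK rho_rep).
pose er := rho (e x) *m v - v - vec_mx (x *m A).
have er_le : `|er| <= eps3 * `|x| by exact: hdiff0.
pose xi := x *m A *m pinvmx B.
have xiB : xi *m B = x *m A.
  by rewrite /xi mulmxKpV// /B eq_row_base submxMl.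
have xA : `|x *m A| <= d%:R * `|A| * (C * n%:R) * eta.
  by rewrite (le_trans (row_norm_le _ _))// -[leRHS]mulrA ler_wpM2l// mulr_ge0.
have xi_le : `|xi| <= C5 * eta.
  by rewrite (le_trans (CBP _))// xiB /C5 -mulrA ler_wpM2l.
pose y2 := y1 + xi.
have Ky2 : K y2.
  rewrite /K/= /y2 addrAC (le_trans (ler_normD _ _))// (le_trans (lerD y1y xi_le))//.
  rewrite (@le_trans _ _ (dl * c8))//; last first.
    rewrite (le_trans dlr)// ler_pdivrMr// ler_peMr ?(ltW r'0)//.
    by rewrite ler1n.
  rewrite /c8 [dl * _]mulrC [leRHS]mulrDl mul1r [X in X + dl]mulrDl -addrA lerD2l.
  by rewrite ler_wpDr ?(ltW dl0)// ler_wpM2l// ltW.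
have Uy2 := UK _ Ky2.
have P2 := phiP _ _ Uy2 Uy1.
have y21 : y2 - y1 = xi by rewrite /y2 addrAC subrr add0r.
rewrite y21 xiB in P2.
(* The errors left are the nonlinearity of phi, the turning of tangent vectors by a, and the
   nonlinearity of the action in x. *)
have E : phi y2 - u = (phi y2 - phi y1 - vec_mx (x *m A))
    - (rho a - 1%:M) *m vec_mx (x *m A) - rho a *m er.
  rewrite /er uE mulmxBl mul1mx !mulmxBr.
  have -> : phi y1 = rho a *m v by [].
  by apply/matrixP => i j; rewrite !mxE; ring.
have T1 : `|phi y2 - phi y1 - vec_mx (x *m A)| <= 4^-1 * eta.
  rewrite (le_trans P2)// (@le_trans _ _ (eps2 * (C5 * eta)))//.
    by rewrite ler_pM// ?ge_min ?lexx ?orbT// le_min !ltW.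
  by rewrite mulrA ler_wpM2r ?(ltW eta0)// mulrC.
have T2 : `|(rho a - 1%:M) *m vec_mx (x *m A)| <= 4^-1 * eta.
  rewrite (le_trans (mulmx_norm _ _))// vec_mx_norm.
  rewrite (le_trans (ler_pM _ _ (ler_wpM2l N0 (hrho _ ya2)) xA))// ?mulr_ge0//.
  rewrite [leLHS](_ : _ = c7 * eps4 * eta); last by rewrite /c7; ring.
  by apply: ler_wpM2r => //; exact: ltW.
have T3 : `|rho a *m er| <= 4^-1 * eta.
  rewrite (le_trans (rho_norm rho_rep _ _))// (le_trans (ler_wpM2l N0 er_le))//.
  rewrite (le_trans (ler_wpM2l N0 (ler_wpM2l (ltW eps30) xC)))//.
  rewrite [leLHS](_ : _ = c6 * eps3 * eta); last by rewrite /c6; ring.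
  by apply: ler_wpM2r => //; exact: ltW.
have : eta <= `|phi y2 - u| by apply: y1min; rewrite mem_set.
rewrite E leNgt => /negP; apply.
rewrite (le_lt_trans (ler_normB _ _))// (le_lt_trans (lerD (ler_normB _ _) T3))//.
rewrite (le_lt_trans (lerD (lerD T1 T2) (lexx _)))//.
exact: lt_three_quarters.
Qed.

Lemma orbit_mul g v : orbit (rho g *m v) = orbit v.
Proof.
apply/seteqP; split=> _ [h _ <-].
  by exists (h * g)%g => //; rewrite (rep_mul rho_rep) mulmxA.
exists (h * g^-1)%g => //.
by rewrite (rep_mul rho_rep) -mulmxA (rhoK rho_rep).
Qed.

Lemma translate_parametrization m g v U (phi : 'rV[R]_m -> 'cV[R]_n) :
  local_parametrization (orbit v) U phi ->
  local_parametrization (orbit v) U (fun x => rho g *m phi x).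
Proof.
case=> oU sphi imm inj rel; split; first exact: oU.
- by move=> k; apply: Ck_mulmx => //; exact: Ck_cst.
- move=> x Ux; have df : differentiable phi x by have [+ _] := sphi 1%N; exact.
  have [_ ->] := mulmxl_diff (rho g) df.
  by move=> h1 h2 /(congr1 (mulmx (rho g^-1%g))); rewrite !(rhoK rho_rep) => /(imm _ Ux).
- by move=> x y Ux Uy /(congr1 (mulmx (rho g^-1%g))); rewrite !(rhoK rho_rep); exact: inj.
move=> O oO OU; have [W oW WE] := rel O oO OU.
exists (mulmx (rho g^-1%g) @^-1` W).
  by apply: open_comp => // w _; exact: mulmx_continuous.
apply/seteqP; split=> [_ [y Oy <-]|w [[h _ <-] Ww]].
  have [[h _ hE] Wp] : (orbit v `&` W) (phi y) by rewrite -WE; exists y.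
  split; last by rewrite /preimage/= (rhoK rho_rep).
  by exists (g * h)%g => //; rewrite (rep_mul rho_rep) -mulmxA hE.
have [y Oy yE] : (phi @` O) (rho g^-1%g *m (rho h *m v)).
  by rewrite WE; split => //; exists (g^-1 * h)%g => //; rewrite (rep_mul rho_rep) mulmxA.
by exists y => //; rewrite yE (rhoVK rho_rep).
Qed.

Lemma orbit_submanifold v : @submanifold R (\rank (inf_act v)) n (orbit v).
Proof.
move=> _ [g _ <-]; have [U [phi [lp U0 p0]]] := orbit_parametrization v.
exists U, (fun x => rho g *m phi x); split; first exact: translate_parametrization.
by exists 0 => //; rewrite p0.
Qed.

(** * Tangent spaces in an arbitrary parametrization *)

Section Tangent.
Variables (v : 'cV[R]_n) (m : nat) (U : set 'rV[R]_m) (phi : 'rV[R]_m -> 'cV[R]_n).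
Hypothesis lp : local_parametrization (orbit v) U phi.
Variables (x : 'rV[R]_m) (g : G).
Hypotheses (Ux : U x) (xg : phi x = rho g *m v).

Let dphi : differentiable phi x.
Proof. by have [+ _] := lp_smooth lp 1%N; exact. Qed.

Lemma near_orbit : exists2 r, 0 < r & forall y, `|y - x| < r -> U y /\ orbit v (phi y).
Proof.
have [W _ WE] := lp_relopen lp (lp_open lp) (@subset_refl _ U).
have /nbhs_ballP[r /= r0' h] : nbhs x U by apply: open_nbhs_nbhs; split => //; exact: (lp_open lp).
exists r => // y yx; have Uy : U y by apply: h; rewrite -ball_normE /= distrC.
split => //; suff [] : (orbit v `&` W) (phi y) by [].
by rewrite -WE; exists y.
Qed.

(** The points phi (x + t h) lie on the orbit; after translation by g^-1 they are motions of v, to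
    which [inf_act_limit] applies. *)
Lemma parametrization_tangent h :
  exists z, 'd phi x h = rho g *m vec_mx (z *m inf_act v).
Proof.
have : (mxvec (rho g^-1%g *m 'd phi x h) <= inf_act v)%MS.
  apply: inf_act_limit => eps eps0.
  have [r rpos hr] := near_orbit.
  pose c := n%:R * `|h| + 1.
  have c0 : 0 < c by rewrite ltr_wpDl// mulr_ge0.
  have [r2 /= r20 hr2] := (@nbhs_ballP _ _ _ _).1 (diff_eps dphi (divr_gt0 eps0 c0)).
  pose c2 := `|h| + 1.
  have c20 : 0 < c2 by rewrite ltr_wpDl.
  pose t := Num.min (Num.min r r2 / c2) eps / 2.
  have t0 : 0 < t by rewrite !(divr_gt0, lt_min)// rpos r20.
  have t2 : t < Num.min (Num.min r r2 / c2) eps.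
    by rewrite /t ltr_pdivrMr// ltr_pMr ?ltr1n// !(divr_gt0, lt_min)// rpos r20.
  move: t2; rewrite lt_min => /andP[t2 teps].
  have th : `|t *: h| < Num.min r r2.
    rewrite normrZ ger0_norm ?(ltW t0)// (@le_lt_trans _ _ (t * c2))//.
      by rewrite ler_wpM2l ?(ltW t0)// lerDl.
    by rewrite -ltr_pdivlMr.
  move: th; rewrite lt_min => /andP[thr thr2].
  have [|_ [g' _ g'E]] := hr (t *: h + x); first by rewrite addrK.
  exists t, (g^-1 * g')%g; rewrite t0 teps; split=> //.
  rewrite (rep_mul rho_rep) -mulmxA g'E -[X in _ - X - _](rhoK rho_rep g) -xg.
  rewrite scalemxAr -!mulmxBr.
  have := hr2 (t *: h); rewrite -ball_normE /= sub0r normrN => /(_ thr2) H.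
  rewrite linearZ /= in H.
  rewrite (le_trans (rho_norm rho_rep _ _))// (le_trans (ler_wpM2l _ H))//.
  rewrite normrZ ger0_norm ?(ltW t0)//.
  rewrite mulrCA (_ : n%:R * (t * `|h|) = n%:R * `|h| * t); last by ring.
  rewrite mulrA ler_wpM2r ?(ltW t0)// -mulrA ler_piMr ?(ltW eps0)//.
  by rewrite mulrC ler_pdivrMr// mul1r lerDl.
move=> /submxP[z zE]; exists z.
by rewrite -zE mxvecK (rhoVK rho_rep).
Qed.

(** The inverse of phi is only known to be continuous. The points g e(t z) v lie in the relatively
    open image, so they are phi y; the immersion bounds y - x by O(t), and the vectors 'd phi ((y -
    x) / t) then tend to the given tangent vector. *)
Lemma parametrization_tangent_onto z :
  exists h, 'd phi x h = rho g *m vec_mx (z *m inf_act v).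
Proof.
pose D := lin1_mx (mxvec \o 'd phi x).
have DE h : h *m D = mxvec ('d phi x h) by rewrite mul_rV_lin1.
have fD : row_free D.
  rewrite -kermx_eq0; apply/rowV0P => h /sub_kermxP; rewrite DE => h0.
  apply: (lp_immersion lp Ux); rewrite linear0.
  by apply: (can_inj mxvecK); rewrite h0 linear0.
suff /submxP[h hE] : (mxvec (rho g *m vec_mx (z *m inf_act v)) <= D)%MS.
  by exists h; apply: (can_inj mxvecK); rewrite hE DE.
apply: row_space_closed => eps eps0.
have [CD CD0 CDP] := row_free_norm fD.
set w := vec_mx (z *m inf_act v).
pose c := n%:R * (`|w| + 1).
have c0 : 0 <= c by rewrite mulr_ge0// addr_ge0.
have [e1 e10 e1P] := small_factor CD0.
pose e2 := eps / 2 / (2 * CD * c + 1).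
have e2d : 0 < 2 * CD * c + 1 by rewrite ltr_wpDl// !mulr_ge0.
have e20 : 0 < e2 by rewrite !divr_gt0.
have e3 : 0 < Num.min e1 e2 by rewrite lt_min e10.
have [r1 /= r10 hr1] := (@nbhs_ballP _ _ _ _).1 (diff_eps dphi e3).
have [r2 r20 hr2] := near_orbit.
pose O := [set y | `|y - x| < Num.min r1 r2].
have oO : open O by exact: open_dist.
have OU : O `<=` U.
  by move=> y; rewrite /O/= lt_min => /andP[_ /hr2[]].
have [W oW WE] := lp_relopen lp oO OU.
have Ox : O x by rewrite /O/= subrr normr0 lt_min r10.
have [_ Wx] : (orbit v `&` W) (phi x) by rewrite -WE; exists x.
have /nbhs_ballP[r3 /= r30 hr3] : nbhs (phi x) W by exact: open_nbhs_nbhs.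
pose e4 := Num.min 1 (eps / 2 / (n%:R + 1)).
have n1 : 0 < n%:R + 1 :> R by rewrite ltr_wpDl.
have e40 : 0 < e4 by rewrite lt_min ltr01 !divr_gt0.
have [r4 r40 hr4] := inf_act_curve v z e40.
pose t := Num.min r4 (r3 / (c + 1)) / 2.
have c1 : 0 < c + 1 by rewrite ltr_wpDl.
have t0 : 0 < t by rewrite !(divr_gt0, lt_min)// r40.
have : t < Num.min r4 (r3 / (c + 1)).
  by rewrite /t ltr_pdivrMr// ltr_pMr ?ltr1n// !(divr_gt0, lt_min)// r40.
rewrite lt_min => /andP[tr4 tr3].
have := hr4 t; rewrite t0 tr4 => /(_ isT); rewrite -/w.
set u := rho (e (t *: z)) *m v => uw.
pose p := rho g *m u.
have uv : `|u - v| <= t * (`|w| + 1).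
  rewrite -[X in `|X| <= _](subrK (t *: w)) (le_trans (ler_normD _ _))//.
  rewrite normrZ ger0_norm ?(ltW t0)// mulrDr mulr1 addrC lerD2l (le_trans uw)//.
  by rewrite ler_piMl ?(ltW t0)// ge_min lexx.
have px : `|p - phi x| <= c * t.
  rewrite xg /p -mulmxBr (le_trans (rho_norm rho_rep _ _))//.
  by rewrite (le_trans (ler_wpM2l _ uv))// /c -mulrA (mulrC t).
have [y Oy yp] : (phi @` O) p.
  rewrite WE; split.
    by exists (g * e (t *: z))%g => //; rewrite (rep_mul rho_rep) -mulmxA.
  apply: hr3; rewrite -ball_normE /= distrC (le_lt_trans px)//.
  rewrite (@le_lt_trans _ _ ((c + 1) * t))//; first by rewrite ler_wpM2r ?(ltW t0)// lerDl.
  by rewrite mulrC -ltr_pdivlMr.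
pose h := y - x.
have hd : `|p - phi x - 'd phi x h| <= Num.min e1 e2 * `|h|.
  have := hr1 h; rewrite -ball_normE /= sub0r normrN /h subrK yp; apply.
  by move: Oy; rewrite /O/= lt_min => /andP[].
have h_le : `|h| <= 2 * CD * (c * t).
  have := CDP h; rewrite DE mxvec_norm => h1.
  have h2 : `|'d phi x h| <= c * t + e1 * `|h|.
    rewrite -[X in `|X| <= _](subrK (p - phi x)) addrC (le_trans (ler_normD _ _))//.
    rewrite lerD// distrC (le_trans hd)// ler_wpM2r//.
    by rewrite ge_min lexx.
  have h3 := le_trans h1 (ler_wpM2l CD0 h2).
  have h4 : CD * e1 * `|h| <= 4^-1 * `|h| by rewrite ler_wpM2r.
  rewrite mulrDr (mulrA CD e1) in h3; rewrite -(mulrA 2 CD).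
  have h5 : 0 <= `|h| by []. 
  have h6 : 0 <= CD * (c * t) by rewrite mulr_ge0// mulr_ge0// ltW.
  by move: h3 h4 h5 h6; lra.
exists (t^-1 *: (h *m D)); first by rewrite scalemx_sub// submxMl.
rewrite DE -linearZ -linearB mxvec_norm.
have -> : rho g *m w - t^-1 *: 'd phi x h =
   t^-1 *: ((p - phi x - 'd phi x h) - rho g *m (u - v - t *: w)).
  rewrite !mulmxBr -scalemxAr -xg -/p opprB.
  have -> : p - phi x - 'd phi x h + (t *: (rho g *m w) - (p - phi x)) =
      t *: (rho g *m w) - 'd phi x h by rewrite [LHS]addrC subrKA.
  by rewrite scalerBr scalerA mulVf ?gt_eqF// scale1r.
rewrite normrZ ger0_norm ?invr_ge0 ?(ltW t0)// mulrC ler_pdivrMr//.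
rewrite (le_trans (ler_normB _ _))// [eps]splitr mulrDl lerD//.
  rewrite (le_trans hd)// (@le_trans _ _ (e2 * (2 * CD * (c * t))))//.
    by rewrite ler_pM// ?ge_min ?lexx ?orbT// ltW.
  rewrite (_ : _ * _ = e2 * (2 * CD * c) * t); last by ring.
  apply: ler_wpM2r; first exact: ltW.
  rewrite /e2 mulrAC ler_pdivrMr// ler_wpM2l ?lerDl//.
  by rewrite divr_ge0// ltW.
rewrite (le_trans (rho_norm rho_rep _ _))// (le_trans (ler_wpM2l _ uw))//.
rewrite mulrA ler_wpM2r ?(ltW t0)// (@le_trans _ _ ((n%:R + 1) * (eps / 2 / (n%:R + 1))))//.
  by rewrite ler_pM// ?lerDl// ?(ltW e40)// ge_min lexx orbT.
by rewrite mulrC divfK// gt_eqF.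
Qed.

(** The tangent space depends only on the orbit, so all parametrizations have the same number of
    parameters and the value chosen in [dimension] is forced. *)
Lemma parametrization_rank : m = \rank (inf_act v).
Proof.
pose D := lin1_mx (mxvec \o 'd phi x).
have DE h : h *m D = mxvec ('d phi x h) by rewrite mul_rV_lin1.
have fD : row_free D.
  rewrite -kermx_eq0; apply/rowV0P => h /sub_kermxP; rewrite DE => h0.
  apply: (lp_immersion lp Ux); rewrite linear0.
  by apply: (can_inj mxvecK); rewrite h0 linear0.
have <- : \rank D = m by exact/eqP.
pose M k : 'M[R]_(n * 1) := lin_mulmx (rho k).
have ME k z : z *m M k = mxvec (rho k *m vec_mx z).
  by rewrite -{1}[z]vec_mxK mul_vec_lin.
apply/eqP; rewrite eqn_leq; apply/andP; split.
  rewrite (leq_trans _ (mxrankM_maxl (inf_act v) (M g)))// mxrankS//.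
  apply/row_subP => i; have [z zE] := parametrization_tangent (delta_mx 0 i).
  by rewrite rowE DE zE -ME -mulmxA submxMl.
rewrite (leq_trans _ (mxrankM_maxl D (M g^-1%g)))// mxrankS//.
apply/row_subP => i; have [h hE] := parametrization_tangent_onto (delta_mx 0 i).
have -> : row i (inf_act v) = h *m D *m M g^-1%g.
  by rewrite DE ME mxvecK hE (rhoK rho_rep) vec_mxK rowE.
by rewrite -mulmxA submxMl.
Qed.

End Tangent.

Lemma dimension_orbit v : dimension (orbit v) = \rank (inf_act v).
Proof.
apply: xget_unique => [|m sm]; first exact: orbit_submanifold.
have ov : orbit v v by exists 1%g => //; rewrite (rho1 rho_rep) mul1mx.
have [U [phi [lp [x Ux xv]]]] := sm v ov.
by apply: (parametrization_rank lp Ux (g := 1%g)); rewrite (rho1 rho_rep) mul1mx.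
Qed.

End OrbitGeometry.

(** * Left and right multiplication as operators on flattened matrices *)

Section LinMx.
Variable R : realType.

Lemma lin_mx_entry m1 n1 m2 n2 (f : {linear 'M[R]_(m1, n1) -> 'M[R]_(m2, n2)})
    i j k l :
  lin_mx f (mxvec_index i j) (mxvec_index k l) = f (delta_mx i j) k l.
Proof.
have -> : lin_mx f (mxvec_index i j) (mxvec_index k l) =
    (delta_mx (0 : 'I_1) (mxvec_index i j) *m lin_mx f) 0 (mxvec_index k l).
  by rewrite -rowE [RHS]mxE.
by rewrite -mxvec_delta mul_vec_lin mxvecE.
Qed.

Lemma tr_lin_mulmx n p (A : 'M[R]_n) :
  (lin_mulmx A : 'M[R]_(n * p))^T = lin_mulmx A^T.
Proof.
apply/matrixP => a b; case/mxvec_indexP: a => i j; case/mxvec_indexP: b => k l.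
rewrite mxE !lin_mx_entry /= !mxE (bigD1 k)//= [RHS](bigD1 i)//=.
rewrite !mxE !eqxx /= !big1 ?addr0 => [|t|t]; first by rewrite eq_sym.
  by move=> /negPf ti; rewrite !mxE ti mulr0.
by move=> /negPf ti; rewrite !mxE ti mulr0.
Qed.

Lemma tr_lin_mulmxr n p (A : 'M[R]_p) :
  (lin_mulmxr A : 'M[R]_(n * p))^T = lin_mulmxr A^T.
Proof.
apply/matrixP => a b; case/mxvec_indexP: a => i j; case/mxvec_indexP: b => k l.
rewrite mxE !lin_mx_entry /= !mxE (bigD1 l)//= [RHS](bigD1 j)//=.
rewrite !mxE !eqxx /= !andbT !big1 ?addr0 => [|t|t]; first by rewrite eq_sym.
  by move=> /negPf ti; rewrite !mxE ti andbF mul0r.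
by move=> /negPf ti; rewrite !mxE ti andbF mul0r.
Qed.

Lemma lin_mulmx_comp m n p q (A : 'M[R]_(m, n)) (B : 'M[R]_(n, p)) :
  (lin_mulmx B : 'M[R]_(p * q, n * q)) *m lin_mulmx A = lin_mulmx (A *m B).
Proof.
apply/row_matrixP => i; rewrite !rowE mulmxA.
case/mxvec_indexP: i => k l; rewrite -mxvec_delta !mul_vec_lin /=.
by rewrite mulmxA.
Qed.

Lemma lin_mulmxr_comp m n p q (A : 'M[R]_(n, p)) (B : 'M[R]_(p, q)) :
  (lin_mulmxr A : 'M[R]_(m * n, m * p)) *m lin_mulmxr B = lin_mulmxr (A *m B).
Proof.
apply/row_matrixP => i; rewrite !rowE mulmxA.
case/mxvec_indexP: i => k l; rewrite -mxvec_delta !mul_vec_lin /=.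
by rewrite mulmxA.
Qed.

Lemma lin_mulmxC m n p q (A : 'M[R]_(m, n)) (B : 'M[R]_(p, q)) :
  (lin_mulmx A : 'M[R]_(n * p, m * p)) *m lin_mulmxr B =
  lin_mulmxr B *m lin_mulmx A.
Proof.
apply/row_matrixP => i; rewrite !rowE !mulmxA.
case/mxvec_indexP: i => k l; rewrite -mxvec_delta !mul_vec_lin /= mulmxA.
by [].
Qed.

Lemma lin_mulmx1 n p : lin_mulmx (1%:M : 'M[R]_n) = 1%:M :> 'M[R]_(n * p).
Proof.
apply/row_matrixP => i; rewrite !rowE mulmx1.
case/mxvec_indexP: i => k l; rewrite -mxvec_delta !mul_vec_lin /= mul1mx.
by [].
Qed.

Lemma lin_mulmxr1 n p : lin_mulmxr (1%:M : 'M[R]_p) = 1%:M :> 'M[R]_(n * p).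
Proof.
apply/row_matrixP => i; rewrite !rowE mulmx1.
case/mxvec_indexP: i => k l; rewrite -mxvec_delta !mul_vec_lin /= mulmx1.
by [].
Qed.

End LinMx.

(** * Adjoint action, isotropy algebras and orthonormal frames *)

Section Frame.
Variables (R : realType) (G : lieGroupType R) (n : nat) (rho : G -> 'M[R]_n).
Hypothesis rho_rep : orthogonal_representation rho.
Hypothesis G_compact : compact [set: G].
Variables (d : nat) (e : 'rV[R]_d -> G) (L : 'M[R]_(d, n * n)) (r0 : R).
Hypothesis uc : unit_coordinates rho e L r0.
Local Notation inf_act := (inf_act L).
Local Notation orbit := (Defs.orbit rho).

(** Conjugating e(t z) by g gives a motion of the identity matrix with velocity g X g^-1, which
    [inf_act_limit] places in the Lie algebra. *)
Lemma adjoint_sub g : (L *m lin_mulmx (rho g) *m lin_mulmxr (rho g^-1%g) <= L)%MS.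
Proof.
have LE : inf_act (1%:M : 'M[R]_n) = L by rewrite -[LHS]/(L *m lin_mulmxr 1%:M) lin_mulmxr1 mulmx1.
apply/row_subP => i; rewrite rowE !mulmxA.
set z := delta_mx 0 i.
rewrite -[z *m L]vec_mxK !mul_vec_lin /= -{2}LE.
apply: (inf_act_limit rho_rep G_compact uc) => eps eps0.
pose c : R := n%:R * n%:R + 1.
have c0 : 0 < c by rewrite ltr_wpDl// mulr_ge0.
have [r rpos h] := inf_act_curve rho_rep uc (1%:M : 'M[R]_n) z (divr_gt0 eps0 c0).
pose t := Num.min r eps / 2.
have t0 : 0 < t by rewrite divr_gt0// lt_min rpos.
have : t < Num.min r eps by rewrite /t ltr_pdivrMr// ltr_pMr ?ltr1n// lt_min rpos.
rewrite lt_min => /andP[tr te].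
exists t, (g * e (t *: z) * g^-1)%g; split; first by rewrite t0.
have := h t; rewrite t0 tr => /(_ isT); rewrite LE !mulmx1.
set w := vec_mx (z *m L) => H.
have gg : rho g *m rho g^-1%g = 1%:M by rewrite -(rep_mul rho_rep) mulgV (rho1 rho_rep).
have -> : rho (g * e (t *: z) * g^-1)%g - 1%:M - t *: (rho g *m w *m rho g^-1%g) =
    rho g *m (rho (e (t *: z)) - 1%:M - t *: w) *m rho g^-1%g.
  by rewrite !(rep_mul rho_rep) !mulmxBr !mulmxBl mulmx1 gg -scalemxAr -scalemxAl.
rewrite -mulmxA (le_trans (rho_norm rho_rep _ _))//.
have h2 (X : 'M[R]_n) : `|X *m rho g^-1%g| <= n%:R * `|X|.
  rewrite -trmx_norm trmx_mul -(rhoV rho_rep) invgK.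
  by rewrite (le_trans (rho_norm rho_rep _ _))// trmx_norm.
rewrite (le_trans (ler_wpM2l _ (h2 _)))// (le_trans (ler_wpM2l _ (ler_wpM2l _ H)))//.
rewrite [leLHS](_ : _ = eps * (n%:R * n%:R / c) * t); last by ring.
apply: ler_wpM2r; first exact: ltW.
by rewrite ler_piMr ?(ltW eps0)// ler_pdivrMr// mul1r lerDl.
Qed.

Lemma inf_act_translate g (v : 'cV[R]_n) :
  (inf_act v *m lin_mulmx (rho g) <= inf_act (rho g *m v))%MS.
Proof.
rewrite -[inf_act v]/(L *m lin_mulmxr v) -mulmxA -lin_mulmxC mulmxA.
rewrite -[inf_act _]/(L *m lin_mulmxr (rho g *m v)).
have -> : lin_mulmxr v = lin_mulmxr (rho g^-1%g) *m lin_mulmxr (rho g *m v) :> 'M[R]_(n * n, n * 1).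
  by rewrite lin_mulmxr_comp (rhoK rho_rep).
by rewrite mulmxA submxMr// adjoint_sub.
Qed.

(** Inclusion of isotropy groups gives inclusion of isotropy algebras: a kernel vector at v is close
    to the coordinates of an element fixing v, hence w, so its action on w vanishes to first
    order. *)
Lemma inf_act_kernel k l (v : 'M[R]_(n, k)) (w : 'M[R]_(n, l)) :
  (forall g, rho g *m v = v -> rho g *m w = w) ->
  forall z : 'rV[R]_d, z *m inf_act v = 0 -> z *m inf_act w = 0.
Proof.
move=> hvw z zv; apply/eqP; rewrite -normr_le0; apply/ler_addgt0Pr => eps0 eps00.
rewrite add0r.
pose c := d%:R * `|inf_act w|.
have c0 : 0 <= c by rewrite mulr_ge0.
pose K := (c + 2) * `|z| + 1.
have K0 : 0 < K by rewrite ltr_wpDl// mulr_ge0// addr_ge0.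
pose eps := Num.min 1 (eps0 / K).
have epspos : 0 < eps by rewrite lt_min ltr01 divr_gt0.
have [r1 r10 h1] := kernel_fixed rho_rep uc v epspos.
have [r2 r20 h2] := act_diff0 rho_rep uc w epspos.
pose t := Num.min r1 r2 / (2 * (`|z| + 1)).
have z1 : 0 < `|z| + 1 by rewrite ltr_wpDl.
have t0 : 0 < t by rewrite !divr_gt0 ?lt_min ?r10// mulr_gt0.
have tz : 2 * `|t *: z| < Num.min r1 r2.
  rewrite normrZ ger0_norm ?(ltW t0)// (@lt_le_trans _ _ (2 * (t * (`|z| + 1))))//.
    by rewrite !ltr_pM2l// ltrDl.
  rewrite mulrCA /t divfK// gt_eqF// mulr_gt0//.
clearbody t.
have tz1 : `|t *: z| <= 2 * `|t *: z| by rewrite ler_peMl// ler1n.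
have [||y yv yz] := h1 (t *: z).
- by rewrite (le_lt_trans tz1)// (lt_le_trans tz)// ge_min lexx.
- by rewrite -scalemxAl zv scaler0.
have y2 : `|y| <= 2 * `|t *: z|.
  rewrite -[y](subrK (t *: z)) (le_trans (ler_normD _ _))// mulr_natl mulr2n.
  by rewrite lerD2r (le_trans yz)// ler_piMl// ge_min lexx.
have := h2 y; rewrite (hvw _ yv) subrr sub0r normrN vec_mx_norm => H.
have {}H : `|y *m inf_act w| <= eps * `|y|.
  by apply: H; rewrite (le_lt_trans y2)// (lt_le_trans tz)// ge_min lexx orbT.
have : `|t *: z *m inf_act w| <= eps * ((c + 2) * `|t *: z|).
  have -> : t *: z *m inf_act w = y *m inf_act w - (y - t *: z) *m inf_act w.
    by rewrite -mulmxBl opprB addrC subrK.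
  rewrite (le_trans (ler_normB _ _))// addrC mulrDl mulrDr lerD//.
    by rewrite (le_trans (row_norm_le _ _))// -/c mulrCA ler_wpM2l.
  by rewrite (le_trans H)// ler_wpM2l// ltW.
have tn p q (u : 'M[R]_(p, q)) : `|t *: u| = t * `|u|.
  by rewrite normrZ ger0_norm ?(ltW t0).
rewrite -scalemxAl !tn.
rewrite [X in _ <= X -> _](_ : _ = t * (eps * ((c + 2) * `|z|))); last by ring.
rewrite ler_pM2l// => H2.
rewrite (le_trans H2)// (@le_trans _ _ (eps0 / K * K))//; last by rewrite divfK// gt_eqF.
by rewrite ler_pM ?(ltW epspos) ?mulr_ge0 ?addr_ge0// ?ge_min ?lexx ?orbT// /K lerDl.
Qed.

(* An orthonormal basis of the Lie algebra, for the trace form. *)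
Variables (N : nat) (Z : 'M[R]_(N, n * n)).
Hypotheses (ZZ : Z *m Z^T = 1%:M) (ZL : (Z :=: L)%MS).

Definition frame_act (v : 'cV[R]_n) : 'M[R]_(N, n * 1) := Z *m lin_mulmxr v.

Lemma frame_actE v : (frame_act v :=: inf_act v)%MS.
Proof. exact: eqmxMr. Qed.

Lemma frame_act_ker (v w : 'cV[R]_n) :
  (forall g, rho g *m v = v -> rho g *m w = w) ->
  forall c : 'rV[R]_N, c *m frame_act v = 0 -> c *m frame_act w = 0.
Proof.
move=> hvw c; rewrite /frame_act !mulmxA.
have /submxP[z ->] : (c *m Z <= L)%MS by rewrite -ZL submxMl.
by rewrite -!mulmxA; exact: inf_act_kernel.
Qed.

Lemma sqminors_frame_mul g v r :
  sqminors r (frame_act (rho g *m v)) = sqminors r (frame_act v).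
Proof.
(* [C] is X |-> g^-1 X g, an isometry for the trace form; [Y] below is its matrix in the basis
   [Z]. *)
pose C : 'M[R]_(n * n) := lin_mulmx (rho g^-1%g) *m lin_mulmxr (rho g).
have CC : C *m C^T = 1%:M.
  rewrite /C trmx_mul tr_lin_mulmxr tr_lin_mulmx -mulmxA (mulmxA (lin_mulmxr _)).
  rewrite lin_mulmxr_comp (rho_tr rho_rep) lin_mulmxr1 mul1mx lin_mulmx_comp.
  by rewrite (rep_orthogonal rho_rep) lin_mulmx1.
have /submxP[Y YE] : (Z *m C <= Z)%MS.
  have := adjoint_sub g^-1%g; rewrite invgK -mulmxA -/C => h.
  by rewrite ZL (submx_trans _ h)// submxMr// ZL.
have YY : Y *m Y^T = 1%:M.
  have -> : Y *m Y^T = (Y *m Z) *m (Y *m Z)^T.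
    by rewrite trmx_mul -mulmxA (mulmxA Z) ZZ mul1mx.
  by rewrite -YE trmx_mul -mulmxA (mulmxA C) CC mul1mx.
have -> : frame_act (rho g *m v) = Y *m (frame_act v) *m lin_mulmx (rho g).
  rewrite /frame_act !mulmxA -YE /C -!mulmxA; congr (_ *m _).
  rewrite (mulmxA (lin_mulmxr (rho g))) lin_mulmxr_comp -lin_mulmxC mulmxA.
  by rewrite lin_mulmx_comp -(rep_mul rho_rep) mulgV (rho1 rho_rep) lin_mulmx1 mul1mx.
rewrite sqminors_isometryr; last first.
  by rewrite tr_lin_mulmx lin_mulmx_comp (rep_orthogonal rho_rep) lin_mulmx1.
rewrite sqminors_isometryl//.
exact: mulmx1C.
Qed.

End Frame.

(** * Equivariant maps between orbits *)

Section CkMore.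
Variables (R : realType) (V : normedModType R) (U : set V).
Hypothesis oU : open U.

Lemma Ck_mxvec k m n (f : V -> 'M[R]_(m, n)) :
  Ck k U f -> Ck k U (fun x => mxvec (f x)).
Proof.
move=> /(Ck_mxP _ _ oU) hf; apply/Ck_mxP => // i j; case/mxvec_indexP: j => a b.
by rewrite (ord1 i); under eq_fun do rewrite mxvecE.
Qed.

Lemma Ck_vec_mx k m n (f : V -> 'rV[R]_(m * n)) :
  Ck k U f -> Ck k U (fun x => vec_mx (f x)).
Proof.
move=> /(Ck_mxP _ _ oU) hf; apply/Ck_mxP => // i j.
by under eq_fun do rewrite mxE.
Qed.

Lemma Ck_lin_mulmxr k N m n p (A : 'M[R]_(N, m * n)) (f : V -> 'M[R]_(n, p)) :
  Ck k U f -> Ck k U (fun x => A *m lin_mulmxr (f x)).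
Proof.
move=> hf; apply/Ck_mxP => // i j; case/mxvec_indexP: j => a b.
have E x : (A *m lin_mulmxr (f x)) i (mxvec_index a b) =
    (vec_mx (row i A) *m f x) a b.
  have -> : (A *m lin_mulmxr (f x)) i (mxvec_index a b) =
     (row i (A *m lin_mulmxr (f x))) 0 (mxvec_index a b) by rewrite [RHS]mxE.
  by rewrite row_mul -[row i A]vec_mxK mul_vec_lin mxvecE vec_mxK.
under eq_fun do rewrite E.
have := Ck_mulmx oU (Ck_cst k U (vec_mx (row i A))) hf.
by move=> /(Ck_mxP _ _ oU); exact.
Qed.

Lemma open_neq0 (f : V -> R) : Ck 0 U f -> open (U `&` [set x | f x != 0]).
Proof.
move=> cf; rewrite openE => x [Ux fx]; rewrite /interior.
apply: filterI; first exact: open_nbhs_nbhs.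
have f0 : 0 < `|f x| / 2 by rewrite divr_gt0// normr_gt0.
have /cvgrPdist_lt/(_ _ f0) := cf x Ux.
apply: filterS => y; rewrite /= => h; apply/eqP => fy; move: h.
rewrite fy subr0 ltNge => /negP; apply.
by rewrite ler_pdivrMr// ler_pMr ?normr_gt0// ler1n.
Qed.

End CkMore.

Lemma dot_vec_mx (R : realType) n (u w : 'rV[R]_(n * 1)) :
  ((vec_mx u : 'cV[R]_n)^T *m vec_mx w) 0 0 = (u *m w^T) 0 0.
Proof.
rewrite !mxE (reindex (fun a : 'I_n => mxvec_index a (0 : 'I_1))) /=.
  by apply: eq_bigr => a _; rewrite !mxE.
have [f fK Kf] := curry_mxvec_bij n 1.
exists (fun j => (f j).1) => [a _|j _].
  by rewrite (fK (a, 0)).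
by rewrite -[RHS](Kf j)//; case: (f j) => a b; rewrite /= (ord1 b).
Qed.

Lemma row_free_submx (R : fieldType) N q m (A : 'M[R]_(N, q)) :
  \rank A = m -> exists S : 'M[R]_(m, N), row_free (S *m A).
Proof.
move=> <-; have [S SE] : exists S, row_base A = S *m A.
  by apply/submxP; rewrite eq_row_base.
by exists S; rewrite -SE row_base_free.
Qed.

Section Transfer.
Variables (R : realType) (G : lieGroupType R) (n : nat) (rho : G -> 'M[R]_n).
Hypothesis rho_rep : orthogonal_representation rho.
Hypothesis G_compact : compact [set: G].
Variables (d : nat) (e : 'rV[R]_d -> G) (L : 'M[R]_(d, n * n)) (r0 : R).
Hypothesis uc : unit_coordinates rho e L r0.
Variables (N : nat) (Z : 'M[R]_(N, n * n)).
Hypotheses (ZZ : Z *m Z^T = 1%:M) (ZL : (Z :=: L)%MS).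
Local Notation inf_act := (inf_act L).
Local Notation frame_act := (frame_act Z).
Local Notation orbit := (Defs.orbit rho).

(* For isotropy groups G_v and G_w that coincide, the equivariant map from the
   orbit of v to the orbit of w that sends v to w. *)
Definition transfer (v w p : 'cV[R]_n) : 'cV[R]_n :=
  rho (xget 1%g [set g | rho g *m v = p]) *m w.

Lemma same_action (v w : 'cV[R]_n) :
  (forall g, rho g *m v = v -> rho g *m w = w) ->
  forall g h, rho g *m v = rho h *m v -> rho g *m w = rho h *m w.
Proof.
move=> vw g h E; rewrite -(rhoVK rho_rep h (rho g *m w)); congr (_ *m _).
rewrite mulmxA -(rep_mul rho_rep); apply: vw.
by rewrite (rep_mul rho_rep) -mulmxA E (rhoK rho_rep).
Qed.

(** [c] holds the coordinates of g X g^-1 in the frame. It does not depend on u, so one [c] serves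
    the orbits of v and w at once. *)
Lemma adjoint_frame g (z : 'rV[R]_d) : exists c : 'rV[R]_N, forall u : 'cV[R]_n,
  vec_mx (c *m frame_act (rho g *m u)) = rho g *m vec_mx (z *m inf_act u).
Proof.
have /submxP[c cE] : (z *m (L *m lin_mulmx (rho g) *m lin_mulmxr (rho g^-1%g)) <= Z)%MS.
  by rewrite ZL mulmx_sub// (adjoint_sub rho_rep G_compact uc).
exists c => u; rewrite -[frame_act _]/(Z *m lin_mulmxr (rho g *m u)) mulmxA -cE.
rewrite -!mulmxA lin_mulmxr_comp (rhoK rho_rep) lin_mulmxC !mulmxA.
by rewrite mx_rV_lin.
Qed.

Lemma rank_frame_act g v : \rank (frame_act (rho g *m v)) = \rank (inf_act v).
Proof.
have le g' (u : 'cV[R]_n) : (\rank (inf_act u) <= \rank (inf_act (rho g' *m u)))%N.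
  have h := mxrankS (inf_act_translate rho_rep G_compact uc g' u).
  rewrite (leq_trans _ h)//.
  rewrite -[X in (\rank X <= _)%N]mulmx1 -lin_mulmx1.
  have -> : lin_mulmx 1%:M = lin_mulmx (rho g') *m lin_mulmx (rho g'^-1%g) :> 'M[R]_(n * 1).
    by rewrite lin_mulmx_comp -(rep_mul rho_rep) mulVg (rho1 rho_rep).
  by rewrite mulmxA mxrankM_maxl.
rewrite (frame_actE ZL); apply/eqP; rewrite eqn_leq le andbT.
by have := le g^-1%g (rho g *m v); rewrite (rhoK rho_rep).
Qed.

Variables (v w : 'cV[R]_n).
Hypotheses (vw : forall g, rho g *m v = v -> rho g *m w = w)
  (wv : forall g, rho g *m w = w -> rho g *m v = v).

Lemma transferE g : transfer v w (rho g *m v) = rho g *m w.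
Proof.
apply: (same_action vw).
exact: (@xgetPex _ (1%g : G) [set h | rho h *m v = rho g *m v] (ex_intro _ g erefl)).
Qed.

Variables (m : nat) (U : set 'rV[R]_m) (phi : 'rV[R]_m -> 'cV[R]_n).
Hypothesis lp : local_parametrization (orbit v) U phi.
Let q x := transfer v w (phi x).

Let dphi x : U x -> differentiable phi x.
Proof. by have [+ _] := lp_smooth lp 1%N; exact. Qed.

Let orbit_phi x : U x -> exists g, phi x = rho g *m v.
Proof.
move=> Ux; have [r r_gt0 h] := near_orbit lp Ux.
by have [|_ [g _ gE]] := h x; [rewrite subrr normr0|exists g].
Qed.

(** By [local_lift], passing from phi x to phi (h + x) amounts to inserting e(z) with z = O(h). This
    z is neither unique nor known to be smooth in h, but its infinitesimal action on w is a linear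
    function [T] of its action on v. *)
Lemma transfer_diff x g : U x -> phi x = rho g *m v ->
  differentiable q x /\ forall h z,
  'd phi x h = rho g *m vec_mx (z *m inf_act v) ->
  'd q x h = rho g *m vec_mx (z *m inf_act w).
Proof.
move=> Ux xg.
pose Av := inf_act v; pose Aw := inf_act w.
pose T := pinvmx Av *m Aw.
have AT : Av *m T = Aw.
  apply/eqP; rewrite -subr_eq0; apply/eqP/row_matrixP => i; rewrite row0.
  rewrite /T mulmxA -[X in _ - X]mul1mx -mulmxBl row_mul.
  apply: (inf_act_kernel rho_rep uc vw).
  by rewrite -row_mul mulmxBl mul1mx mulmxKpV// subrr row0.
pose D := lin1_mx (mxvec \o 'd phi x).
have DE h : h *m D = mxvec ('d phi x h) by rewrite mul_rV_lin1.
pose M k : 'M[R]_(n * 1) := lin_mulmx (rho k).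
have ME k z : z *m M k = mxvec (rho k *m vec_mx z).
  by rewrite -{1}[z]vec_mxK mul_vec_lin.
pose Q := D *m M g^-1%g *m T *m M g.
pose dq : {linear 'rV[R]_m -> 'cV[R]_n} := vec_mx \o mulmxr Q.
have cdq : continuous dq.
  apply: (@lipschitz_continuous _ _ _ _ (m%:R * `|Q|)) => a b.
  by rewrite -linearB /dq /= vec_mx_norm row_norm_le.
have dqE h : dq h = rho g *m vec_mx (mxvec (rho g^-1%g *m 'd phi x h) *m T).
  by rewrite /dq/= /Q !mulmxA DE ME mxvecK ME mxvecK.
have qx : q x = rho g *m w by rewrite /q xg transferE.
have [||dfq dqq] := @eps_diff _ _ _ q x dq.
- exact: cdq.
- move=> eps eps0.
  have [C C0 lift] := local_lift rho_rep G_compact uc v.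
  pose nn : R := n%:R.
  have nn0 : 0 <= nn by [].
  pose cD := m%:R * `|D| + 1.
  have cD0 : 0 < cD by rewrite ltr_wpDl// mulr_ge0.
  pose cz := C * (nn * cD).
  have cz0 : 0 <= cz by rewrite mulr_ge0// mulr_ge0// ltW.
  pose cT := (n * 1)%:R * `|T|.
  have cT0 : 0 <= cT by rewrite mulr_ge0.
  pose K := nn * cz + nn * (cT * (cz + nn)) + 1.
  have K0 : 0 < K.
    by rewrite ltr_wpDl// addr_ge0// mulr_ge0// mulr_ge0// addr_ge0.
  pose e1 := Num.min 1 (eps / K).
  have e10 : 0 < e1 by rewrite lt_min ltr01 divr_gt0.
  have [r1 r10 h1] := act_diff0 rho_rep uc v e10.
  have [r2 r20 h2] := act_diff0 rho_rep uc w e10.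
  have r12 : 0 < Num.min r1 r2 by rewrite lt_min r10.
  have [del del0 {}lift] := lift _ r12.
  have [r3 r30 hr3] := near_orbit lp Ux.
  have H1 := diff_eps (dphi Ux) e10.
  have c1 : 0 < nn * cD + 1 by rewrite ltr_wpDl// mulr_ge0// ltW.
  have H2 : \forall h \near (0 : 'rV[R]_m), `|h| < Num.min r3 (del / (nn * cD + 1)).
    by apply: nbhs0_lt; rewrite lt_min r30 divr_gt0.
  apply: filterS2 H1 H2 => h H1; rewrite lt_min => /andP[h3 hdel].
  have h0 : 0 <= `|h| by [].
  have [|_ [g' _ g'E]] := hr3 (h + x); first by rewrite addrK.
  have ph : `|phi (h + x) - phi x| <= cD * `|h|.
    rewrite -[X in `|X| <= _](subrK ('d phi x h)) (le_trans (ler_normD _ _))//.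
    rewrite addrC /cD mulrDl mul1r lerD//.
      by rewrite -mxvec_norm -DE row_norm_le.
    by rewrite (le_trans H1)// ler_piMl// ge_min lexx.
  have gE : rho (g^-1 * g')%g *m v = rho g^-1%g *m phi (h + x).
    by rewrite (rep_mul rho_rep) -mulmxA g'E.
  have gx : rho g^-1%g *m phi x = v by rewrite xg (rhoK rho_rep).
  have uv : `|rho (g^-1 * g')%g *m v - v| <= nn * cD * `|h|.
    rewrite gE -[X in _ - X]gx -mulmxBr (le_trans (rho_norm rho_rep _ _))//.
    by rewrite -mulrA ler_wpM2l.
  have [|z [zr zC gz]] := lift (g^-1 * g')%g.
    rewrite (le_lt_trans uv)// (@le_lt_trans _ _ ((nn * cD + 1) * `|h|))//.
      by rewrite ler_wpM2r// lerDl.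
    by rewrite mulrC -ltr_pdivlMr.
  move: zr; rewrite lt_min => /andP[zr1 zr2].
  have zh : `|z| <= cz * `|h|.
    by rewrite (le_trans zC)// (le_trans (ler_wpM2l C0 uv))// /cz !mulrA.
  have pE : phi (h + x) = rho (g * e z)%g *m v.
    by rewrite (rep_mul rho_rep) -mulmxA -gz gE (rhoVK rho_rep).
  have qE : q (h + x) = rho g *m (rho (e z) *m w).
    by rewrite /q pE transferE (rep_mul rho_rep) mulmxA.
  pose a := rho g^-1%g *m (phi (h + x) - phi x - 'd phi x h).
  pose ev := rho (e z) *m v - v - vec_mx (z *m Av).
  pose ew := rho (e z) *m w - w - vec_mx (z *m Aw).
  have ev_le : `|ev| <= e1 * `|z| by exact: h1.
  have ew_le : `|ew| <= e1 * `|z| by exact: h2.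
  have a_le : `|a| <= nn * (e1 * `|h|).
    by rewrite (le_trans (rho_norm rho_rep _ _))// ler_wpM2l.
  have -> : q (h + x) - q x - dq h = rho g *m (ew + vec_mx (mxvec (a - ev) *m T)).
    have aE : a - ev = vec_mx (z *m Av) - rho g^-1%g *m 'd phi x h.
      by rewrite /a /ev !mulmxBr -gE gz gx; apply/matrixP => i j; rewrite !mxE; ring.
    have -> : vec_mx (mxvec (a - ev) *m T) =
        vec_mx (z *m Aw) - vec_mx (mxvec (rho g^-1%g *m 'd phi x h) *m T).
      by rewrite aE linearB mulmxBl linearB /= vec_mxK -mulmxA AT.
    rewrite dqE qE qx /ew -!mulmxBr; congr (_ *m _).
    by rewrite addrA subrK.
  rewrite (le_trans (rho_norm rho_rep _ _))//.
  have b1 : `|ew| <= cz * (e1 * `|h|).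
    by rewrite (le_trans ew_le)// mulrCA ler_wpM2l// ltW.
  have b2 : `|a - ev| <= (cz + nn) * (e1 * `|h|).
    rewrite (le_trans (ler_normB _ _))// mulrDl addrC lerD//.
    by rewrite (le_trans ev_le)// mulrCA ler_wpM2l// ltW.
  have b3 : `|vec_mx (mxvec (a - ev) *m T) : 'cV[R]_n| <= cT * ((cz + nn) * (e1 * `|h|)).
    by rewrite vec_mx_norm (le_trans (row_norm_le _ _))// mxvec_norm ler_wpM2l.
  rewrite (le_trans (ler_wpM2l nn0 (le_trans (ler_normD _ _) (lerD b1 b3))))//.
  rewrite (@le_trans _ _ (K * (e1 * `|h|)))//.
    rewrite [leLHS](_ : _ = (nn * cz + nn * (cT * (cz + nn))) * (e1 * `|h|)); last by ring.
    apply: ler_wpM2r; first by rewrite mulr_ge0// ltW.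
    by rewrite /K lerDl.
  rewrite mulrA ler_wpM2r// -ler_pdivlMl// mulrC ge_min lexx orbT//.
split=> // h z hz; rewrite dqq dqE hz (rhoK rho_rep) vec_mxK.
by rewrite -mulmxA AT.
Qed.

Lemma transfer_frame x h : U x -> exists c : 'rV[R]_N,
  'd phi x h = vec_mx (c *m frame_act (phi x)) /\
  'd q x h = vec_mx (c *m frame_act (q x)).
Proof.
move=> Ux; have [g xg] := orbit_phi Ux.
have [z zE] := parametrization_tangent rho_rep G_compact uc lp Ux xg h.
have [_ dq] := transfer_diff Ux xg.
have [c cE] := adjoint_frame g z.
exists c; split; first by rewrite xg cE.
by rewrite (dq _ _ zE) /q xg transferE cE.
Qed.

Lemma same_kernel x : U x -> forall c : 'rV[R]_N,
  c *m frame_act (phi x) = 0 <-> c *m frame_act (q x) = 0.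
Proof.
move=> Ux c; have [g xg] := orbit_phi Ux; rewrite /q xg transferE.
have conj (u u' : 'cV[R]_n) : (forall h, rho h *m u = u -> rho h *m u' = u') ->
    forall h, rho h *m (rho g *m u) = rho g *m u -> rho h *m (rho g *m u') = rho g *m u'.
  move=> uu h; rewrite !mulmxA -!(rep_mul rho_rep); exact: same_action.
by split; apply: (frame_act_ker rho_rep uc ZL); apply: conj.
Qed.

Hypothesis m_rank : m = \rank (inf_act v).

(* Bootstrapping: the derivatives of [q] are smooth functions of [phi], of its
   derivatives and of [q] itself, so [q] is C^(k+1) once it is C^k. *)
Lemma transfer_smooth : smooth U q.
Proof.
have oU := lp_open lp.
have dq x : U x -> differentiable q x.
  by move=> Ux; have [g xg] := orbit_phi Ux; have [] := transfer_diff Ux xg.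
elim=> [|k IH] /=; first by move=> x Ux; exact/differentiable_continuous/dq.
split=> // xi; apply: Ck_pointwise => x0 Ux0.
pose F x := frame_act (phi x).
have Fr x : U x -> \rank (F x) = m.
  by move=> Ux; have [g xg] := orbit_phi Ux; rewrite /F xg rank_frame_act.
(* [S] fixes m combinations of the frame that are independent at [x0]; they remain so on the open
   set [U'], where the Gram determinant is nonzero. *)
have [S fS] := row_free_submx (Fr _ Ux0).
pose Gm x := (S *m F x) *m (S *m F x)^T.
have CF l : Ck l U F by apply: Ck_lin_mulmxr => //; exact: (lp_smooth lp).
have CSF l : Ck l U (fun x => S *m F x) by apply: Ck_mulmx => //; exact: Ck_cst.
have CG l : Ck l U Gm by apply: Ck_mulmx => //; exact: Ck_trmx.
pose U' := U `&` [set x | \det (Gm x) != 0].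
have oU' : open U' by apply: open_neq0 => //; apply: Ck_det => //.
have U'U : U' `<=` U by move=> x [].
(* Cramer's rule: the derivative of phi is expanded in the rows of [S *m F x], and the same
   coefficients are applied to the frame at [q x]. Equality of the left kernels of the two frames
   makes the choice of coefficients immaterial. *)
pose rhs x : 'cV[R]_n := vec_mx ((\det (Gm x))^-1 *:
  (mxvec ('D_xi phi x) *m (S *m F x)^T *m \adj (Gm x) *m S *m frame_act (q x))).
apply: (@Ck_sub _ _ _ _ U').
  move=> _ ->; split => //=.
  by rewrite -unitfE -unitmxE gram_unitmx.
apply: (@Ck_ext _ _ _ _ _ rhs) => //.
  move=> x [Ux /= dx].
  have [c [c1 c2]] := transfer_frame xi Ux.
  transitivity (vec_mx (c *m frame_act (q x)) : 'cV[R]_n); last first.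
    by rewrite deriveE; [exact: esym|exact: dq].
  have cE : mxvec ('D_xi phi x) = c *m F x.
    by rewrite deriveE; [rewrite c1 vec_mxK|exact: dphi].
  rewrite /rhs cE.
  have fSx : row_free (S *m F x) by rewrite -gram_unitmx unitmxE unitfE.
  have FS : (F x <= S *m F x)%MS.
    have := mxrank_leqif_sup (submxMl S (F x)); rewrite (eqP fSx) (Fr _ Ux).
    by case=> _ <-.
  have /submxP[y yE] : (c *m F x <= S *m F x)%MS by rewrite mulmx_sub.
  rewrite yE -(mulmxA y) -/(Gm x) -[y *m Gm x *m _]mulmxA mul_mx_adj.
  rewrite mul_mx_scalar -!scalemxAl scalerA mulVf// scale1r.
  congr (vec_mx _); apply/eqP; rewrite eq_sym -subr_eq0 -mulmxBl; apply/eqP.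
  apply: (proj1 (same_kernel Ux _)).
  by rewrite mulmxBl -/(F x) yE -mulmxA subrr.
apply: Ck_vec_mx => //; apply: Ck_scalemx => //.
  apply: CkV => //; first by move=> x [].
  by apply: Ck_det => //; apply: Ck_sub U'U _ => //.
apply: Ck_mulmx => //; last by apply: Ck_lin_mulmxr => //; exact: Ck_sub IH.
apply: Ck_mulmx => //; last exact: Ck_cst.
apply: Ck_mulmx => //; last by apply: Ck_adjmx => //; exact: Ck_sub (CG k).
apply: Ck_mulmx => //; last by apply: Ck_trmx => //; exact: Ck_sub (CSF k).
apply: Ck_mxvec => //; apply: (Ck_sub U'U).
by have [_] := lp_smooth lp k.+1; exact.
Qed.

Lemma transfer_parametrization : local_parametrization (orbit w) U q.
Proof.
have oU := lp_open lp.
split=> //.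
- exact: transfer_smooth.
- move=> x Ux; suff h0 h : 'd q x h = 0 -> h = 0.
    move=> h1 h2 /eqP; rewrite -subr_eq0 -linearB => /eqP/h0/eqP.
    by rewrite subr_eq0 => /eqP.
  have [c [c1 c2]] := transfer_frame h Ux; rewrite c2 => cq.
  apply: (lp_immersion lp Ux); rewrite linear0 c1.
  have c0 : c *m frame_act (q x) = 0 by rewrite -[LHS]vec_mxK cq linear0.
  by rewrite (proj2 (same_kernel Ux c) c0) linear0.
- move=> x y Ux Uy; have [g xg] := orbit_phi Ux; have [h yh] := orbit_phi Uy.
  rewrite /q xg yh !transferE => /(same_action wv) E.
  by apply: (lp_injective lp) => //; rewrite xg yh.
move=> O oO OU; apply: relatively_open => y Oy.
  by have [g yg] := orbit_phi (OU _ Oy); rewrite /q yg transferE; exists g.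
(* The inverse map is continuous: a point of the orbit of w near [q y] is g e(z) w with z small, and
   g e(z) v is then near [phi y]. *)
have [g yg] := orbit_phi (OU _ Oy).
have [W oW WE] := lp_relopen lp oO OU.
have [_ Wy] : (orbit v `&` W) (phi y) by rewrite -WE; exists y.
have /nbhs_ballP[r /= rpos hr] : nbhs (phi y) W by exact: open_nbhs_nbhs.
pose c : R := n%:R + 1.
have c0 : 0 < c by rewrite ltr_wpDl.
have [r1 r10 h1] : exists2 r1, 0 < r1 & forall z, `|z| < r1 -> `|rho (e z) *m v - v| < r / c.
  have := @act_e_continuous _ _ _ _ _ _ _ _ uc _ v 0.
  rewrite normr0 => /(_ (uc_gt0 uc)) /cvgrPdist_lt /(_ _ (divr_gt0 rpos c0)).
  move=> /nbhs_ballP[r1 /= r1pos h]; exists r1 => // x xr.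
  have := h x; rewrite -ball_normE /= sub0r normrN => /(_ xr).
  by rewrite distrC (uc_0 uc) (rho1 rho_rep) mul1mx.
have [del del0 lift] := local_lift_small rho_rep G_compact uc w r10.
exists (del / c) => [|_ [g' _ <-]]; first by rewrite divr_gt0.
rewrite {1}/q yg transferE => H.
have [|z zr gz] := lift (g^-1 * g')%g.
  have -> : rho (g^-1 * g')%g *m w - w = rho g^-1%g *m (rho g' *m w - rho g *m w).
    by rewrite mulmxBr (rhoK rho_rep) (rep_mul rho_rep) mulmxA.
  rewrite (le_lt_trans (rho_norm rho_rep _ _))//.
  rewrite (@le_lt_trans _ _ (c * `|rho g' *m w - rho g *m w|))//.
    by rewrite ler_wpM2r// /c lerDl.
  by rewrite mulrC -ltr_pdivlMr.
have g'E : rho g' *m w = rho (g * e z)%g *m w.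
  by rewrite (rep_mul rho_rep) -mulmxA -gz (rep_mul rho_rep) -mulmxA (rhoVK rho_rep).
have [y' Oy' y'E] : (phi @` O) (rho (g * e z)%g *m v).
  rewrite WE; split; first by exists (g * e z)%g.
  apply: hr; rewrite -ball_normE /= distrC yg (rep_mul rho_rep) -mulmxA -mulmxBr.
  rewrite (le_lt_trans (rho_norm rho_rep _ _))//.
  rewrite (@le_lt_trans _ _ (c * `|rho (e z) *m v - v|))//.
    by rewrite ler_wpM2r// /c lerDl.
  by rewrite mulrC -ltr_pdivlMr// h1.
by exists y' => //; rewrite /q y'E transferE g'E.
Qed.

(** The differentials of phi and q have the same coordinates in the frames at phi x and q x, so
    [gram_ratio] applies; invariance of [sqminors] replaces these points by v and w. *)
Lemma transfer_gram x : U x ->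
  \det (first_fundamental_form q x) * sqminors m (frame_act v) =
  \det (first_fundamental_form phi x) * sqminors m (frame_act w).
Proof.
move=> Ux; have [g xg] := orbit_phi Ux.
have dq : differentiable q x by have [] := transfer_diff Ux xg.
have /choice[c cE] : forall i : 'I_m, exists c : 'rV[R]_N,
    'd phi x (delta_mx 0 i) = vec_mx (c *m frame_act (phi x)) /\
    'd q x (delta_mx 0 i) = vec_mx (c *m frame_act (q x)).
  by move=> i; exact: transfer_frame.
pose b := \matrix_i c i.
have FE f : (forall i, 'd f x (delta_mx 0 i) = vec_mx (c i *m frame_act (f x))) ->
    differentiable f x ->
    first_fundamental_form f x = (b *m frame_act (f x)) *m (b *m frame_act (f x))^T.
  move=> h df; apply/matrixP => i j; rewrite [LHS]mxE !deriveE// !h dot_vec_mx.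
  have bE i' l : (c i' *m frame_act (f x)) 0 l = (b *m frame_act (f x)) i' l.
    by rewrite -(rowK c i') -row_mul [LHS]mxE.
  rewrite [LHS]mxE [RHS]mxE; apply: eq_bigr => l _.
  by rewrite ![(_^T) _ _]mxE !bE.
rewrite (FE q) //; last by move=> i; have [] := cE i.
rewrite (FE phi) //; [|by move=> i; have [] := cE i|exact: dphi].
rewrite -(sqminors_frame_mul rho_rep G_compact uc ZZ ZL g v).
rewrite -(sqminors_frame_mul rho_rep G_compact uc ZZ ZL g w).
have qE : q x = rho g *m w by rewrite /q xg transferE.
rewrite -qE -xg; apply: gram_ratio.
  by rewrite xg rank_frame_act m_rank.
by move=> k; move/(same_kernel Ux).
Qed.

End Transfer.

(** * Volumes of orbits *)

Section RowMeasurable.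
Variable R : realType.
Local Notation mR := (measurableTypeR R).

Lemma measurable_box m (a b : 'I_m -> R) :
  measurable [set t : m.-tuple mR | forall i, a i < tnth t i < b i].
Proof.
rewrite (_ : [set _ | _] =
  \bigcap_(i in [set: 'I_m]) ((fun t : m.-tuple mR => tnth t i) @^-1` `]a i, b i[%classic)).
  apply: fin_bigcap_measurable => // i _.
  rewrite -[X in measurable X]setTI.
  by apply: measurable_tnth => //; exact: measurable_itv.
apply/seteqP; split => t h i.
  by move=> _; rewrite /= in_itv/=; exact: h.
by have := h i I; rewrite /= in_itv.
Qed.

(** Rational boxes link the norm topology of rows with the measurable structure of tuples: [F] lists
    the boxes contained in [O], replacing the others by the empty set. *)
Lemma measurable_row_open m (O : set 'rV[R]_m) : open O ->
  measurable (@row_of_tuple R m @^-1` O).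
Proof.
move=> oO.
pose F (p : {ffun 'I_m -> rat} * rat) : set (m.-tuple mR) :=
  if `[< forall x : 'rV[R]_m, (forall i, ratr (p.1 i) - ratr p.2 < x 0 i < ratr (p.1 i) + ratr p.2) -> O x >]
  then [set t | forall i, ratr (p.1 i) - ratr p.2 < tnth t i < ratr (p.1 i) + ratr p.2]
  else set0.
have -> : @row_of_tuple R m @^-1` O = \bigcup_p F p.
  apply/seteqP; split => t; last first.
    case=> p _; rewrite /F; case: asboolP => // h ht.
    by apply: h => i; rewrite mxE; exact: ht.
  rewrite /preimage/= => Ot.
  have /nbhs_ballP[r /= r0 hr] : nbhs (row_of_tuple t) O by exact: open_nbhs_nbhs.
  have r2 : 0 < r / 2 by rewrite divr_gt0.
  have [s] := rat_in_itvoo r2; rewrite in_itv/= => /andP[s0 sr].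
  have /choice[c hc] : forall i : 'I_m, exists c : rat, `|tnth t i - ratr c| < ratr s.
    move=> i; have : tnth t i - ratr s < tnth t i + ratr s.
      by rewrite ltrBlDr -addrA ltrDl addr_gt0.
    move=> /rat_in_itvoo[c]; rewrite in_itv/= => /andP[c1 c2].
    exists c; rewrite ltr_norml; apply/andP; split.
      by rewrite ltrNl opprB ltrBlDl.
    by rewrite ltrBlDl -ltrBlDr.
  exists ([ffun i => c i], s) => //; rewrite /F; case: asboolP => [_ i|]; last first.
    case=> x xb; apply: hr; rewrite -ball_normE /=.
    apply: (@le_lt_trans _ _ (2 * ratr s)); last by rewrite mulrC -ltr_pdivlMr.
    apply: mx_norm_le => [|k i]; first by rewrite mulr_ge0// ltW.
    rewrite (ord1 k) !mxE -[X in `|X|](subrKA (ratr (c i))).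
    rewrite (le_trans (ler_normD _ _))// mulr_natl mulr2n lerD//; first exact/ltW/hc.
    have := xb i; rewrite /= ffunE => /andP[h1 h2].
    by rewrite ler_norml; move: h1 h2; lra.
  by have := hc i; rewrite /= ffunE ltr_norml; lra.
apply: countable_bigcupT_measurable => //.
move=> p; rewrite /F; case: asboolP => // _; exact: measurable_box.
Qed.

Lemma measurable_row_continuous m (U : set 'rV[R]_m) (f : 'rV[R]_m -> R)
    (A : set (m.-tuple mR)) : open U -> Ck 0 U f -> measurable A ->
  @row_of_tuple R m @` A `<=` U ->
  measurable_fun A (f \o @row_of_tuple R m).
Proof.
move=> oU cf mA AU; apply: (measurability _ (measurable_realfun.RGenOpens.measurableE R)).
move=> _ [_ [a [b ->] <-]].
pose O := U `&` f @^-1` `]a, b[%classic.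
have oO : open O.
  rewrite openE => x [Ux fx]; rewrite /interior; apply: filterI.
    exact: open_nbhs_nbhs.
  by apply: (cf x Ux); apply: open_nbhs_nbhs; split => //; exact: interval_open.
rewrite (_ : _ `&` _ = A `&` @row_of_tuple R m @^-1` O).
  by apply: measurableI => //; exact: measurable_row_open.
apply/seteqP; split => t [At ft]; split => //.
  by split => //; apply: AU; exists t.
by case: ft.
Qed.

Lemma lebesgue_tuple_box m (r : R) :
  (lebesgue_tuple R m [set t | forall i, (- r < tnth t i < r)%R] < +oo)%E.
Proof.
elim: m => [|m IH].
  by rewrite /= diracE; case: (_ \in _) => //=; rewrite ltry.
rewrite /= /pushforward.
have -> : (@tcons R m) @^-1` [set t | forall i, (- r < tnth t i < r)%R] =
   [set t | forall i, (- r < tnth t i < r)%R] `*` `]- r, r[%classic.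
  apply/seteqP; split => -[t x] /=; rewrite /setX/= in_itv /=.
    move=> h; split => [i|].
      by have := h (lift ord0 i); rewrite tnthS.
    by have := h ord0; rewrite tnth0.
  move=> [h hx] i; case: (unliftP ord0 i) => [j|] ->; first by rewrite tnthS.
  by rewrite tnth0.
rewrite product_measure1E//; first last.
- exact: measurable_box.
rewrite lte_mul_pinfty//.
  by rewrite ge0_fin_numE.
suff : (@lebesgue_measure R `](- r)%R, r[%classic < +oo)%E by [].
rewrite lebesgue_measure_itv/=; case: ifP => _ //.
by rewrite -EFinB ltry.
Qed.

End RowMeasurable.

Section Density.
Variable R : realType.

(** The condition under the infimum of [riemannian_volume], named so that a single decomposition can
    be transported. *)
Definition volume_sum m n (M : set 'cV[R]_n) (s : \bar R) : Prop :=
  exists (k : nat) (U : 'I_k -> set 'rV[R]_m)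
      (phi : 'I_k -> 'rV[R]_m -> 'cV[R]_n)
      (A : 'I_k -> set (m.-tuple (measurableTypeR R))),
    let piece i := (phi i \o @row_of_tuple R m) @` A i in
    [/\ forall i, local_parametrization M (U i) (phi i),
        forall i, measurable (A i) /\ (@row_of_tuple R m) @` A i `<=` U i,
        trivIset setT piece,
        \bigcup_i piece i = M &
        s = (\sum_(i < k) \int[lebesgue_tuple R m]_(t in A i)
               (Num.sqrt (\det (first_fundamental_form (phi i)
                                  (row_of_tuple t))))%:E)%E].

Lemma density_continuous m n (M : set 'cV[R]_n) U (phi : 'rV[R]_m -> 'cV[R]_n) :
  local_parametrization M U phi ->
  Ck 0 U (fun x => Num.sqrt (\det (first_fundamental_form phi x))).
Proof.
move=> lp; have oU := lp_open lp.
have dC l h : Ck l U (fun x => 'D_h phi x) by have [_] := lp_smooth lp l.+1; exact.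
have dc : Ck 0 U (fun x => \det (first_fundamental_form phi x)).
  apply: Ck_det => //; apply/Ck_mxP => // i j.
  under eq_fun do rewrite mxE.
  have := Ck_mulmx oU (Ck_trmx oU (dC 0%N (delta_mx 0 i))) (dC 0%N (delta_mx 0 j)).
  by move=> /(Ck_mxP _ _ oU); exact.
by move=> x Ux; apply: continuous_comp; [exact: dc|exact: sqrt_continuous].
Qed.

Lemma density_measurable m n (M : set 'cV[R]_n) U (phi : 'rV[R]_m -> 'cV[R]_n) A :
  local_parametrization M U phi -> measurable A -> @row_of_tuple R m @` A `<=` U ->
  measurable_fun A ((fun x => Num.sqrt (\det (first_fundamental_form phi x)))
    \o @row_of_tuple R m).
Proof.
move=> lp mA AU.
exact: (measurable_row_continuous (lp_open lp) (density_continuous lp)).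
Qed.

Lemma density_bounded m n (M : set 'cV[R]_n) U (phi : 'rV[R]_m -> 'cV[R]_n) (r : R) :
  local_parametrization M U phi -> [set x | `|x| <= r] `<=` U -> 0 <= r ->
  exists2 C, 0 <= C & forall x, `|x| <= r ->
    Num.sqrt (\det (first_fundamental_form phi x)) <= C.
Proof.
move=> lp rU r_ge0.
have [||| c _ cP] := @compact_EVT_max _ _
    (fun x => Num.sqrt (\det (first_fundamental_form phi x))) [set x : 'rV[R]_m | `|x| <= r].
- by exists 0; rewrite /= normr0.
- have := @closed_ball_compact R m 0 r.
  by congr (compact _); apply/seteqP; split => x /=; rewrite ?sub0r ?subr0 ?normrN.
- apply: continuous_in_subspaceT => x; rewrite inE => xr.
  exact: (density_continuous lp (rU _ xr)).
exists (Num.sqrt (\det (first_fundamental_form phi c))); first exact: sqrtr_ge0.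
by move=> x xr; apply: cP; rewrite inE.
Qed.

End Density.

Section Scaling.
Variables (R : realType) (G : lieGroupType R) (n : nat) (rho : G -> 'M[R]_n).
Hypothesis rho_rep : orthogonal_representation rho.
Hypothesis G_compact : compact [set: G].
Variables (d : nat) (e : 'rV[R]_d -> G) (L : 'M[R]_(d, n * n)) (r0 : R).
Hypothesis uc : unit_coordinates rho e L r0.
Variables (N : nat) (Z : 'M[R]_(N, n * n)).
Hypotheses (ZZ : Z *m Z^T = 1%:M) (ZL : (Z :=: L)%MS).
Local Notation orbit := (Defs.orbit rho).

Lemma sqminors_frame_gt0 v : 0 < sqminors (\rank (inf_act L v)) (frame_act Z v).
Proof.
have := sqminors_gt0 (frame_act Z v).
by rewrite (frame_actE ZL).
Qed.

(** The parameter sets [A] stay the same and each phi is composed with [transfer]; by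
    [transfer_gram] the densities change by a constant factor. *)
Lemma volume_sum_transfer v w m s :
  (forall g, rho g *m v = v -> rho g *m w = w) ->
  (forall g, rho g *m w = w -> rho g *m v = v) ->
  m = \rank (inf_act L v) ->
  volume_sum m (orbit v) s ->
  volume_sum m (orbit w)
    ((Num.sqrt (sqminors m (frame_act Z w) / sqminors m (frame_act Z v)))%:E * s)%E.
Proof.
move=> vw wv mE [k [U [phi [A [lps mA tr cov ->]]]]].
have v0 : 0 < sqminors m (frame_act Z v) by rewrite mE sqminors_frame_gt0.
have piece_orbit i t : A i t -> exists g, phi i (row_of_tuple t) = rho g *m v.
  move=> At; have : orbit v (phi i (row_of_tuple t)).
    by rewrite -cov; exists i => //; exists t.
  by case=> g _ <-; exists g.
exists k, U, (fun i => transfer rho v w \o phi i), A; split => //.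
- by move=> i; exact: (transfer_parametrization rho_rep G_compact uc ZL vw wv (lps i)).
- move=> i j _ _ [_ [[t At <-] [t' At' /= E]]]; apply: tr => //.
  exists (phi i (row_of_tuple t)); split; first by exists t.
  exists t' => //=; move: E.
  have [g gE] := piece_orbit _ _ At; have [h hE] := piece_orbit _ _ At'.
  rewrite gE hE !(transferE rho_rep vw) => E.
  exact: (same_action rho_rep wv).
- apply/seteqP; split => [_ [i _ [t At <-]]|_ [g _ <-]] /=.
    by have [g ->] := piece_orbit _ _ At; rewrite (transferE rho_rep vw); exists g.
  have : orbit v (rho g *m v) by exists g.
  rewrite -cov => -[i _ [t At /= tE]]; exists i => //; exists t => //=.
  by rewrite tE (transferE rho_rep vw).
rewrite ge0_sume_distrr; last by move=> i _; apply: integral_ge0 => t _; rewrite lee_fin sqrtr_ge0.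
apply: eq_bigr => i _; have [mAi AiU] := mA i.
rewrite -ge0_integralZl_EFin//; last first.
  by apply/measurable_realfun.measurable_EFinP; exact: (density_measurable (lps i)).
apply: eq_integral => t; rewrite inE => At; rewrite -EFinM; congr (_%:E).
rewrite -sqrtrM; last by rewrite divr_ge0 ?sqminors_ge0.
congr Num.sqrt.
have Ut : U i (row_of_tuple t) by apply: AiU; exists t.
have := transfer_gram rho_rep G_compact uc ZZ ZL vw wv (lps i) mE Ut => E.
by rewrite mulrAC [X in X / _]mulrC -E mulfK ?gt_eqF.
Qed.

Lemma volume_transfer_le v w m :
  (forall g, rho g *m v = v -> rho g *m w = w) ->
  (forall g, rho g *m w = w -> rho g *m v = v) ->
  m = \rank (inf_act L v) -> 0 < sqminors m (frame_act Z w) ->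
  (riemannian_volume m (orbit w) <=
   (Num.sqrt (sqminors m (frame_act Z w) / sqminors m (frame_act Z v)))%:E *
     riemannian_volume m (orbit v))%E.
Proof.
move=> vw wv mE w0.
have v0 : 0 < sqminors m (frame_act Z v) by rewrite mE sqminors_frame_gt0.
have k0 : 0 < Num.sqrt (sqminors m (frame_act Z w) / sqminors m (frame_act Z v)).
  by rewrite sqrtr_gt0 divr_gt0.
rewrite -lee_pdivrMl//; apply: le_ereal_inf_tmp => s hs.
rewrite lee_pdivrMl//; apply: ereal_inf_lbound.
exact: (volume_sum_transfer vw wv mE hs).
Qed.

Lemma rank_inf_act_le k l (v : 'M[R]_(n, k)) (w : 'M[R]_(n, l)) :
  (forall g, rho g *m v = v -> rho g *m w = w) ->
  (\rank (inf_act L w) <= \rank (inf_act L v))%N.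
Proof.
move=> vw.
have : (kermx (inf_act L v) <= kermx (inf_act L w))%MS.
  apply/sub_kermxP/row_matrixP => i; rewrite row0 row_mul.
  by apply: (inf_act_kernel rho_rep uc vw); rewrite -row_mul mulmx_ker row0.
move=> /mxrankS; rewrite !mxrank_ker leq_sub2lE//; exact: rank_leq_row.
Qed.

(** The inequality holds in both directions, and exchanging v and w inverts the factor. *)
Lemma volume_transfer v w m :
  (forall g, rho g *m v = v -> rho g *m w = w) ->
  (forall g, rho g *m w = w -> rho g *m v = v) ->
  m = \rank (inf_act L v) ->
  riemannian_volume m (orbit w) =
   ((Num.sqrt (sqminors m (frame_act Z w) / sqminors m (frame_act Z v)))%:E *
     riemannian_volume m (orbit v))%E.
Proof.
move=> vw wv mE.
have mw : m = \rank (inf_act L w).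
  by apply/eqP; rewrite mE eqn_leq !rank_inf_act_le.
have v0 : 0 < sqminors m (frame_act Z v) by rewrite mE sqminors_frame_gt0.
have w0 : 0 < sqminors m (frame_act Z w) by rewrite mw sqminors_frame_gt0.
apply/eqP; rewrite eq_le volume_transfer_le//=.
have k0 : 0 < Num.sqrt (sqminors m (frame_act Z v) / sqminors m (frame_act Z w)).
  by rewrite sqrtr_gt0 divr_gt0.
rewrite -(invf_div (sqminors m (frame_act Z v))) sqrtrV ?divr_ge0 ?sqminors_ge0//.
by rewrite lee_pdivrMl// volume_transfer_le.
Qed.

(** By compactness, finitely many translates of one small patch around v cover the orbit, and on
    each the density is bounded over a bounded domain. *)
Lemma volume_finite v : exists2 a, 0 <= a &
  riemannian_volume (\rank (inf_act L v)) (orbit v) = a%:E.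
Proof.
set m := \rank _.
suff [s hs soo] : exists2 s, volume_sum m (orbit v) s & (s < +oo)%E.
  have v0 : (0 <= riemannian_volume m (orbit v))%E.
    apply: le_ereal_inf_tmp => _ [k [U [phi [A [_ _ _ _ ->]]]]].
    apply: sume_ge0 => i _; apply: integral_ge0 => t _.
    by rewrite lee_fin sqrtr_ge0.
  have voo : (riemannian_volume m (orbit v) < +oo)%E.
    by apply: le_lt_trans soo; exact: ereal_inf_lbound.
  have vfin : riemannian_volume m (orbit v) \is a fin_num by rewrite ge0_fin_numE.
  by exists (fine (riemannian_volume m (orbit v))); rewrite ?fine_ge0 ?fineK.
have [U [phi [lp U0 p0]]] := orbit_parametrization rho_rep G_compact uc v.
have oU := lp_open lp.
have [r r0' rU] : exists2 r, 0 < r & [set x | `|x| <= r] `<=` U.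
  have /nbhs_ballP[r /= r0' hr] : nbhs (0 : 'rV[R]_m) U by exact: open_nbhs_nbhs.
  exists (r / 2) => [|x /= xr]; first by rewrite divr_gt0.
  by apply: hr; rewrite -ball_normE /= sub0r normrN (le_lt_trans xr)// gtr_pMr ?invf_lt1 ?ltr1n.
pose O := [set x : 'rV[R]_m | `|x| < r].
have oO : open O by exact: open_ball0.
have OU : O `<=` U by move=> x /= /ltW; exact: rU.
have [W oW WE] := lp_relopen lp oO OU.
have Wv : W v.
  suff [] : (orbit v `&` W) v by [].
  by rewrite -WE; exists 0; rewrite // /O/= normr0.
have cov_orbit : compact (orbit v).
  apply: (continuous_compact _ G_compact); apply: continuous_subspaceT.
  exact: (act_continuous rho_rep uc).
move: cov_orbit; rewrite compact_cover => /(_ G setT (fun g => mulmx (rho g^-1%g) @^-1` W)).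
case=> [g _|_ [g _ <-]|D _ Dcov].
- by apply: open_comp => // p _; exact: mulmx_continuous.
- by exists g => //; rewrite /preimage/= (rhoK rho_rep).
pose sD := finmap.enum_fset D; pose k := size sD.
pose g (i : 'I_k) : G := nth 1%g sD i.
have cov p : orbit v p -> exists i, W (rho (g i)^-1%g *m p).
  move=> op; have [g' /= g'D Wh] := Dcov p op.
  have ig : (index g' sD < k)%N by rewrite index_mem.
  by exists (Ordinal ig); rewrite /g /= nth_index.
pose B (i j : 'I_k) := O `&` [set x | W (rho (g j)^-1%g *m (rho (g i) *m phi x))].
have oB i j : open (B i j).
  rewrite openE => x [Ox Wx]; rewrite /interior; apply: filterI; first exact: open_nbhs_nbhs.
  have cphi : {for x, continuous phi} by apply: (lp_smooth lp 0%N); exact: OU.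
  have := continuous_comp cphi (@mulmx_continuous _ _ _ 1 (rho (g i)) (phi x)).
  move=> /continuous_comp/(_ (@mulmx_continuous _ _ _ 1 (rho (g j)^-1%g) _)).
  by apply; exact: open_nbhs_nbhs.
(* [B i j] holds the parameters of patch [i] whose image also lies in patch [j]; removing those with
   j < i makes the pieces disjoint. *)
pose A (i : 'I_k) := @row_of_tuple R m @^-1` O `\`
   \bigcup_(j in [set j : 'I_k | (j < i)%N]) (@row_of_tuple R m @^-1` (B i j)).
have mA i : measurable (A i).
  apply: measurableD; first exact: measurable_row_open.
  by apply: fin_bigcup_measurable => // j _; exact: measurable_row_open.
have AO i : @row_of_tuple R m @` A i `<=` O by move=> _ [t [Ot _] <-].
have W_phi x : O x -> W (phi x).
  move=> Ox; suff [] : (orbit v `&` W) (phi x) by [].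
  by rewrite -WE; exists x.
have orb_phi i x : O x -> orbit v (rho (g i) *m phi x).
  move=> Ox; suff [[h _ <-] _] : (orbit v `&` W) (phi x).
    by exists (g i * h)%g => //; rewrite (rep_mul rho_rep) mulmxA.
  by rewrite -WE; exists x.
have lpi i := translate_parametrization rho_rep (g i) lp.
exists (\sum_(i < k) \int[lebesgue_tuple R m]_(t in A i)
  (Num.sqrt (\det (first_fundamental_form (fun x => rho (g i) *m phi x)
     (row_of_tuple t))))%:E)%E.
  exists k, (fun=> U), (fun i x => rho (g i) *m phi x), A; split => //.
  - by move=> i; split => // x /AO /OU.
  - move=> i j _ _ [_ [[t [Ot Ht] <-] [t' [Ot' Ht'] /= E]]]; apply/val_inj/eqP.
    rewrite eq_le !leNgt; apply/andP; split; apply/negP => ij.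
      apply: Ht; exists j => //; split => //=.
      by rewrite -E (rhoK rho_rep); exact: W_phi.
    apply: Ht'; exists i => //; split => //=.
    by rewrite E (rhoK rho_rep); exact: W_phi.
  - apply/seteqP; split => [_ [i _ [t [Ot _] <-]]|p op] /=; first exact: orb_phi.
    have [i0 Wi0] := cov _ op.
    have [i /asboolP Wi imin] := @arg_minnP _ i0
      (fun i => `[< W (rho (g i)^-1%g *m p) >]) val (asboolT Wi0).
    have [x Ox xE] : (phi @` O) (rho (g i)^-1%g *m p).
      rewrite WE; split => //; case: op => h _ <-.
      by exists ((g i)^-1 * h)%g => //; rewrite (rep_mul rho_rep) mulmxA.
    pose t : m.-tuple (measurableTypeR R) := [tuple x 0 i | i < m].
    have tx : row_of_tuple t = x by apply/rowP => l; rewrite mxE tnth_mktuple.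
    exists i => //; exists t; last by rewrite /= tx xE (rhoVK rho_rep).
    split; first by rewrite /preimage/= tx.
    case=> j /= ji [_ /=]; rewrite tx xE (rhoVK rho_rep) => Wj.
    by have := imin j (asboolT Wj); rewrite leqNgt ji.
apply: lte_sum_pinfty => i _.
have [C C0 HC] := density_bounded (lpi i) rU (ltW r0').
apply: (@le_lt_trans _ _ (\int[lebesgue_tuple R m]_(t in A i) (cst C%:E) t)%E).
  apply: ge0_le_integral => //.
  - by apply/measurable_realfun.measurable_EFinP; apply: (density_measurable (lpi i)) => // x /AO /OU.
  - by move=> t At; rewrite lee_fin; apply: HC; apply: ltW; apply: (AO i); exists t.
rewrite integral_cst// lte_mul_pinfty//.
apply: le_lt_trans (lebesgue_tuple_box m r); apply: le_measure; rewrite ?inE//.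
  exact: measurable_box.
move=> t [/= Ot _] l.
have := le_lt_trans (mx_entry_norm (row_of_tuple t) 0 l) Ot.
by rewrite mxE ltr_norml.
Qed.

Lemma orbit_volume_transfer v w :
  (forall g, rho g *m v = v -> rho g *m w = w) ->
  (forall g, rho g *m w = w -> rho g *m v = v) ->
  let m := \rank (inf_act L v) in
  (orbit_volume rho w ^+ 2 =
  orbit_volume rho v ^+ 2 * (sqminors m (frame_act Z w) / sqminors m (frame_act Z v))%:E)%E.
Proof.
move=> vw wv m; rewrite /orbit_volume !(dimension_orbit rho_rep G_compact uc).
have -> : \rank (inf_act L w) = m.
  by apply/eqP; rewrite eqn_leq !rank_inf_act_le.
rewrite (volume_transfer vw wv erefl) -/m.
have [a _ ->] := volume_finite v.
rewrite -EFinM -!EFin_expe -EFinM exprMn sqr_sqrtr; first by rewrite mulrC.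
by rewrite divr_ge0 ?sqminors_ge0.
Qed.

End Scaling.

(** * Isotropy groups and principal orbits *)

Lemma finite_subset_eq (T : choiceType) (A B : set T) :
  finite_set B -> A `<=` B -> (B #<= A)%card -> A = B.
Proof.
move=> fB AB BA; have fA := sub_finite_set AB fB.
have /finite_setP[b Bb] := fB; have /finite_setP[a Aa] := fA.
have ba : (b <= a)%N by rewrite -card_le_II -(card_le_eql Bb) -(card_le_eqr Aa).
suff E : fset_set A = fset_set B by rewrite -(fset_setK fA) E fset_setK.
apply/eqP; rewrite finmap.eqEfcard (card_fset_set Aa) (card_fset_set Bb) ba andbT.
by rewrite -fset_set_sub.
Qed.

Section Isotropy.
Variables (R : realType) (G : lieGroupType R) (n : nat) (rho : G -> 'M[R]_n).
Hypothesis rho_rep : orthogonal_representation rho.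
Hypothesis G_compact : compact [set: G].
Variables (d : nat) (e : 'rV[R]_d -> G) (L : 'M[R]_(d, n * n)) (r0 : R).
Hypothesis uc : unit_coordinates rho e L r0.
Local Notation isotropy := (isotropy rho).

Lemma isotropyM v g h : isotropy v g -> isotropy v h -> isotropy v (g * h)%g.
Proof. by rewrite /Defs.isotropy/= (rep_mul rho_rep) -mulmxA => + ->. Qed.

Lemma isotropyV v g : isotropy v g -> isotropy v g^-1%g.
Proof. by rewrite /Defs.isotropy/= => {1}<-; rewrite (rhoK rho_rep). Qed.

Lemma isotropy1 v : isotropy v 1%g.
Proof. by rewrite /Defs.isotropy/= (rho1 rho_rep) mul1mx. Qed.

Lemma isotropy_closed v : closed (isotropy v).
Proof.
have -> : isotropy v = (fun g => rho g *m v) @^-1` [set v] by [].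
apply: closed_comp => [g _|]; first exact: (act_continuous rho_rep uc).
by apply: accessible_closed_set1; apply: hausdorff_accessible; exact: norm_hausdorff.
Qed.

Lemma isotropy_generated v : exists2 r, 0 < r & forall K : set G,
  (forall g h, K g -> K h -> K (g * h)%g) -> (forall g, K g -> K g^-1%g) ->
  (\forall g \near (1%g : G), isotropy v g -> K g) ->
  forall x, `|x| < r -> isotropy v (e x) -> K (e x).
Proof.
have [r /andP[rpos rr0] [C C0 step]] := fibre_step rho_rep uc v.
exists r => // K KM KV K1.
have [ep ep0 hep] : exists2 ep, 0 < ep & forall x, `|x| < ep -> isotropy v (e x) -> K (e x).
  have /(uc_continuous uc) ce : `|0 : 'rV[R]_d| < r0 by rewrite normr0 (uc_gt0 uc).
  have K0 : nbhs (e 0) [set g | isotropy v g -> K g] by rewrite (uc_0 uc).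
  have /nbhs_ballP[ep /= ep0 h] := ce _ K0.
  by exists ep => // x xe; apply: h; rewrite -ball_normE /= sub0r normrN.
(* [s] is small enough that y, of norm at most C s r, lies within [ep]. *)
pose s := Num.min 1 (ep / (2 * (C + 1) * r)).
have s0 : 0 < s by rewrite lt_min ltr01 divr_gt0// !mulr_gt0// ltr_wpDl.
have s1 : 0 <= s <= 1 by rewrite (ltW s0) ge_min lexx.
have Csr : C * (s * r) < ep.
  have : s <= ep / (2 * (C + 1) * r) by rewrite ge_min lexx orbT.
  rewrite ler_pdivlMr ?mulr_gt0// ?ltr_wpDl// => H.
  have : 0 < s * r by rewrite mulr_gt0.
  move: H; rewrite (_ : s * (2 * (C + 1) * r) = 2 * (C * (s * r)) + 2 * (s * r)); last by ring.
  have : 0 <= C * (s * r) by rewrite mulr_ge0// mulr_ge0// ltW.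
  lra.
(* While |x| is at least [ep], a step shortens x by at least 3/4 s |x|, which exceeds [del]. *)
pose del := s / 2 * ep.
have del0 : 0 < del by rewrite mulr_gt0// divr_gt0.
suff H k x : `|x| < r -> `|x| < ep + k%:R * del -> isotropy v (e x) -> K (e x).
  move=> x xr; apply: (H (Num.bound (r / del))) => //.
  rewrite (lt_trans xr)// ltr_wpDl ?(ltW ep0)// -ltr_pdivrMr//.
  by rewrite archi_boundP// divr_ge0// ltW.
elim: k x => [|k IH] x xr; first by rewrite mul0r addr0; exact: hep.
move=> xk Hx; have [xe|xe] := ltP `|x| ep; first exact: hep.
have [y [z [xyz yv yC zx]]] := step x s xr s1.
have zle : `|z| <= `|x| - del.
  rewrite (le_trans zx)// Hx subrr normr0 mulr0 add0r.
  have : s * ep <= s * `|x| by rewrite ler_wpM2l// ltW.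
  have : 0 < s * ep by rewrite mulr_gt0.
  rewrite /del; lra.
have Ky : K (e y).
  apply: hep => //; apply: le_lt_trans Csr; rewrite (le_trans yC)//.
  by rewrite !ler_wpM2l// ltW.
have Kz : K (e z).
  apply: IH; last by rewrite -xyz; exact: isotropyM.
    by rewrite (le_lt_trans zle)// (le_lt_trans _ xr)// gerBl ltW.
  rewrite (le_lt_trans zle)// ltrBlDr (lt_le_trans xk)//.
  by rewrite -addrA lerD2l -natr1 mulrDl mul1r.
have -> : e x = (e z * (e y)^-1)%g by rewrite -xyz -mulgA mulgV mulg1.
by apply: KM => //; exact: KV.
Qed.

Lemma nbhs_translate (g : G) (P : G -> Prop) : (\forall h \near (1%g : G), P h) ->
  \forall h \near g, P (g^-1 * h)%g.
Proof.
move=> H; have cg := @mulgl_continuous G g^-1%g g; apply: cg.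
by rewrite mulVg.
Qed.

Lemma nbhs_translateV (g : G) (P : G -> Prop) : (\forall h \near (1%g : G), P h) ->
  \forall h \near g, P (h^-1 * g)%g.
Proof.
move=> H; have := @invg_continuous G 1%g; rewrite /continuous_at invg1 => /(_ _ H).
by move=> /(nbhs_translate g); apply: filterS => h /=; rewrite invgM invgK.
Qed.

(* The intersection of the open subgroups of the isotropy group is itself an
   open subgroup, hence it has no proper open and closed subset. *)
Lemma isotropy_unit_component v : \forall h \near (1%g : G),
  isotropy v h -> connected_component (isotropy v) 1%g h.
Proof.
have [r rpos gen] := isotropy_generated v.
pose adm (K : set G) := [/\ forall g h, K g -> K h -> K (g * h)%g,
  forall g, K g -> K g^-1%g & \forall g \near (1%g : G), isotropy v g -> K g].
pose M := isotropy v `&` [set g | forall K, adm K -> K g].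
have MM g h : M g -> M h -> M (g * h)%g.
  move=> [g1 g2] [h1 h2]; split; first exact: isotropyM.
  by move=> K aK; have [KM _ _] := aK; apply: KM; [exact: g2|exact: h2].
have MV g : M g -> M g^-1%g.
  move=> [g1 g2]; split; first exact: isotropyV.
  by move=> K aK; have [_ KV _] := aK; apply: KV; exact: g2.
have M1 : \forall g \near (1%g : G), isotropy v g -> M g.
  have := uc_nbhs uc rpos; apply: filterS => g [x xr ->] Hx; split => // K [KM KV K1].
  exact: gen.
have M1' : M 1%g.
  by apply: (nbhs_singleton M1); exact: isotropy1.
have Mcl : closed M.
  move=> g gM.
  have Hg : isotropy v g.
    by apply: isotropy_closed => B /gM [h [[h1 _] h2]]; exists h.
  have [h [Mh hM]] := gM _ (nbhs_translateV g M1).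
  suff -> : g = (h * (h^-1 * g))%g.
    apply: MM => //; apply: hM; apply: isotropyM => //.
    by apply: isotropyV; case: Mh.
  by rewrite mulgA mulgV mul1g.
(* For [A] open and closed in M, compactness of A gives a neighbourhood of 1 in M whose elements and
   their inverses map A into itself on the right. The elements [K] with this property form an
   admissible subgroup, so K contains M, and A, being nonempty, is all of M. *)
have Mcon : connected M.
  move=> A [a Aa] [C1 oC1 AC1] [C2 cC2 AC2].
  have cA : compact A.
    apply: (subclosed_compact _ G_compact) => //.
    by rewrite AC2; exact: closedI.
  have N : \forall h \near (1%g : G), forall a, A a -> C1 (a * h)%g.
    have /compact_near_coveringP := cA; apply => a' Aa'.
    have C1a : C1 a' by move: Aa'; rewrite AC1 => -[].
    have := @mulg_continuous G (a', 1%g); rewrite /continuous_at /= mulg1 => /(_ C1).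
    by apply; exact: open_nbhs_nbhs.
  pose K := [set h | M h /\ (forall a, A a -> A (a * h)%g) /\ forall a, A a -> A (a * h^-1)%g].
  have adK : adm K.
    split.
    - move=> g h [Mg [g1 g2]] [Mh [h1 h2]]; split; first exact: MM.
      split=> a' Aa'; first by rewrite mulgA; apply/h1/g1.
      by rewrite invgM mulgA; apply/g2/h2.
    - by move=> g [Mg [g1 g2]]; split; [exact: MV|split=> //; rewrite invgK].
    have N' : \forall h \near (1%g : G), forall a, A a -> C1 (a * h^-1)%g.
      by have := @invg_continuous G 1%g; rewrite /continuous_at invg1 => H; exact: (H _ N).
    apply: filterS3 M1 N N' => h h1 h2 h3 Hh; have Mh := h1 Hh; split => //.
    have AM a' : A a' -> M a' by rewrite AC1 => -[].
    split=> a' Aa'; rewrite AC1; split; [exact/MM/Mh/AM|exact: h2| |exact: h3].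
    by apply: MM; [exact: AM|exact: MV].
  apply/seteqP; split => [x|x Mx]; first by rewrite AC1 => -[].
  have Ma : M a by move: Aa; rewrite AC1 => -[].
  have [_ /(_ _ adK) [_ [H _]]] : M (a^-1 * x)%g by apply: MM => //; exact: MV.
  by have := H _ Aa; rewrite mulgA mulgV mul1g.
apply: filterS M1 => h hM Hh; exists M => //; last exact: hM.
by split => // g [].
Qed.

Lemma isotropy_component v g : isotropy v g -> \forall h \near g,
  isotropy v h -> connected_component (isotropy v) g h.
Proof.
move=> Hg; have := nbhs_translate g (isotropy_unit_component v).
apply: filterS => h H Hh.
have [|C [C1 CH Ccon] Ch] := H; first by apply: isotropyM => //; exact: isotropyV.
exists ((fun h => (g * h)%g) @` C); last by exists (g^-1 * h)%g => //; rewrite mulgA mulgV mul1g.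
split.
- by exists 1%g => //; rewrite mulg1.
- by move=> _ [x Cx <-]; apply: isotropyM => //; exact: CH.
apply: connected_continuous_connected => //; apply: continuous_subspaceT.
exact: mulgl_continuous.
Qed.

(** Components are open in the isotropy group by [isotropy_component], and that group is compact.
    [P] is [G] with base point 1. *)
Lemma components_finite v : finite_set (components rho v).
Proof.
pose P : ptopologicalType := HB.pack (LieGroup.sort G) (isPointed.Build (LieGroup.sort G) 1%g).
have cH : @compact P (isotropy v).
  by apply: (subclosed_compact _ G_compact) => //; exact: isotropy_closed.
move: cH; rewrite compact_cover => /(_ P (isotropy v)
  (fun g => (interior [set h : P | isotropy v h -> connected_component (isotropy v) g h]))).
case=> [g _|g Hg|D DH Dcov]; first exact: open_interior.
  by exists g => //; exact: isotropy_component.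
have sub : components rho v `<=` (fun g : P => connected_component (isotropy v) g) @` [set` D].
  move=> _ [g Hg <-]; have [h Dh /interior_subset/(_ Hg) gh] := Dcov _ Hg.
  by exists h => //; exact: same_connected_component.
by apply: (sub_finite_set sub); apply: finite_image; exact: finite_fset.
Qed.

(** Equal ranks make the isotropy algebras of x and v equal, so the action on x is a linear function
    [T] of the action on v. For g near 1 fixing v, write g x = e(y) x with |y| = O(|g x - x|). Then
    e(y) fixes v too, so y acts on v, and hence on x, with size o(|y|). Thus |y| = o(|y|), y = 0,
    and g fixes x. *)
Lemma isotropy_open x v : (forall g, rho g *m x = x -> rho g *m v = v) ->
  \rank (inf_act L x) = \rank (inf_act L v) ->
  \forall g \near (1%g : G), isotropy v g -> isotropy x g.
Proof.
move=> xv rk; pose Ax := inf_act L x; pose Av := inf_act L v.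
have kxv : (kermx Ax <= kermx Av)%MS.
  apply/sub_kermxP/row_matrixP => i; rewrite row0 row_mul.
  by apply: (inf_act_kernel rho_rep uc xv); rewrite -row_mul mulmx_ker row0.
have kvx : (kermx Av <= kermx Ax)%MS.
  by have := mxrank_leqif_sup kxv; rewrite !mxrank_ker /Ax /Av rk => -[_ <-].
pose T := pinvmx Av *m Ax.
have AT : Av *m T = Ax.
  apply/eqP; rewrite -subr_eq0; apply/eqP.
  rewrite /T mulmxA -[X in _ - X]mul1mx -mulmxBl; apply/sub_kermxP.
  by apply: submx_trans kvx; apply/sub_kermxP; rewrite mulmxBl mul1mx mulmxKpV// subrr.
have [C C0 lift] := local_lift rho_rep G_compact uc x.
pose cT := (n * 1)%:R * `|T|.
have cT0 : 0 <= cT by rewrite mulr_ge0.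
pose ep := (2 * (C * (cT + 1) + 1))^-1.
have c0 : 0 < C * (cT + 1) + 1 by rewrite ltr_wpDl// mulr_ge0// addr_ge0.
have ep0 : 0 < ep by rewrite invr_gt0 mulr_gt0.
have [r1 r10 h1] := act_diff0 rho_rep uc x ep0.
have [r2 r20 h2] := act_diff0 rho_rep uc v ep0.
have [|del del0 {}lift] := lift (Num.min r1 r2); first by rewrite lt_min r10.
have := @act_continuous _ _ _ _ rho_rep _ _ _ _ uc _ x 1%g.
rewrite /continuous_at (rho1 rho_rep) mul1mx => /cvgrPdist_lt /(_ _ del0).
apply: filterS => g; rewrite distrC => gx Hg.
have [y [+ yC gy]] := lift g gx; rewrite lt_min => /andP[y1 y2].
have yv : rho (e y) *m v = v.
  have : rho ((e y)^-1 * g)%g *m x = x by rewrite (rep_mul rho_rep) -mulmxA gy (rhoK rho_rep).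
  move=> /xv; rewrite (rep_mul rho_rep) -mulmxA Hg => E.
  by rewrite -{1}E (rhoVK rho_rep).
have b1 : `|y *m Av| <= ep * `|y|.
  have := h2 _ y2; rewrite yv subrr sub0r normrN.
  by rewrite -(mxvec_norm (vec_mx _)) vec_mxK.
have b2 : `|y *m Ax| <= cT * (ep * `|y|).
  by rewrite -AT mulmxA (le_trans (mulmx_norm _ _))// mulrAC ler_wpM2l.
have b3 : `|rho (e y) *m x - x| <= (cT + 1) * (ep * `|y|).
  rewrite -[X in `|X|](subrK (vec_mx (y *m Ax))) (le_trans (ler_normD _ _))//.
  by rewrite addrC mulrDl mul1r lerD//; [rewrite vec_mx_norm|exact: h1].
have y0 : `|y| <= 0.
  have : `|y| <= C * ((cT + 1) * (ep * `|y|)).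
    by rewrite (le_trans yC)// ler_wpM2l// gy.
  rewrite !mulrA => H.
  have : (C * (cT + 1) + 1) * ep = 2^-1.
    by rewrite /ep invfM mulrCA mulfV ?mulr1// gt_eqF.
  have : 0 <= ep * `|y| by rewrite mulr_ge0// ltW.
  move: H; rewrite mulrDl mul1r.
  move: (C * (cT + 1) * ep) => c H1 H2 H3.
  have {H1 H3} : `|y| <= 2^-1 * `|y| - ep * `|y|.
    by rewrite -H3 mulrDl addrK.
  have := normr_ge0 y; lra.
rewrite /Defs.isotropy/= gy; move: y0; rewrite normr_le0 => /eqP ->.
by rewrite (uc_0 uc) (rho1 rho_rep) mul1mx.
Qed.

(** G_x is open and closed in G_v, so its components are components of G_v. Their number is finite
    and not smaller than that of G_v, so every component of G_v occurs. *)
Lemma isotropy_eq x v : (forall g, rho g *m x = x -> rho g *m v = v) ->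
  \rank (inf_act L x) = \rank (inf_act L v) ->
  (components rho v #<= components rho x)%card ->
  isotropy x = isotropy v.
Proof.
move=> xv rk cvx; have op := isotropy_open xv rk.
have comp g : isotropy x g ->
    connected_component (isotropy x) g = connected_component (isotropy v) g.
  move=> Hg; apply/seteqP; split => h.
    by move=> [C [Cg CH Cc] Ch]; exists C => //; split => // k /CH; exact: xv.
  move=> [C [Cg CH Cc] Ch]; exists C => //; split => //.
  suff <- : C `&` isotropy x = C by move=> k [].
  apply: Cc; first by exists g.
    exists (interior [set k | isotropy v k -> isotropy x k]); first exact: open_interior.
    apply/seteqP; split => k [Ck Hk]; split => //; last first.
      by apply: (interior_subset Hk); exact: CH.
    have := nbhs_translate k op; apply: filterS => k' H Hk'.
    have -> : k' = (k * (k^-1 * k'))%g by rewrite mulgA mulgV mul1g.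
    apply: isotropyM => //; apply: H; apply: isotropyM => //; apply: isotropyV.
    exact: CH.
  by exists (isotropy x) => //; exact: isotropy_closed.
have sub : components rho x `<=` components rho v.
  by move=> _ [g Hg <-]; exists g; [exact: xv|rewrite comp].
have ceq : components rho x = components rho v.
  by apply: finite_subset_eq => //; exact: components_finite.
apply/seteqP; split => g; first exact: xv.
move=> Hg; have : components rho v (connected_component (isotropy v) g) by exists g.
rewrite -ceq => -[h Hh E].
apply: (@connected_component_sub _ _ h); rewrite E.
exact: connected_component_refl.
Qed.

End Isotropy.

Section Dot.
Variables (R : realType) (n : nat).

Definition dot (u w : 'cV[R]_n) : R := (u^T *m w) 0 0.

Lemma dotC u w : dot u w = dot w u.
Proof. by rewrite /dot -[in RHS](trmxK u) -trmx_mul [RHS]mxE. Qed.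

Lemma dotDr u v w : dot u (v + w) = dot u v + dot u w.
Proof. by rewrite /dot mulmxDr mxE. Qed.

Lemma dotZr a u w : dot u (a *: w) = a * dot u w.
Proof. by rewrite /dot -scalemxAr mxE. Qed.

Lemma dotNr u w : dot u (- w) = - dot u w.
Proof. by rewrite /dot mulmxN mxE. Qed.

Lemma dotDl u v w : dot (u + v) w = dot u w + dot v w.
Proof. by rewrite dotC dotDr !(dotC w). Qed.

Lemma dotZl a u w : dot (a *: u) w = a * dot u w.
Proof. by rewrite dotC dotZr dotC. Qed.

Lemma dotNl u w : dot (- u) w = - dot u w.
Proof. by rewrite dotC dotNr dotC. Qed.

Lemma dotE u w : dot u w = \sum_i u i 0 * w i 0.
Proof. by rewrite /dot mxE; apply: eq_bigr => i _; rewrite mxE. Qed.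

Lemma dot_ge0 u : 0 <= dot u u.
Proof. by rewrite dotE sumr_ge0// => i _; rewrite -expr2 sqr_ge0. Qed.

Lemma dot_eq0 u : dot u u <= 0 -> u = 0.
Proof.
move=> u0; have : dot u u == 0 by rewrite eq_le u0 dot_ge0.
rewrite dotE psumr_eq0 => [/allP h|i _]; last by rewrite -expr2 sqr_ge0.
apply/colP => i; have := h i (mem_index_enum i).
by rewrite mulf_eq0 orbb !mxE => /eqP.
Qed.

End Dot.

Section Principal.
Variables (R : realType) (G : lieGroupType R) (n : nat) (rho : G -> 'M[R]_n).
Hypothesis rho_rep : orthogonal_representation rho.
Hypothesis G_compact : compact [set: G].
Variables (d : nat) (e : 'rV[R]_d -> G) (L : 'M[R]_(d, n * n)) (r0 : R).
Hypothesis uc : unit_coordinates rho e L r0.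

Lemma dot_rho g u w : dot (rho g *m u) (rho g *m w) = dot u w.
Proof.
by rewrite /dot trmx_mul -mulmxA (mulmxA _ (rho g)) (rep_orthogonal rho_rep) mul1mx.
Qed.

(* Maximizing the inner product with [w] over the orbit of [u] amounts to
   minimizing the distance, all points of the orbit having the same norm. *)
Lemma exists_nearest u w : exists g, forall h,
  dot (rho h *m u) w <= dot (rho g *m u) w.
Proof.
have [||g _ gP] := @compact_EVT_max _ _ (fun g => dot (rho g *m u) w) [set: G] _ G_compact.
- by exists 1%g.
- apply: continuous_subspaceT => g.
  have cg := @act_continuous _ _ _ _ rho_rep _ _ _ _ uc _ u g.
  have cd : continuous (fun p : 'cV[R]_n => dot p w).
    move=> p; under eq_fun do rewrite dotC.
    have := @mulmx_continuous R _ _ 1 (w^T) p => /mx_continuousP; exact.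
  exact: (continuous_comp cg (cd _)).
by exists g => h; apply: gP; exact: mem_set.
Qed.

(** Let u' and w' be the images of u and w under h. Pairing the fixed point with w and using u'.w <=
    u.w gives w'.w >= w.w; since w' and w have equal length, |w' - w|^2 <= 0. So w' = w, and then u'
    = u. *)
Lemma nearest_isotropy u w (t : R) : 0 < t < 1 ->
  (forall h, dot (rho h *m u) w <= dot u w) ->
  forall h, rho h *m ((1 - t) *: u + t *: w) = (1 - t) *: u + t *: w ->
  rho h *m u = u /\ rho h *m w = w.
Proof.
move=> /andP[t0 t1] near h; have {near} := near h.
rewrite mulmxDr -!scalemxAr; have hw : dot (rho h *m w) (rho h *m w) = dot w w by exact: dot_rho.
move: (rho h *m u) (rho h *m w) hw => u' w' hw near E.
have Ew : (1 - t) * dot u' w + t * dot w' w = (1 - t) * dot u w + t * dot w w.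
  by rewrite -!dotZl -!dotDl E.
have w'E : w' = w.
  apply/eqP; rewrite -subr_eq0; apply/eqP/dot_eq0.
  rewrite dotDr !dotDl !dotNr !dotNl hw opprK (dotC w w').
  have : (1 - t) * dot u' w <= (1 - t) * dot u w by rewrite ler_wpM2l// subr_ge0 ltW.
  move=> H; have : 0 <= t * (dot w' w - dot w w) by rewrite mulrBr; move: Ew H; lra.
  by rewrite pmulr_rge0//; lra.
split => //; apply: (@scalerI _ _ (1 - t)); first by rewrite gt_eqF// subr_gt0.
by apply: (addIr (t *: w)); rewrite -{1}w'E E.
Qed.

Local Notation rk v := (\rank (inf_act L v)).

Lemma regularE v : regular rho v <-> forall w : 'cV[R]_n, (rk w <= rk v)%N.
Proof.
by split=> h w; have := h w; rewrite !(dimension_orbit rho_rep G_compact uc).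
Qed.

Lemma principal_isotropy_min x v : principal rho v ->
  (forall g, rho g *m x = x -> rho g *m v = v) ->
  isotropy rho x = isotropy rho v.
Proof.
move=> [vreg vmin] xv; have /regularE vmax := vreg.
have rE : rk x = rk v.
  by apply/eqP; rewrite eqn_leq vmax (rank_inf_act_le rho_rep uc xv).
apply: (isotropy_eq rho_rep G_compact uc xv rE); apply: vmin.
by apply/regularE; rewrite rE.
Qed.

Lemma principal_segment u w : principal rho w -> exists g, forall t, 0 < t < 1 ->
  principal rho ((1 - t) *: (rho g *m u) + t *: w).
Proof.
move=> wp; have [g near] := exists_nearest u w.
exists g => t t01; set x := _ + _.
have near' h : dot (rho h *m (rho g *m u)) w <= dot (rho g *m u) w.
  by rewrite mulmxA -(rep_mul rho_rep).
have xw h : rho h *m x = x -> rho h *m w = w by move=> /(nearest_isotropy t01 near')[].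
have E := principal_isotropy_min wp xw.
have [/regularE wreg wmin] := wp.
split; last by move=> y yreg; have := wmin y yreg; rewrite /components E.
apply/regularE => y; rewrite (leq_trans (wreg y))// .
exact: (rank_inf_act_le rho_rep uc xw).
Qed.

Lemma principal_isotropy v w : principal rho v -> principal rho w ->
  exists g, isotropy rho v = isotropy rho (rho g *m w).
Proof.
move=> vp wp; have [g near] := exists_nearest w v.
exists g; set w' := rho g *m w.
have t01 : (0 < 2^-1 :> R) && (2^-1 < 1 :> R) by rewrite invr_gt0 ltr0n/= invf_lt1// ltr1n.
have near' h : dot (rho h *m w') v <= dot w' v.
  by rewrite /w' mulmxA -(rep_mul rho_rep).
have xv := nearest_isotropy t01 near'.
set x := _ + _ in xv.
have Ev : isotropy rho x = isotropy rho v.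
  by apply: principal_isotropy_min vp _ => h /xv[].
(* Minimality is known at w rather than at w' = g w, so x is moved back by g^-1 and its isotropy
   group is conjugated accordingly. *)
have conj (u : 'cV[R]_n) h : rho h *m (rho g^-1%g *m u) = rho g^-1%g *m u <->
    rho (g * h * g^-1)%g *m u = u.
  rewrite !(rep_mul rho_rep) -!mulmxA; split => [->|{2}<-].
    by rewrite (rhoVK rho_rep).
  by rewrite (rhoK rho_rep).
have Ew : isotropy rho (rho g^-1%g *m x) = isotropy rho w.
  apply: principal_isotropy_min wp _ => h /conj/xv[+ _].
  by rewrite -[w](rhoK rho_rep g) -/w' => /conj.
apply/seteqP; split => h Hh.
  by have : isotropy rho x h by [rewrite Ev]; move=> /xv[].
rewrite -Ev; have : isotropy rho w (g^-1 * h * g)%g.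
  rewrite /isotropy/= !(rep_mul rho_rep) -!mulmxA -/w' Hh.
  by rewrite /w' (rhoK rho_rep).
rewrite -Ew => /conj; by rewrite !mulgA mulgV mul1g -mulgA mulgV mulg1.
Qed.

(** Ranks are bounded by [d], and finiteness of [components] lets the least number of components be
    attained among regular points. *)
Lemma principal_exists : exists v, principal rho v.
Proof.
pose P k := `[< exists v : 'cV[R]_n, rk v = k >].
have exP : exists k, P k.
  by exists (rk (0 : 'cV[R]_n)); apply/asboolP; exists 0.
have leP k : P k -> (k <= d)%N by move=> /asboolP[v <-]; exact: rank_leq_row.
have [v1 v1reg] : exists v : 'cV[R]_n, forall w : 'cV[R]_n, (rk w <= rk v)%N.
  have [k /asboolP[v vk] kmax] := ex_maxnP exP leP.
  exists v => w; rewrite vk.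
  by apply: kmax; apply/asboolP; exists w.
pose Q k := `[< exists v, regular rho v /\ (components rho v #= `I_k)%card >].
have exQ : exists k, Q k.
  have /finite_setP[k kE] := components_finite rho_rep G_compact uc v1.
  by exists k; apply/asboolP; exists v1; split => //; apply/regularE.
have [k /asboolP[v [vreg vk]] kmin] := ex_minnP exQ.
exists v; split => // w wreg.
have /finite_setP[l lE] := components_finite rho_rep G_compact uc w.
rewrite (card_le_eql vk) (card_le_eqr lE) card_le_II; apply: kmin.
by apply/asboolP; exists w.
Qed.

End Principal.

(** * The polynomial *)

Section PolynomialFunctions.
Import (canonicals, coercions) mpoly.
Variables (R : realType) (n : nat).
Implicit Types P : {mpoly R[n]}.

Lemma digits_inj k D (a b : 'I_k -> nat) :
  (forall i, (a i < D)%N) -> (forall i, (b i < D)%N) ->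
  (\sum_i a i * D ^ i = \sum_i b i * D ^ i)%N -> a =1 b.
Proof.
elim: k a b => [a b _ _ _ []//|k IH a b aD bD].
have D0 : (0 < D)%N by apply: leq_ltn_trans (aD ord0).
have E (c : 'I_k.+1 -> nat) : (\sum_i c i * D ^ i =
    c ord0 + (\sum_(i < k) c (lift ord0 i) * D ^ i) * D)%N.
  rewrite big_ord_recl expn0 muln1; congr (_ + _)%N.
  rewrite big_distrl; apply: eq_bigr => i _.
  by rewrite lift0 expnS mulnA mulnAC.
rewrite !E => H.
have h0 : a ord0 = b ord0.
  by move/(congr1 (modn^~ D)): H; rewrite ![(_ + _ * D)%N]addnC !modnMDl !modn_small.
move: H; rewrite h0 => /addnI/eqP; rewrite eqn_pmul2r// => /eqP H i.
case: (unliftP ord0 i) => [j|] -> //.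
exact: (IH (fun j => a (lift ord0 j)) (fun j => b (lift ord0 j))).
Qed.

Lemma poly_roots_all0 (q : {poly R}) : (forall x, q.[x] = 0) -> q = 0.
Proof.
move=> q0; apply/eqP/negPn/negP => qn0.
have := max_poly_roots qn0 (rs := [seq k%:R | k <- iota 0 (size q)]).
rewrite size_map size_iota ltnn => H; apply: notF; apply: H.
  by apply/allP => x _; rewrite /root q0.
by rewrite map_inj_uniq ?iota_uniq// => i j /eqP; rewrite eqr_nat => /eqP.
Qed.

(* Kronecker substitution [x_i := t ^ (D ^ i)]. *)
Lemma poly_eval_eq0 P : (forall v, poly_eval P v = 0) -> P = 0.
Proof.
move=> P0; pose D := mpoly.msize P.
pose wt (m : mpoly.multinom n) := (\sum_(i < n) m i * D ^ i)%N.
pose q : {poly R} := \sum_(m <- mpoly.msupp P) mpoly.mcoeff m P *: 'X^(wt m).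
have q0 : q = 0.
  apply: poly_roots_all0 => x; rewrite -[RHS](P0 (\col_i x ^+ (D ^ i))).
  rewrite /poly_eval mpoly.mevalE horner_sum; apply: eq_bigr => m _.
  rewrite hornerZ hornerXn; congr (_ * _).
  rewrite /wt -prodrXr; apply: eq_bigr => i _.
  by rewrite mxE -exprM mulnC.
apply/mpoly.mpolyP => m; rewrite mpoly.mcoeff0.
have [mP|/mpoly.memN_msupp_eq0//] := boolP (m \in mpoly.msupp P).
(* All exponents are below [D], so they are base-D digits of [wt] and distinct monomials go to
   distinct powers of t. *)
have bnd (m' : mpoly.multinom n) : m' \in mpoly.msupp P -> forall i, (m' i < D)%N.
  move=> m'P i; apply: leq_ltn_trans (mpoly.msize_mdeg_lt m'P).
  by rewrite mpoly.mdegE (bigD1 i)//= leq_addr.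
have : q`_(wt m) = 0 by rewrite q0 coef0.
rewrite /q coef_sum (bigD1_seq m)//= ?mpoly.msupp_uniq//.
rewrite coefZ coefXn eqxx mulr1 big_seq_cond big1 ?addr0// => m' /andP[m'P m'm].
rewrite coefZ coefXn; case: eqP => [/esym E|]; last by rewrite mulr0.
case/eqP: m'm; apply/mpoly.mnmP.
by apply: (@digits_inj _ D); [exact: bnd|exact: bnd|].
Qed.

Lemma poly_eval_inj P Q : (forall v, poly_eval P v = poly_eval Q v) -> P = Q.
Proof.
move=> PQ; apply/eqP; rewrite -subr_eq0; apply/eqP/poly_eval_eq0 => v.
by rewrite /poly_eval mpoly.mevalB; apply/eqP; rewrite subr_eq0; apply/eqP; exact: PQ.
Qed.

Lemma poly_eval_continuous P : continuous (fun v : 'cV[R]_n => poly_eval P v).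
Proof.
move=> v; rewrite /poly_eval; under eq_fun do rewrite mpoly.mevalE.
suff H : Ck 0 [set: 'cV[R]_n] (fun v : 'cV[R]_n =>
   \sum_(m <- mpoly.msupp P) mpoly.mcoeff m P * \prod_i v i 0 ^+ m i) by exact: (H v I).
apply: Ck_sum => [|m _]; first exact: openT.
apply: CkM; [exact: openT|exact: Ck_cst|].
apply: Ck_prod => [|i _]; first exact: openT.
have -> : (fun x : 'cV[R]_n => x i 0 ^+ m i) = (fun x => \prod_(k < m i) x i 0).
  by apply/funext => x; rewrite prodr_const card_ord.
apply: Ck_prod => [|_ _]; first exact: openT.
by move=> x _; have /mx_continuousP := @cvg_id _ (nbhs x); exact.
Qed.

Lemma homogeneous_prod (I : Type) (r : seq I) (F : I -> {mpoly R[n]}) :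
  (forall i, F i \is mpoly.ishomog1 1 mpoly.mdeg) ->
  \prod_(i <- r) F i \is mpoly.ishomog1 (size r) mpoly.mdeg.
Proof.
move=> hF; elim: r => [|i r IH]; first by rewrite big_nil mpoly.dhomog1.
by rewrite big_cons /= -add1n mpoly.dhomogM.
Qed.

Lemma homogeneous_det m (A : 'M[{mpoly R[n]}]_m) :
  (forall i j, A i j \is mpoly.ishomog1 1 mpoly.mdeg) ->
  \det A \is mpoly.ishomog1 m mpoly.mdeg.
Proof.
move=> hA; apply: rpred_sum => s _.
have H : \prod_i A i (s i) \is mpoly.ishomog1 m mpoly.mdeg.
  have := @homogeneous_prod _ (index_enum 'I_m) (fun i => A i (s i)) (fun i => hA i (s i)).
  by rewrite -[index_enum _]enumT size_enum_ord.
by case: (odd_perm s); rewrite ?expr1 ?expr0 ?mulN1r ?mul1r ?rpredN.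
Qed.

End PolynomialFunctions.

Section MinorPolynomial.
Import (canonicals, coercions) mpoly.
Variables (R : realType) (n N : nat) (Z : 'M[R]_(N, n * n)).

(** The entries of [frame_act Z v] as linear forms in the coordinates of v; hence an m x m minor is
    homogeneous of degree m. *)
Definition frame_poly : 'M[{mpoly R[n]}]_(N, n * 1) :=
  \matrix_(i, j) \sum_l frame_act Z (delta_mx l 0) i j *: mpoly.mpolyX R (mpoly.mnm1 l).

Lemma frame_poly_eval i j (v : 'cV[R]_n) :
  poly_eval (frame_poly i j) v = frame_act Z v i j.
Proof.
rewrite mxE /poly_eval raddf_sum /=.
rewrite [in RHS](matrix_sum_delta v) /frame_act.
under [X in lin_mulmxr X]eq_bigr do rewrite big_ord1.
rewrite linear_sum mulmx_sumr summxE; apply: eq_bigr => l _.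
by rewrite mpoly.mevalZ mpoly.mevalXU linearZ -scalemxAr [RHS]mxE mulrC.
Qed.

Definition minor_poly m (c : R) (p : {ffun 'I_m -> 'I_N} * {ffun 'I_m -> 'I_(n * 1)}) :
  {mpoly R[n]} := c *: \det (mxsub p.1 p.2 frame_poly).

Lemma minor_poly_eval m c p v :
  poly_eval (@minor_poly m c p) v = c * \det (mxsub p.1 p.2 (frame_act Z v)).
Proof.
rewrite /poly_eval mpoly.mevalZ -det_map_mx; congr (_ * \det _).
by apply/matrixP => i j; rewrite [LHS]mxE [in LHS]mxE [RHS]mxE -frame_poly_eval.
Qed.

(** The constant enters each square as [Num.sqrt c], so the polynomial is a sum of squares as
    written. *)
Definition volume_poly m (c : R) : {mpoly R[n]} := 
  \sum_(p : {ffun 'I_m -> 'I_N} * {ffun 'I_m -> 'I_(n * 1)}) minor_poly (Num.sqrt c) p ^+ 2.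

Lemma volume_poly_eval m c v : 0 <= c ->
  poly_eval (volume_poly m c) v = c * sqminors m (frame_act Z v).
Proof.
move=> c0; rewrite /poly_eval raddf_sum /sqminors pair_big mulr_sumr /=.
apply: eq_bigr => p _; rewrite rmorphXn /=.
by have := minor_poly_eval (Num.sqrt c) p v; rewrite /poly_eval => ->; rewrite exprMn sqr_sqrtr.
Qed.

Lemma volume_poly_homogeneous m c : homogeneous (volume_poly m c).
Proof.
exists (m * 2)%N; apply: rpred_sum => p _; apply: mpoly.dhomogMn.
apply: mpoly.dhomogZ; apply: homogeneous_det => i j; rewrite !mxE.
apply: rpred_sum => l _; apply: mpoly.dhomogZ.
by rewrite mpoly.dhomogX; apply/eqP; exact: mpoly.mdeg1.
Qed.

Lemma volume_poly_sum_of_squares m c : sum_of_squares (volume_poly m c).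
Proof.
by exists [seq @minor_poly m (Num.sqrt c) p | p <- index_enum _]; rewrite big_map.
Qed.

End MinorPolynomial.

(** * Existence and uniqueness of the volume polynomial *)

Theorem theorem1 (R : realType) (G : lieGroupType R)
    (G_compact : compact [set: G]) (G_connected : connected [set: G])
    (n : nat) (rho : G -> 'M[R]_n)
    (rho_rep : orthogonal_representation rho) :
  exists P : {mpoly R[n]},
    unique (fun Q : {mpoly R[n]} =>
      [/\ forall v, Vprinc rho v -> (orbit_volume rho v ^+ 2)%E = (poly_eval Q v)%:E,
          forall g v, poly_eval Q (rho g *m v) = poly_eval Q v &
          homogeneous Q]) P /\
    sum_of_squares P.
Proof.
have [d [e [L [r0 uc]]]] := unit_coordinates_exist rho_rep.
have [Z [ZZ ZL]] := orthonormal_row_base L.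
have [v0 v0p] := principal_exists rho_rep G_compact uc.
pose m := \rank (inf_act L v0).
have [a a0 aE] := volume_finite rho_rep G_compact uc v0.
(* The constant is read off at one principal point [v0], whose orbit has volume [a]. *)
pose c := a ^+ 2 / sqminors m (frame_act Z v0).
have c0 : 0 <= c by rewrite divr_ge0 ?sqr_ge0 ?sqminors_ge0.
have vol_eval v : Vprinc rho v ->
    (orbit_volume rho v ^+ 2)%E = (poly_eval (volume_poly Z m c) v)%:E.
  move=> [w wp [h _ <-]]; rewrite volume_poly_eval//.
  rewrite (sqminors_frame_mul rho_rep G_compact uc ZZ ZL).
  (* Moving w within its orbit gives it exactly the isotropy group of [v0]; volume and [sqminors] do
     not change. *)
  have [g gE] := principal_isotropy rho_rep G_compact uc v0p wp.
  have vol k u : orbit_volume rho (rho k *m u) = orbit_volume rho u.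
    by rewrite /orbit_volume (orbit_mul rho_rep).
  have v0w k : rho k *m v0 = v0 -> rho k *m (rho g *m w) = rho g *m w.
    by move=> kv; have : isotropy rho v0 k by []; rewrite gE.
  have wv0 k : rho k *m (rho g *m w) = rho g *m w -> rho k *m v0 = v0.
    by move=> kw; have : isotropy rho (rho g *m w) k by []; rewrite -gE.
  have := orbit_volume_transfer rho_rep G_compact uc ZZ ZL v0w wv0.
  rewrite /= -/m !vol (sqminors_frame_mul rho_rep G_compact uc ZZ ZL) => ->.
  rewrite /orbit_volume (dimension_orbit rho_rep G_compact uc) aE.
  by rewrite -!EFinM -expr2 /c mulrA mulrAC.
have vol_inv g v : poly_eval (volume_poly Z m c) (rho g *m v) = poly_eval (volume_poly Z m c) v.
  by rewrite !volume_poly_eval// (sqminors_frame_mul rho_rep G_compact uc ZZ ZL).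
exists (volume_poly Z m c); split; last exact: volume_poly_sum_of_squares.
split; first by split => //; exact: volume_poly_homogeneous.
move=> Q [Qvol Qinv _]; apply: poly_eval_inj => u.
have [g gP] := principal_segment rho_rep G_compact uc u v0p.
pose x t := (1 - t) *: (rho g *m u) + t *: v0.
have x0E : x 0 = rho g *m u by rewrite /x subr0 scale1r scale0r addr0.
(* Both polynomials agree on [x t] for 0 < t < 1. Letting t tend to 0 from the right, they agree at
   g u, and by invariance at u. *)
have lim P : poly_eval P (x t) @[t --> 0^'+] --> poly_eval P (rho g *m u).
  rewrite -x0E; apply: cvg_at_right_filter.
  apply: (@continuous_comp _ _ _ x (fun v => poly_eval P v)); last exact: poly_eval_continuous.
  apply: cvgD; apply: cvgZr_tmp; last exact: cvg_id.
  by apply: cvgB; [exact: cvg_cst|exact: cvg_id].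
have V1 v : Vprinc rho v -> poly_eval (volume_poly Z m c) v = poly_eval Q v.
  move=> vp; apply: EFin_inj; rewrite -Qvol//; exact/esym/vol_eval.
rewrite -(vol_inv g) -(Qinv g).
apply: (cvg_unique _ (lim _)) => //.
apply: cvg_trans (lim Q); apply: near_eq_cvg; near=> t.
apply/esym/V1; exists (x t); last by exists 1%g; rewrite // (rho1 rho_rep) mul1mx.
by apply: gP; apply/andP; split; near: t; [exact: nbhs_right_gt|exact: nbhs_right_lt].
Unshelve. all: by end_near. Qed.
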